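(* Let $\Omega \subset \mathbb{R}^n$ be open and let $\phi(x,\theta)$ be a phase function of order $\mu$ on $\Omega \times \mathbb{R}^s$. Then there is a unique way of defining $D_\phi(a) \in \mathcal{D}'(\Omega)$ for $a \in S^{\infty}(\Omega, s)$ such that $D_\phi(a)$ coincides with the function $$x \mapsto \int_{\mathbb{R}^s} a(x,\theta)\, e^{i\phi(x,\theta)}\, \mathrm{d}^s\theta$$ when $a \in S^{m}(\Omega,s)$ for some $m < -s$, and such that, for all $m$, the map $D_\phi : S^{m}(\Omega,s) \to \mathcal{D}'(\Omega)$ is continuous. Moreover, if $p \in \mathbb{N}_0$ and $m - p\mu < -s$, then the map $D_\phi : S^{m}(\Omega,s) \to \mathcal{D}'^{(p)}(\Omega)$ is continuous.
   Context: Symbols: for an open set $\Omega\subset\mathbb{R}^n$ and $m\in\mathbb{R}$, $S^{m}(\Omega,s)$ is the set of (smooth) functions $a:\Omega\times\mathbb{R}^s\to\mathbb{C}$ such that for each compact $K\subset\Omega$ and all multiindices $\alpha,\beta$, $$\|a\|_{\alpha\beta K} = \sup_{x\in K,\,\theta\in\mathbb{R}^s} |(D_x^\alpha D_\theta^\beta a)(x,\theta)|\,(1+|\theta|)^{|\beta|-m} < \infty ,$$ equipped with these seminorms; its elements are called symbols of order $m$. $S^{-\infty}(\Omega,s)=\bigcap_m S^m(\Omega,s)$ and $S^{\infty}(\Omega,s)=\bigcup_m S^m(\Omega,s)$. Phase functions: a phase function of order $\mu$ on $\Omega\times\mathbb{R}^s$ is a function $\phi:\Omega\times\mathbb{R}^s\to\mathbb{R}$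 such that (1) $\phi$ is a symbol of order $\mu>0$; (2) for each compact $K\subset\Omega$ there are positive $C,D$ such that $|\nabla_x\phi(x,\theta)|^2+|\theta|^2|\nabla_\theta\phi(x,\theta)|^2\ge C|\theta|^{2\mu}$ for all $|\theta|\ge D$, $x\in K$. $C_0^k(\Omega)$ denotes the $k$ times continuously differentiable functions with compact support in $\Omega$; $\mathcal{D}'^{(k)}(\Omega)$ is the dual space of $C_0^k(\Omega)$, and $\mathcal{D}'(\Omega)=\mathcal{D}'^{(\infty)}(\Omega)$. *)

(* Defs.v *)
From HB Require Import structures.
From mathcomp Require Import all_boot all_order all_algebra.
From mathcomp Require Import complex.
From mathcomp Require Import all_classical all_reals all_analysis.

Set Implicit Arguments.
Unset Strict Implicit.
Unset Printing Implicit Defensive.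

Import Order.TTheory GRing.Theory Num.Theory numFieldNormedType.Exports.
Import ComplexField.

Local Open Scope classical_set_scope.
Local Open Scope ring_scope.
Local Open Scope complex_scope.

Notation cabs := Normc.normc.

Definition enorm (R : realType) N (x : 'rV[R]_N) : R :=
  Num.sqrt (\sum_j x ord0 j ^+ 2).

Section differentiation.
Context {R : realType} {V : normedModType R}.

(* e : I -> V is the family of coordinate directions of V. *)
Fixpoint Cn (I : Type) (e : I -> V) (k : nat) (A : set V) (f : V -> R) : Prop :=
  (forall x, A x -> {for x, continuous f}) /\
  if k is j.+1 then
    forall i, (forall x, A x -> derivable f x (e i)) /\
              Cn e j A (fun x => 'D_(e i) f x)
  else True.

(* An order of differentiability is [Some k] for k in N, or [None] for oo. *)
Definition le_order (j : nat) (k : option nat) : Prop :=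
  if k is Some p then (j <= p)%N else True.

Definition Cclass (I : Type) (e : I -> V) (k : option nat) (A : set V)
    (f : V -> R[i]) : Prop :=
  forall j, le_order j k ->
    Cn e j A (fun x => complex.Re (f x)) /\ Cn e j A (fun x => complex.Im (f x)).

Definition cderive (v : V) (f : V -> R[i]) (x : V) : R[i] :=
  'D_v (fun y => complex.Re (f y)) x +i* 'D_v (fun y => complex.Im (f y)) x.

Definition mdegree N (alpha : 'I_N -> nat) : nat := (\sum_i alpha i)%N.

Definition partial N (e : 'I_N -> V) (alpha : 'I_N -> nat) (f : V -> R[i]) :
    V -> R[i] :=
  foldr (fun i => iter (alpha i) (cderive (e i))) f (enum 'I_N).

End differentiation.

Definition dirv (R : realType) N (i : 'I_N) : 'rV[R]_N := delta_mx ord0 i.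

Section joint_directions.
Context {R : realType} {n s : nat}.

Definition dirx (i : 'I_n) : 'rV[R]_n * 'rV[R]_s := (dirv R i, 0).
Definition dirt (j : 'I_s) : 'rV[R]_n * 'rV[R]_s := (0, dirv R j).
Definition dirxt (k : 'I_n + 'I_s) : 'rV[R]_n * 'rV[R]_s :=
  match k with inl i => dirx i | inr j => dirt j end.

End joint_directions.

(* The balls of a family P of (extended-valued) seminorms on V, pulled
   back along val : E -> V; as a subbase they generate the topology that the
   seminorms define on E. *)
Definition seminorm_balls (R : realType) (E : Type) (V : zmodType)
    (val : E -> V) (P : set (V -> \bar R)) : set (set E) :=
  [set B | exists p c e, [/\ P p, 0 < e &
     B = [set x | (p (val x - val c)%R < e%:E)%E]]].

Section symbols.
Context {R : realType} {n : nat}.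
Variables (Omega : set 'rV[R]_n) (s : nat).

(* Since |(-i)^(|alpha|+|beta|)| = 1, the plain partial derivatives have the same
   modulus as D_x^alpha D_theta^beta with D = -i d. *)
Definition symbol_norm (m : R) (alpha : 'I_n -> nat) (beta : 'I_s -> nat)
    (K : set 'rV[R]_n) (a : 'rV[R]_n * 'rV[R]_s -> R[i]) : \bar R :=
  ereal_sup [set (cabs (partial dirx alpha (partial dirt beta a) z) *
      (1 + enorm z.2) `^ ((mdegree beta)%:R - m))%:E | z in [set z | K z.1]].

Definition is_symbol (m : R) (a : 'rV[R]_n * 'rV[R]_s -> R[i]) : Prop :=
  Cclass dirxt None (Omega `*` setT) a /\
  forall K, compact K -> K `<=` Omega ->
    forall alpha beta, (symbol_norm m alpha beta K a < +oo)%E.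

(* A function on Omega x R^s is represented by its extension by zero. *)
Definition zero_outside (a : 'rV[R]_n * 'rV[R]_s -> R[i]) : Prop :=
  forall z, ~ Omega z.1 -> a z = 0.

Definition symbol_pred (m : R) : {pred 'rV[R]_n * 'rV[R]_s -> R[i]} :=
  fun a => `[< is_symbol m a /\ zero_outside a >].

Record symbols (m : R) := Symbol {
  symbol_fun :> 'rV[R]_n * 'rV[R]_s -> R[i] ;
  symbol_funP : symbol_fun \in symbol_pred m }.

HB.instance Definition _ m := [isSub for @symbol_fun m].
HB.instance Definition _ m := [Choice of symbols m by <:].

Definition symbol_norms (m : R) :
    set (('rV[R]_n * 'rV[R]_s -> R[i]) -> \bar R) :=
  [set p | exists alpha beta K, [/\ compact K, K `<=` Omega &
     p = symbol_norm m alpha beta K]].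

HB.instance Definition _ m := isSubBaseTopological.Build (symbols m)
  (seminorm_balls (@symbol_fun m) (symbol_norms m)) id.

Definition symbol_oo_pred : {pred 'rV[R]_n * 'rV[R]_s -> R[i]} :=
  fun a => `[< (exists m, is_symbol m a) /\ zero_outside a >].

Record symbols_oo := SymbolOo {
  symbol_oo_fun :> 'rV[R]_n * 'rV[R]_s -> R[i] ;
  symbol_oo_funP : symbol_oo_fun \in symbol_oo_pred }.

HB.instance Definition _ := [isSub for symbol_oo_fun].
HB.instance Definition _ := [Choice of symbols_oo by <:].

Lemma symbol_oo_subproof m (a : symbols m) : symbol_fun a \in symbol_oo_pred.
Proof.
have /asboolP[sa za] := symbol_funP a.
by apply/asboolP; split=> //; exists m.
Qed.

Definition symbol_incl m (a : symbols m) : symbols_oo :=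
  SymbolOo (symbol_oo_subproof a).

Definition gradx_sq (phi : 'rV[R]_n * 'rV[R]_s -> R) z : R :=
  \sum_i ('D_(dirx i) phi z) ^+ 2.
Definition gradt_sq (phi : 'rV[R]_n * 'rV[R]_s -> R) z : R :=
  \sum_j ('D_(dirt j) phi z) ^+ 2.

Definition is_phase (mu : R) (phi : 'rV[R]_n * 'rV[R]_s -> R) : Prop :=
  [/\ 0 < mu, is_symbol mu (fun z => (phi z)%:C) &
    forall K, compact K -> K `<=` Omega ->
      exists C D : R, [/\ 0 < C, 0 < D &
        forall x theta, K x -> D <= enorm theta ->
          C * enorm theta `^ (2 * mu) <=
          gradx_sq phi (x, theta) +
            enorm theta ^+ 2 * gradt_sq phi (x, theta)]].

End symbols.

Section test_functions.
Context {R : realType} {n : nat}.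
Variables (Omega : set 'rV[R]_n) (k : option nat).

Definition supp (u : 'rV[R]_n -> R[i]) : set 'rV[R]_n :=
  closure [set x | u x != 0].

(* An element of C_0^k(Omega) is represented by its extension by zero, which is
   of class C^k on the whole of R^n. *)
Definition is_test (u : 'rV[R]_n -> R[i]) : Prop :=
  [/\ Cclass (@dirv R n) k setT u, compact (supp u) & supp u `<=` Omega].

Definition test_pred : {pred 'rV[R]_n -> R[i]} := fun u => `[< is_test u >].

Lemma Cn_lincomb j (f g : 'rV[R]_n -> R) (a b : R) :
  Cn (@dirv R n) j setT f -> Cn (@dirv R n) j setT g ->
  Cn (@dirv R n) j setT (a \*: f + b \*: g).
Proof.
have cZ (c : R) (h : 'rV[R]_n -> R) x :
    {for x, continuous h} -> {for x, continuous (c \*: h)}.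
  by move=> hx; exact: cvgZl_tmp hx.
elim: j f g => [|j IH] f g [cf df] [cg dg]; split=> //.
- by move=> x _; apply: continuousD; apply: cZ; [exact: cf|exact: cg].
- by move=> x _; apply: continuousD; apply: cZ; [exact: cf|exact: cg].
move=> i; have [df1 df2] := df i; have [dg1 dg2] := dg i.
have dfx x : derivable (a \*: f) x (dirv R i) by apply: derivableZ; exact: df1.
have dgx x : derivable (b \*: g) x (dirv R i) by apply: derivableZ; exact: dg1.
split=> [x _|]; first exact: derivableD (dfx x) (dgx x).
rewrite (_ : (fun x => _) = (a \*: (fun x => 'D_(dirv R i) f x)) +
  (b \*: (fun x => 'D_(dirv R i) g x))); first exact: IH.
apply/funext => x; rewrite deriveD// !deriveZ//; [exact: dg1|exact: df1].
Qed.

Lemma supp_lincomb (c : R[i]) (u v : 'rV[R]_n -> R[i]) :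
  supp (c *: u + v) `<=` supp u `|` supp v.
Proof.
rewrite /supp -closureU; apply: closure_subset => x /=.
have [ux|ux _] := eqVneq (u x) 0; last by left.
have [vx|vx _] := eqVneq (v x) 0; last by right.
have -> : (c *: u + v) x = c * u x + v x by [].
by rewrite ux vx mulr0 addr0 eqxx.
Qed.

Lemma test_submod_closed : submod_closed test_pred.
Proof.
split=> [|c u v /asboolP[cu ku su] /asboolP[cv kv sv]]; apply/asboolP.
  have s0 : supp (0 : 'rV[R]_n -> R[i]) = set0.
    rewrite /supp (_ : [set x | _] = set0) ?closure0//.
    by apply/seteqP; split => x //=; rewrite eqxx.
  split; rewrite ?s0//; last exact: compact0.
  have C0 j : Cn (@dirv R n) j setT (fun=> 0 : R).
    elim: j => [|j IH]; (split=> [x _|//]; first exact: cst_continuous).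
    move=> i; split=> [x _|]; first exact: derivable_cst.
    by rewrite (_ : (fun x => _) = (fun=> 0 : R))//; apply/funext => x;
      exact: derive_cst.
  by move=> j _; split.
have sub := @supp_lincomb c u v; split.
- move=> j jk; have [cu1 cu2] := cu j jk; have [cv1 cv2] := cv j jk.
  split.
  + rewrite (_ : (fun x => _) = 1 \*: (complex.Re c \*: (fun x => complex.Re (u x)) +
        (- complex.Im c) \*: (fun x => complex.Im (u x))) +
        1 \*: (fun x => complex.Re (v x))).
      by apply: Cn_lincomb => //; exact: Cn_lincomb.
    apply/funext => x.
    have -> : (c *: u + v) x = c * u x + v x by [].
    rewrite /= /GRing.add/= /GRing.scale/= !mul1r.
    by case: (c) (u x) (v x) => [a b] [a' b'] [a'' b''] /=; rewrite mulNr.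
  + rewrite (_ : (fun x => _) = 1 \*: (complex.Re c \*: (fun x => complex.Im (u x)) +
        complex.Im c \*: (fun x => complex.Re (u x))) +
        1 \*: (fun x => complex.Im (v x))).
      by apply: Cn_lincomb => //; exact: Cn_lincomb.
    apply/funext => x.
    have -> : (c *: u + v) x = c * u x + v x by [].
    rewrite /= /GRing.add/= /GRing.scale/= !mul1r.
    by case: (c) (u x) (v x) => [a b] [a' b'] [a'' b''] /=.
- apply: subclosed_compact (compactU ku kv) sub; exact: closed_closure.
- by apply: (subset_trans sub); rewrite subUset.
Qed.

HB.instance Definition _ :=
  GRing.isSubmodClosed.Build R[i] ('rV[R]_n -> R[i]) test_pred
    test_submod_closed.

Record tests := Test {
  test_fun :> 'rV[R]_n -> R[i] ;
  test_funP : test_fun \in test_pred }.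

HB.instance Definition _ := [isSub for test_fun].
HB.instance Definition _ := [Choice of tests by <:].
HB.instance Definition _ := [SubChoice_isSubLmodule of tests by <:].

(* The topology of C_0^k(Omega) is the locally convex inductive limit of the
   spaces C_K^k, K compact in Omega: it is generated by all the seminorms whose
   restriction to every C_K^k is continuous. *)
Definition sup_norm (alpha : 'I_n -> nat) (u : 'rV[R]_n -> R[i]) : \bar R :=
  ereal_sup [set (cabs (partial (@dirv R n) alpha u x))%:E | x in setT].

Definition is_seminorm (q : tests -> R) : Prop :=
  (forall u v, q (u + v) <= q u + q v) /\
  (forall (c : R[i]) u, q (c *: u) = cabs c * q u).

Definition continuous_on_CK (q : tests -> R) (K : set 'rV[R]_n) : Prop :=
  exists (A : seq ('I_n -> nat)) (C : R),
    [/\ 0 <= C, forall alpha, alpha \in A -> le_order (mdegree alpha) k &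
      forall u : tests, supp u `<=` K ->
        ((q u)%:E <= C%:E * \sum_(alpha <- A) sup_norm alpha u)%E].

Definition test_norms : set (tests -> \bar R) :=
  [set p | exists q : tests -> R, [/\ is_seminorm q,
     forall K, compact K -> K `<=` Omega -> continuous_on_CK q K &
     p = (fun u => (q u)%:E)]].

HB.instance Definition _ :=
  isSubBaseTopological.Build tests (seminorm_balls id test_norms) id.

Definition distr_pred : {pred tests -> R[i]} :=
  fun T => `[< scalar T /\ continuous (T : tests -> R[i]^o) >].

Record distr := Distr {
  distr_fun :> tests -> R[i] ;
  distr_funP : distr_fun \in distr_pred }.

HB.instance Definition _ := [isSub for distr_fun].
HB.instance Definition _ := [Choice of distr by <:].

(* [distr] is the topological dual of C_0^k(Omega), with the weak-* topology. *)
Definition weak_star_norms : set ((tests -> R[i]) -> \bar R) :=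
  [set p | exists u, p = (fun T => (cabs (T u))%:E)].

HB.instance Definition _ :=
  isSubBaseTopological.Build distr (seminorm_balls distr_fun weak_star_norms) id.

End test_functions.

Section test_inclusion.
Context {R : realType} {n : nat}.
Variables (Omega : set 'rV[R]_n) (p : nat).

Lemma test_incl_subproof (u : tests Omega None) :
  test_fun u \in test_pred Omega (Some p).
Proof.
have /asboolP[cu ku su] := test_funP u.
by apply/asboolP; split=> // j _; exact: cu.
Qed.

Definition test_incl (u : tests Omega None) : tests Omega (Some p) :=
  Test (test_incl_subproof u).

End test_inclusion.

(* Lebesgue measure on R^N, as the N-fold product of the one-dimensional one. *)
Section lebesgue_cons.
Context {R : realType} {N : nat}.
Local Notation T := (measurableTypeR R).
Variable mu : {sigma_finite_measure set (N.-tuple T) -> \bar R}.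

Definition tcons (z : T * N.-tuple T) : N.+1.-tuple T := [tuple of z.1 :: z.2].

Lemma measurable_tcons : measurable_fun setT tcons.
Proof. exact: measurable_cons. Qed.

Definition lebesgue_cons : set (N.+1.-tuple T) -> \bar R :=
  pushforward (@lebesgue_measure R \x mu)%E tcons.

Let lebesgue_cons0 : lebesgue_cons set0 = 0%E.
Proof. by rewrite /lebesgue_cons /pushforward preimage_set0 measure0. Qed.

Let lebesgue_cons_ge0 A : (0 <= lebesgue_cons A)%E.
Proof. by rewrite /lebesgue_cons /pushforward measure_ge0. Qed.

Let lebesgue_cons_sigma_additive : semi_sigma_additive lebesgue_cons.
Proof.
move=> F mF tF mUF; rewrite /lebesgue_cons /pushforward preimage_bigcup.
apply: measure_semi_sigma_additive.
- by move=> i; rewrite -[X in measurable X]setTI; exact: measurable_tcons.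
- apply/trivIsetP => /= i j _ _ ij; rewrite -preimage_setI.
  by move/trivIsetP : tF => /(_ _ _ _ _ ij) ->//; rewrite preimage_set0.
- by rewrite -preimage_bigcup -[X in measurable X]setTI; exact: measurable_tcons.
Qed.

HB.instance Definition _ := isMeasure.Build _ _ _ lebesgue_cons
  lebesgue_cons0 lebesgue_cons_ge0 lebesgue_cons_sigma_additive.

Let tuncons (t : N.+1.-tuple T) : T * N.-tuple T :=
  (thead t, [tuple of behead t]).

Let measurable_tuncons : measurable_fun setT tuncons.
Proof.
apply: measurable_fun_pair; last exact: measurable_behead.
exact: measurable_tnth.
Qed.

Let lebesgue_cons_sigma_finite : sigma_finite setT lebesgue_cons.
Proof.
have /sigma_finiteP[F [FT ndF mF]] := sigma_finiteT (@lebesgue_measure R).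
have /sigma_finiteP[G [GT ndG mG]] := sigma_finiteT mu.
exists (fun i => tuncons @^-1` (F i `*` G i)).
  rewrite -preimage_bigcup; apply/seteqP; split => // t _.
  have [i _ Fi] : (\bigcup_i F i) (tuncons t).1 by rewrite -FT.
  have [j _ Gj] : (\bigcup_i G i) (tuncons t).2 by rewrite -GT.
  exists (maxn i j) => //; split.
  - by move: Fi; exact/subsetPset/ndF/leq_maxl.
  - by move: Gj; exact/subsetPset/ndG/leq_maxr.
move=> i; have [mFi Fi] := mF i; have [mGi Gi] := mG i; split.
  by rewrite -[X in measurable X]setTI; apply: measurable_tuncons => //;
    exact: measurableX.
rewrite /lebesgue_cons /pushforward -comp_preimage (_ : tuncons \o tcons = id).
  by rewrite preimage_id product_measure1E// lte_mul_pinfty// ge0_fin_numE.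
by apply/funext => -[x t]; congr pair; apply: val_inj.
Qed.

HB.instance Definition _ := Measure_isSigmaFinite.Build _ _ _ lebesgue_cons
  lebesgue_cons_sigma_finite.

End lebesgue_cons.

Fixpoint lebesgueN (R : realType) (N : nat) :
    {sigma_finite_measure set (N.-tuple (measurableTypeR R)) -> \bar R} :=
  match N with
  | 0 => \d_[tuple]
  | M.+1 => lebesgue_cons (lebesgueN R M)
  end.

Definition rv_of_tuple (R : realType) N (t : N.-tuple (measurableTypeR R)) :
  'rV[R]_N := \row_j tnth t j.

Section oscillatory_integrals.
Context {R : realType}.

Definition cintegral N (A : set 'rV[R]_N) (f : 'rV[R]_N -> R[i]) : R[i] :=
  (\int[lebesgueN R N]_(t in @rv_of_tuple R N @^-1` A)
     complex.Re (f (rv_of_tuple t))) +i*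
  (\int[lebesgueN R N]_(t in @rv_of_tuple R N @^-1` A)
     complex.Im (f (rv_of_tuple t))).

Definition cexpi (t : R) : R[i] := cos t +i* sin t.

Context {n s : nat}.
Variables (Omega : set 'rV[R]_n) (phi : 'rV[R]_n * 'rV[R]_s -> R).

Definition osc_fun (a : 'rV[R]_n * 'rV[R]_s -> R[i]) (x : 'rV[R]_n) : R[i] :=
  cintegral setT (fun theta => a (x, theta) * cexpi (phi (x, theta))).

(* A function f on Omega is identified with the distribution u |-> int f u. *)
Definition coincides (k : option nat) (T : distr Omega k)
    (f : 'rV[R]_n -> R[i]) : Prop :=
  forall u : tests Omega k, T u = cintegral Omega (fun x => f x * u x).

Definition is_Dphi (D : symbols_oo Omega s -> distr Omega None) : Prop :=
  (forall (m : R) (a : symbols Omega s m), m < - s%:R ->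
     coincides (D (symbol_incl a)) (osc_fun a)) /\
  (forall m : R, continuous (fun a : symbols Omega s m => D (symbol_incl a))).

End oscillatory_integrals.

(* Main.v *)
Require Import Defs.
From mathcomp Require Import all_boot all_order all_algebra.
From mathcomp Require Import complex ring lra.
From mathcomp Require Import all_classical all_reals all_analysis.
From mathcomp Require Import measurable_realfun.

Set Implicit Arguments.
Unset Strict Implicit.
Unset Printing Implicit Defensive.

Import Order.TTheory GRing.Theory Num.Theory numFieldNormedType.Exports.
Local Open Scope classical_set_scope.
Local Open Scope ring_scope.

(** Let e_k be the coordinate directions of R^n x R^s, with kappa_k = 1 for the
x directions and kappa_k = |theta|^2 for the theta directions, and put
Q = sum_k kappa_k (d_k phi)^2.  The lower bound in the definition of a phase
says that Q dominates |theta|^(2 mu) for large theta, locally uniformly in x.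
Since Q >= 0, the function 1 + Q is then a positive elliptic symbol of order
2 mu on the whole of Omega x R^s, and w = 1 / (1 + Q) is a symbol of order
-2 mu.  Hence b_k = w kappa_k d_k phi has order -mu in the x directions and
1 - mu in the theta directions, and  w + sum_k b_k d_k phi = 1
([damping_field_id]).  No cutoff near theta = 0 or near the critical points of
phi is required.

Since d_k phi cos (phi + tau) is the k-th derivative of
cos (phi + tau - pi / 2), integration by parts gives, for an amplitude A of
order m < -s that is compactly supported in x,
  I_tau (A) = I_tau (w A) - I_(tau - pi/2) (sum_k d_k (b_k A)),
where I_tau (A) is the integral of A cos (phi + tau)
([integration_by_parts_osc]).  Both amplitudes on the right have order m - mu
and have lost at most one derivative.  Read from right to left, the identity
*defines* the left hand side when only m - mu < -s; iterating it p times
defines I_tau (A) for amplitudes of class C^p with m - p mu < -s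
([real_osc]).  The value does not depend on p ([real_osc_step]), is linear in
A ([real_osc_lin]), and is bounded by the symbol bounds of A up to order p
([real_osc_bound]).  Inserting A = a(x, theta) u(x) and combining the phases
tau = 0 and tau = - pi / 2 into exp (i phi) yields D_phi (a) (u), together with
all the continuity statements: the bound involves only derivatives of u up to
order p.

For uniqueness, a / (1 + eps |theta|^2) has order m - 2 and converges to a in
the topology of order m + 2 as eps tends to 0, because the derivatives of
1 / (1 + eps |theta|^2) satisfy symbol bounds of order 0 that are uniform in eps.
Two continuous extensions that agree on order m - 2 therefore agree on order m,
and they agree by assumption on orders below -s ([Dphi_agree]). *)

(** * Directional derivatives and the classes C^k *)

Section lines.
Context {R : realType} {V : normedModType R}.

(** Reduces calculus along a direction to calculus in one real variable. *)
Lemma is_derive_line (f : V -> R) z v (t df : R) :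
  is_derive (z + t *: v) v f df <->
  is_derive t 1 (fun r : R => f (z + r *: v)) df.
Proof.
have E : (fun h : R => h^-1 *: ((f \o shift (z + t *: v)) (h *: v) - f (z + t *: v)))
   = (fun h : R => h^-1 *: (((fun r : R => f (z + r *: v)) \o shift t) (h *: (1:R))
       - f (z + t *: v))).
  apply/funext => h /=; congr (_ *: (f _ - _)).
  by rewrite [h *: 1]mulr1 scalerDl addrCA.
split=> -[ex ev]; split.
- by move: ex; rewrite /derivable E.
- by move: ev; rewrite /derive E.
- by move: ex; rewrite /derivable -E.
- by move: ev; rewrite /derive -E.
Qed.

Lemma is_derive_comp (f : V -> R) (g : R -> R) z v (df dg : R) :
  is_derive z v f df -> is_derive (f z) 1 g dg ->
  is_derive z v (fun y => g (f y)) (dg * df).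
Proof.
have := @is_derive_line f z v 0 df; rewrite scale0r addr0 => -[fl _].
have := @is_derive_line (fun y => g (f y)) z v 0 (dg * df).
rewrite scale0r addr0 => -[_ gl] /fl fd gd; apply: gl.
have gd' : is_derive (f (z + 0 *: v)) 1 g dg by rewrite scale0r addr0.
exact: (is_derive1_comp gd' fd).
Qed.

Lemma derive_ext_open (A : set V) (f g : V -> R) x v : open A ->
  (forall y, A y -> f y = g y) -> A x ->
  'D_v f x = 'D_v g x /\ (derivable f x v -> derivable g x v).
Proof.
move=> oA fg Ax.
have H : {near x, f =1 g} by apply: filterS (open_nbhs_nbhs (conj oA Ax)) => y /fg.
split; first exact: near_eq_derive.
exact: near_eq_derivable.
Qed.

Lemma continuous_ext_open (A : set V) (f g : V -> R) x : open A ->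
  (forall y, A y -> f y = g y) -> A x ->
  {for x, continuous f} -> {for x, continuous g}.
Proof.
move=> oA fg Ax cf; have: f @ x --> g x by rewrite -(fg _ Ax); exact: cf.
apply: cvg_trans; apply: near_eq_cvg.
by apply: filterS (open_nbhs_nbhs (conj oA Ax)) => y /fg.
Qed.

Lemma ball_close (A : set V) (f g : V -> R) z eps : open A -> A z ->
  {for z, continuous f} -> {for z, continuous g} -> 0 < eps ->
  exists2 r, 0 < r & forall y, ball z r y ->
    [/\ A y, `|f z - f y| < eps & `|g z - g y| < eps].
Proof.
move=> oA Az /cvgrPdist_lt cf /cvgrPdist_lt cg eps0.
have : \forall y \near z, [/\ A y, `|f z - f y| < eps & `|g z - g y| < eps].
  near=> y; split; near: y; [exact: open_nbhs_nbhs|exact: cf|exact: cg].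
by move=> /nbhs_ballP[r /= r0 hr]; exists r.
Unshelve. all: by end_near. Qed.

End lines.

Section Cn_theory.
Context {R : realType} {V : normedModType R}.
Variables (I : eqType) (e : I -> V).
Implicit Types (A : set V) (f g : V -> R).

Definition derive_word (ws : seq I) f : V -> R :=
  foldr (fun i g x => 'D_(e i) g x) f ws.

Lemma derive_word_cat ws ws' f : derive_word (ws ++ ws') f = derive_word ws
    (derive_word ws' f).
Proof. exact: foldr_cat. Qed.

Lemma derive_word_rcons ws i f : derive_word (rcons ws i) f = derive_word ws (fun x
    => 'D_(e i) f x).
Proof. by rewrite /derive_word foldr_rcons. Qed.

Lemma Cn_ext A k f g : open A -> (forall x, A x -> f x = g x) ->
  Cn e k A f -> Cn e k A g.
Proof.
move=> oA; elim: k f g => [|k IH] f g fg [cf df].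
  by split=> // x Ax; exact: (continuous_ext_open oA fg Ax (cf x Ax)).
split=> [x Ax|i]; first exact: (continuous_ext_open oA fg Ax (cf x Ax)).
have [df1 df2] := df i; split=> [x Ax|].
  by apply: (derive_ext_open (e i) oA fg Ax).2; exact: df1.
apply: IH df2 => x Ax; exact: (derive_ext_open (e i) oA fg Ax).1.
Qed.

Lemma CnS A k f : Cn e k.+1 A f -> Cn e k A f.
Proof.
elim: k f => [|k IH] f [cf df]; split=> // i.
have [df1 df2] := df i; split=> //; exact: IH.
Qed.

Lemma Cn_le A j k f : (j <= k)%N -> Cn e k A f -> Cn e j A f.
Proof.
move=> /subnK <-; elim: (k - j)%N => [//|l IH]; rewrite addSn => /CnS; exact: IH.
Qed.

Lemma Cn_continuous A k f : Cn e k A f -> forall x, A x -> {for x, continuous f}.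
Proof. by case: k => [|k] []. Qed.

Lemma Cn_derivable A k f i : Cn e k.+1 A f -> forall x, A x -> derivable f x (e i).
Proof. by move=> [_ /(_ i)[]]. Qed.

Lemma Cn_derive A k f i : Cn e k.+1 A f -> Cn e k A (fun x => 'D_(e i) f x).
Proof. by move=> [_ /(_ i)[]]. Qed.

Lemma Cn_derive_word A k f ws : Cn e (size ws + k) A f -> Cn e k A (derive_word ws f).
Proof.
elim: ws k => [//|i ws IH] k hf; apply/Cn_derive/IH.
by rewrite addnS.
Qed.

Lemma Cn_cst A k (c : R) : Cn e k A (fun=> c).
Proof.
elim: k c => [|k IH] c; (split=> [x _|//]; first exact: cst_continuous).
move=> i; split=> [x _|]; first exact: derivable_cst.
rewrite (_ : (fun x => _) = (fun=> 0 : R))//; apply/funext => x.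
exact: derive_cst.
Qed.

Lemma Cn_add A k f g : open A -> Cn e k A f -> Cn e k A g ->
  Cn e k A (fun x => f x + g x).
Proof.
move=> oA; elim: k f g => [|k IH] f g [cf df] [cg dg].
  by split=> // x Ax; apply: continuousD; [exact: cf|exact: cg].
split=> [x Ax|i]; first by apply: continuousD; [exact: cf|exact: cg].
have [df1 df2] := df i; have [dg1 dg2] := dg i; split=> [x Ax|].
  by apply: derivableD; [exact: df1|exact: dg1].
apply: (Cn_ext oA _ (IH _ _ df2 dg2)) => x Ax.
by rewrite -deriveD; [|exact: df1|exact: dg1].
Qed.

Lemma Cn_mul A k f g : open A -> Cn e k A f -> Cn e k A g ->
  Cn e k A (fun x => f x * g x).
Proof.
move=> oA; elim: k f g => [|k IH] f g hf hg.
  split=> // x Ax; apply: continuousM.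
    exact: (Cn_continuous hf).
  exact: (Cn_continuous hg).
have [cf df] := hf; have [cg dg] := hg.
split=> [x Ax|i]; first by apply: continuousM; [exact: cf|exact: cg].
have [df1 df2] := df i; have [dg1 dg2] := dg i; split=> [x Ax|].
  by apply: derivableM; [exact: df1|exact: dg1].
have := Cn_add oA (IH _ _ (CnS hf) dg2) (IH _ _ (CnS hg) df2).
apply: Cn_ext => // x Ax /=.
by rewrite -[in RHS]/(f * g) deriveM; [|exact: df1|exact: dg1].
Qed.

Lemma Cn_opp A k f : open A -> Cn e k A f -> Cn e k A (fun x => - f x).
Proof.
move=> oA hf; have := Cn_mul oA (Cn_cst A k (-1)) hf.
by apply: Cn_ext => // x _; rewrite mulN1r.
Qed.

Lemma Cn_sum A k (T : Type) (r : seq T) (f : T -> V -> R) : open A ->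
  (forall j, Cn e k A (f j)) -> Cn e k A (fun x => \sum_(j <- r) f j x).
Proof.
move=> oA hf; elim: r => [|j r IH].
  by apply: (Cn_ext oA _ (Cn_cst A k 0)) => x _; rewrite big_nil.
by apply: (Cn_ext oA _ (Cn_add oA (hf j) IH)) => x _; rewrite big_cons.
Qed.

Lemma is_derive_inv f x v : f x != 0 -> derivable f x v ->
  is_derive x v (fun y => (f y)^-1) (- ((f x)^-1 * (f x)^-1 * 'D_v f x)).
Proof.
move=> f0 df; split; first exact: derivableV.
by rewrite deriveV// -exprVn expr2 scaleNr.
Qed.

Lemma Cn_inv A k f : open A -> (forall x, A x -> f x != 0) ->
  Cn e k A f -> Cn e k A (fun x => (f x)^-1).
Proof.
move=> oA f0; elim: k => [|k IH] hf.
  by split=> // x Ax; apply: cvgV; [exact: f0|exact: (Cn_continuous hf)].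
split=> [x Ax|i].
  by apply: cvgV; [exact: f0|exact: (Cn_continuous hf)].
have df := Cn_derivable (i := i) hf; have hf' := CnS hf.
split=> [x Ax|].
  by have [] := is_derive_inv (f0 x Ax) (df x Ax).
have := Cn_opp oA (Cn_mul oA (Cn_mul oA (IH hf') (IH hf')) (Cn_derive i hf)).
apply: Cn_ext => // x Ax.
by have [_ ->] := is_derive_inv (f0 x Ax) (df x Ax).
Qed.

Lemma derive_word_ext A ws f g : open A -> (forall x, A x -> f x = g x) ->
  forall x, A x -> derive_word ws f x = derive_word ws g x.
Proof.
move=> oA fg; elim: ws => [|i ws IH] x Ax /=; first exact: fg.
exact: (derive_ext_open (e i) oA IH Ax).1.
Qed.

Lemma derive_word_add A ws f g : open A -> Cn e (size ws) A f -> Cn e (size ws) A g ->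
  forall x, A x -> derive_word ws (fun y => f y + g y) x = derive_word ws f x +
      derive_word ws g x.
Proof.
move=> oA; elim/last_ind: ws f g => [//|ws i IH] f g; rewrite size_rcons => hf hg x Ax.
rewrite !derive_word_rcons -IH//; try exact: Cn_derive.
apply: (derive_word_ext _ oA _ Ax) => y Ay.
by rewrite -deriveD//; [exact: (Cn_derivable hf)|exact: (Cn_derivable hg)].
Qed.

Lemma derive_word_cst ws (c : R) x : ws != [::] -> derive_word ws (fun=> c) x = 0.
Proof.
elim/last_ind: ws x => [//|ws i IH] x _; rewrite derive_word_rcons.
rewrite (_ : 'D_(e i) _ = (fun=> 0)); last by apply/funext => y; exact: derive_cst.
by elim: ws {IH} x => [//|j ws IH] x /=; rewrite (funext IH); exact: derive_cst.
Qed.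

Lemma double_difference_eq (a b x1 x2 x3 x4 h : R) : h != 0 ->
  x1 - x2 - (x3 - x4) = a * h * h -> x1 - x3 - (x2 - x4) = b * h * h -> a = b.
Proof.
move=> h0 E1 E2; apply: (mulIf h0); apply: (mulIf h0).
by rewrite -E1 -E2; ring.
Qed.

Lemma norm_sub_close (x y c eps : R) :
  `|x - c| < eps / 2 -> `|y - c| < eps / 2 -> `|x - y| <= eps.
Proof.
move=> /ltW H1 /ltW H2; have -> : x - y = (x - c) - (y - c) by ring.
by apply: (le_trans (ler_normB _ _)); lra.
Qed.

(** The second difference of f is turned into a mixed derivative by two
applications of the mean value theorem, one in each direction. *)
Lemma second_difference A f i j z (h : R) : Cn e 2 A f -> 0 <= h ->
  (forall s t, 0 <= s <= h -> 0 <= t <= h -> A (z + s *: e i + t *: e j)) ->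
  exists s t, [/\ 0 <= s <= h, 0 <= t <= h &
    f (z + h *: e i + h *: e j) - f (z + h *: e i) -
    (f (z + h *: e j) - f z) =
    'D_(e j) (fun y => 'D_(e i) f y) (z + s *: e i + t *: e j) * h * h].
Proof.
move=> hf h0 hA.
have oo_cc x : x \in `]0, h[ -> 0 <= x <= h.
  by rewrite in_itv/= => /andP[/ltW -> /ltW ->].
have cc_cc x : x \in `[0, h] -> 0 <= x <= h by rewrite in_itv.
pose k (r : R) := f (z + h *: e j + r *: e i) - f (z + r *: e i).
have dk r : 0 <= r <= h -> is_derive r 1 k
    ('D_(e i) f (z + h *: e j + r *: e i) - 'D_(e i) f (z + r *: e i)).
  move=> rh.
  have d1 : is_derive r 1 (fun r => f (z + h *: e j + r *: e i))
      ('D_(e i) f (z + h *: e j + r *: e i)).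
    apply: (is_derive_line f (z + h *: e j) (e i) r _).1.
    apply: derivableP; apply: (Cn_derivable hf).
    by rewrite addrAC; apply: hA => //; rewrite h0 lexx.
  have d2 : is_derive r 1 (fun r => f (z + r *: e i)) ('D_(e i) f (z + r *: e i)).
    apply: (is_derive_line f z (e i) r _).1.
    apply: derivableP; apply: (Cn_derivable hf).
    by have := hA r 0 rh; rewrite lexx h0 scale0r addr0; exact.
  by have := @is_deriveB _ _ _ _ _ _ _ _ _ d1 d2.
have [r rh kE] := MVT_segment h0 (fun x xh => dk x (oo_cc x xh))
  (derivable_within_continuous (fun x xh => let: DeriveDef a _ := dk x (cc_cc x xh)
      in a)).
rewrite in_itv/= in rh.
pose l (t : R) := 'D_(e i) f (z + r *: e i + t *: e j).
have dl t : 0 <= t <= h -> is_derive t 1 l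
    ('D_(e j) (fun y => 'D_(e i) f y) (z + r *: e i + t *: e j)).
  move=> th; apply: (is_derive_line (fun y => 'D_(e i) f y) (z + r *: e i) (e j) t _).1.
  by apply: derivableP; apply: (Cn_derivable (Cn_derive i hf)); exact: hA.
have [t th lE] := MVT_segment h0 (fun x xh => dl x (oo_cc x xh))
  (derivable_within_continuous (fun x xh => let: DeriveDef a _ := dl x (cc_cc x xh)
      in a)).
rewrite in_itv/= in th.
exists r, t; split=> //.
move: kE lE; rewrite /k /l !scale0r !addr0 !subr0 => kE lE.
rewrite -lE.
have -> : 'D_(e i) f (z + r *: e i + h *: e j) = 'D_(e i) f (z + h *: e j + r *: e i).
  by rewrite addrAC.
rewrite -kE (addrAC z); ring.
Qed.

(** Schwarz's theorem.  The same second difference, expanded in either order,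
is h^2 times each of the two mixed derivatives at points within O(h) of z, so
that by continuity the mixed derivatives agree at z. *)
Lemma derive_commute A f i j z : open A -> Cn e 2 A f -> A z ->
  'D_(e j) (fun y => 'D_(e i) f y) z = 'D_(e i) (fun y => 'D_(e j) f y) z.
Proof.
move=> oA hf Az.
pose F : V -> R := fun y => 'D_(e j) (fun y => 'D_(e i) f y) y.
pose G : V -> R := fun y => 'D_(e i) (fun y => 'D_(e j) f y) y.
rewrite -/(F z) -/(G z).
have cF : {for z, continuous F}.
  exact: (Cn_continuous (Cn_derive j (Cn_derive i hf))).
have cG : {for z, continuous G}.
  exact: (Cn_continuous (Cn_derive i (Cn_derive j hf))).
apply/eqP; rewrite -subr_eq0 -normr_le0; apply/ler_addgt0Pr => eps eps0.
rewrite add0r.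
have e2 : 0 < eps / 2 by rewrite divr_gt0.
have [r r0 hr] := ball_close oA Az cF cG e2.
pose M := `|e i| + `|e j| + 1.
have M0 : 0 < M by rewrite ltr_wpDl// addr_ge0.
pose h := r / (2 * M).
have h0 : 0 < h by rewrite divr_gt0// mulr_gt0.
have near_z s t : 0 <= s <= h -> 0 <= t <= h -> ball z r (z + s *: e i + t *: e j).
  move=> /andP[s0 sh] /andP[t0 th]; rewrite -ball_normE/=.
  rewrite -addrA opprD addNKr normrN.
  apply: (le_lt_trans (ler_normD _ _)); rewrite !normrZ !ger0_norm//.
  apply: (@le_lt_trans _ _ (h * M)).
    rewrite /M mulrDr mulr1 mulrDr.
    have := ler_wpM2r (normr_ge0 (e i)) sh; have := ler_wpM2r (normr_ge0 (e j)) th.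
    by lra.
  rewrite /h invfM mulrA divfK ?gt_eqF//; lra.
have [s [t [sh th E1]]] := second_difference hf (ltW h0)
  (fun s t sh th => let: And3 a _ _ := hr _ (near_z s t sh th) in a).
have near_z' a b : 0 <= a <= h -> 0 <= b <= h -> ball z r (z + a *: e j + b *: e i).
  by move=> ah bh; rewrite addrAC; exact: near_z.
have [s' [t' [sh' th' E2]]] := second_difference hf (ltW h0)
  (fun a b ah bh => let: And3 c _ _ := hr _ (near_z' a b ah bh) in c).
have E : F (z + s *: e i + t *: e j) = G (z + s' *: e j + t' *: e i) :> R.
  rewrite (addrAC z (h *: e j)) in E2.
  exact: (double_difference_eq (lt0r_neq0 h0) E1 E2).
have [_ H1 _] := hr _ (near_z _ _ sh th).
have [_ _ H2] := hr _ (near_z' _ _ sh' th').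
rewrite E in H1.
exact: (norm_sub_close H1 H2).
Qed.

Lemma derive_word_move A l i r f : open A -> Cn e (size (l ++ i :: r)) A f ->
  forall x, A x -> derive_word (l ++ i :: r) f x = derive_word (i :: l ++ r) f x.
Proof.
move=> oA; elim: l => [//|j l IH] hf x Ax.
rewrite [LHS]/=.
rewrite (derive_ext_open (e j) oA (IH (CnS hf)) Ax).1.
rewrite /= (derive_commute i j oA _ Ax)//.
by apply: Cn_derive_word; move: hf; rewrite /= !size_cat/= addnS addn2.
Qed.

(** Symbol seminorms and test function seminorms only speak of derivatives
taken in a prescribed order; this lets all arguments use arbitrary words. *)
Lemma derive_word_perm A ws ws' f : open A -> perm_eq ws ws' -> Cn e (size ws) A f ->
  forall x, A x -> derive_word ws f x = derive_word ws' f x.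
Proof.
move=> oA; elim: ws ws' => [|i ws IH] ws' p hf x Ax.
  by move: p; rewrite perm_sym => /perm_nilP ->.
have iws' : i \in ws' by rewrite -(perm_mem p) mem_head.
case/splitPr: iws' p => l r p.
rewrite (derive_word_move oA _ Ax); last by rewrite -(perm_size p).
have p' : perm_eq ws (l ++ r) by rewrite -(perm_cons i) (permPl p) perm_catC /=
    perm_cons perm_catC.
exact: (derive_ext_open (e i) oA (IH _ p' (CnS hf)) Ax).1.
Qed.

End Cn_theory.

(** * Weighted bounds on all derivatives *)

Section bounds.
Context {R : realType} {n s : nat}.
Notation W := ('rV[R]_n * 'rV[R]_s)%type.
Notation I := ('I_n + 'I_s)%type.
Notation e := (@dirxt R n s).
Implicit Types (A : set W) (f g h : W -> R) (z : W).

Definition bracket z : R := 1 + enorm z.2.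

Lemma enorm_ge0 N (x : 'rV[R]_N) : 0 <= enorm x.
Proof. exact: sqrtr_ge0. Qed.

Lemma enorm_coord N (x : 'rV[R]_N) j : `|x ord0 j| <= enorm x.
Proof.
rewrite /enorm -sqrtr_sqr; apply: ler_wsqrtr.
by rewrite (bigD1 j)//= lerDl sumr_ge0// => k _; exact: sqr_ge0.
Qed.

Lemma bracket_ge1 z : 1 <= bracket z.
Proof. by rewrite lerDl enorm_ge0. Qed.

Lemma bracket_gt0 z : 0 < bracket z.
Proof. exact: lt_le_trans (bracket_ge1 z). Qed.

Lemma bracketD z a b : bracket z `^ (a + b) = bracket z `^ a * bracket z `^ b.
Proof. by rewrite powRD// (gt_eqF (bracket_gt0 z)) implybT. Qed.

Lemma bracket_le z a b : a <= b -> bracket z `^ a <= bracket z `^ b.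
Proof. by apply: ler_powR; exact: bracket_ge1. Qed.

Definition is_theta (i : I) : bool := if i is inr _ then true else false.
Definition theta_degree (ws : seq I) : nat := count is_theta ws.
Definition theta_exp (i : I) : R := (is_theta i)%:R.

(** The symbol estimates at the single point z: each theta derivative gains a
factor 1 / (1 + |theta|).  Keeping the point fixed makes the constant free to be
any positive function of z, so that the same lemmas produce orders of symbols
and estimates that are uniform in a parameter. *)
Definition dbound (N : nat) f z (c : R) : Prop :=
  forall ws, (size ws <= N)%N -> `|derive_word e ws f z| <= c * bracket z `^ (-
      (theta_degree ws)%:R).

Lemma dbound_ge0 N f z c : dbound N f z c -> 0 <= c.
Proof.
move=> /(_ [::] isT) /=; rewrite oppr0 powRr0 mulr1.
by apply: le_trans; exact: normr_ge0.
Qed.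

Lemma dbound_val N f z c : dbound N f z c -> `|f z| <= c.
Proof. by move=> /(_ [::] isT) /=; rewrite oppr0 powRr0 mulr1. Qed.

Lemma dbound_mono N M f z c d : (N <= M)%N -> c <= d -> dbound M f z c ->
    dbound N f z d.
Proof.
move=> NM cd h ws sw; apply: (le_trans (h ws (leq_trans sw NM))).
by rewrite ler_wpM2r// powR_ge0.
Qed.

Lemma dbound_weak N f z c d : c <= d -> dbound N f z c -> dbound N f z d.
Proof. exact: dbound_mono. Qed.

Lemma theta_degree_rcons ws i : (theta_degree (rcons ws i))%:R = (theta_degree ws)%:R
    + theta_exp i :> R.
Proof. by rewrite /theta_degree -cats1 count_cat /= addn0 natrD. Qed.

Lemma dbound_derive N f z c i : dbound N.+1 f z c ->
  dbound N (fun y => 'D_(e i) f y) z (c * bracket z `^ (- theta_exp i)).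
Proof.
move=> h ws sw; rewrite -derive_word_rcons -mulrA -bracketD.
by rewrite -opprD (addrC (theta_exp i)) -theta_degree_rcons; apply: h;
    rewrite size_rcons.
Qed.

Lemma dbound_rec N f z c : `|f z| <= c ->
  (forall i, dbound N (fun y => 'D_(e i) f y) z (c * bracket z `^ (- theta_exp i))) ->
  dbound N.+1 f z c.
Proof.
move=> h0 h ws; case/lastP: ws => [_|ws i].
  by rewrite /= oppr0 powRr0 mulr1.
rewrite size_rcons ltnS => /(h i); rewrite derive_word_rcons -mulrA -bracketD.
by rewrite -opprD (addrC (theta_exp i)) -theta_degree_rcons.
Qed.

Lemma bd0 f z c : `|f z| <= c -> dbound 0 f z c.
Proof. by move=> h [|//] _ /=; rewrite oppr0 powRr0 mulr1. Qed.

Lemma dbound_ext A N f g z c : open A -> (forall y, A y -> f y = g y) -> A z ->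
  dbound N f z c -> dbound N g z c.
Proof. by move=> oA fg Az h ws sw; rewrite -(derive_word_ext e ws oA fg Az); exact:
    h. Qed.

Lemma dbound_cst N (c : R) z : dbound N (fun=> c) z `|c|.
Proof.
move=> [|i ws] _; first by rewrite /= oppr0 powRr0 mulr1.
by rewrite derive_word_cst// normr0 mulr_ge0// powR_ge0.
Qed.

Section with_open.
Variable A : set W.
Hypothesis oA : open A.

Lemma dbound_add N f g z c d : A z -> Cn e N A f -> Cn e N A g ->
  dbound N f z c -> dbound N g z d -> dbound N (fun y => f y + g y) z (c + d).
Proof.
move=> Az Nf Ng hf hg ws sw.
rewrite (derive_word_add oA (Cn_le sw Nf) (Cn_le sw Ng) Az).
by rewrite mulrDl (le_trans (ler_normD _ _))// lerD// ?hf ?hg.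
Qed.

Lemma dbound_sum N (T : Type) (r : seq T) (f : T -> W -> R) z (c : T -> R) : A z ->
  (forall j, Cn e N A (f j)) -> (forall j, dbound N (f j) z (c j)) ->
  dbound N (fun y => \sum_(j <- r) f j y) z (\sum_(j <- r) c j).
Proof.
move=> Az hf hc; elim: r => [|j r IH].
  apply: (@dbound_ext A _ (fun=> 0)) => //; first by move=> y _; rewrite big_nil.
  by rewrite big_nil; have := @dbound_cst N 0 z; rewrite normr0.
apply: (@dbound_ext A _ (fun y => f j y + \sum_(j <- r) f j y)) => //.
  by move=> y _; rewrite big_cons.
by rewrite big_cons; apply: dbound_add => //; exact: Cn_sum.
Qed.

Lemma dbound_mul N f g z c d : A z -> Cn e N A f -> Cn e N A g ->
  dbound N f z c -> dbound N g z d -> dbound N (fun y => f y * g y) z (2 ^+ N * c * d).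
Proof.
move=> Az; elim: N f g c d => [|N IH] f g c d Nf Ng hf hg.
  by apply: bd0; rewrite expr0 mul1r normrM ler_pM// ?(dbound_val hf) ?(dbound_val hg).
have c0 := dbound_ge0 hf; have d0 := dbound_ge0 hg.
apply: dbound_rec => [|i].
  rewrite normrM -mulrA; apply: (@le_trans _ _ (c * d)).
    by rewrite ler_pM// ?(dbound_val hf) ?(dbound_val hg).
  by rewrite ler_peMl// ?mulr_ge0// exprn_ege1// ler1n.
apply: (@dbound_ext A _ (fun y => 'D_(e i) f y * g y + f y * 'D_(e i) g y)) => //.
  move=> y Ay; rewrite -[in RHS]/(f * g).
  rewrite deriveM; [|exact: (Cn_derivable Nf)|exact: (Cn_derivable Ng)].
  by rewrite addrC [X in _ = _ + X]mulrC.
have H1 := IH _ _ _ _ (Cn_derive i Nf) (CnS Ng) (dbound_derive i hf)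
    (dbound_mono (leqnSn N) (lexx d) hg).
have H2 := IH _ _ _ _ (CnS Nf) (Cn_derive i Ng)
    (dbound_mono (leqnSn N) (lexx c) hf) (dbound_derive i hg).
have := dbound_add Az (Cn_mul oA (Cn_derive i Nf) (CnS Ng))
  (Cn_mul oA (CnS Nf) (Cn_derive i Ng)) H1 H2.
by apply: dbound_weak; rewrite exprS le_eqVlt; apply/orP; left; apply/eqP; ring.
Qed.

(** Follows the recursion d (1/f) = - (1/f)^2 d f; each application of the
Leibniz bound costs a factor 2 ^ M, whence 8 ^ M for a product of four factors. *)
Fixpoint inv_const (k : R) (N : nat) : R :=
  if N is M.+1 then inv_const k M + 8 ^+ M * inv_const k M ^+ 2 * k else 1.

Lemma inv_const_ge1 k N : 0 <= k -> 1 <= inv_const k N.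
Proof.
move=> k0; elim: N => [//|N IH] /=; apply: (le_trans IH).
by rewrite lerDl !mulr_ge0// ?exprn_ge0// (le_trans _ IH).
Qed.

(** The constant depends on f only through the product of its bound and of the
bound of 1 / f: this ratio is all that ellipticity has to control. *)
Lemma dbound_inv N f z q v : A z -> (forall y, A y -> f y != 0) -> Cn e N A f ->
  dbound N f z q -> `|(f z)^-1| <= v ->
  dbound N (fun y => (f y)^-1) z (v * inv_const (q * v) N).
Proof.
move=> Az f0; move=> Nf hf hv.
have q0 := dbound_ge0 hf.
have v0 : 0 <= v by apply: le_trans hv.
have k0 : 0 <= q * v by rewrite mulr_ge0.
elim: N Nf hf => [|N IH] Nf hf; first by apply: bd0; rewrite /= mulr1.
apply: dbound_rec => [|i].
  by apply: (le_trans hv); rewrite ler_peMr// (@inv_const_ge1 _ N.+1).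
have := IH (CnS Nf) (dbound_mono (leqnSn N) (lexx q) hf) => bw.
have Nw := Cn_inv oA f0 (CnS Nf).
have Nww := Cn_mul oA Nw Nw.
have NM := Cn_cst e A N (-1).
have := dbound_mul Az (Cn_mul oA NM Nww) (Cn_derive i Nf)
  (dbound_mul Az NM Nww (@dbound_cst N (-1) z) (dbound_mul Az Nw Nw bw bw))
  (dbound_derive i hf).
rewrite normrN1 => H.
apply: (@dbound_ext A _ (fun y => -1 * ((f y)^-1 * (f y)^-1) * 'D_(e i) f y)) => //.
  move=> y Ay; have df := Cn_derivable (i := i) Nf Ay.
  have [_ ->] := is_derive_inv (f0 y Ay) df.
  by rewrite !mulN1r mulNr.
apply: (dbound_weak _ H); rewrite mulrA ler_wpM2r ?powR_ge0//.
rewrite [leLHS](_ : _ = v * ((2 ^+ N) ^+ 3 * inv_const (q * v) N ^+ 2 * (q * v)));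
    last by ring.
rewrite -exprM mulnC exprM (_ : 2 ^+ 3 = 8); last by rewrite !exprS expr0 mulr1 -!natrM.
by rewrite ler_wpM2l//= lerDr (le_trans _ (inv_const_ge1 N k0)).
Qed.

End with_open.
End bounds.

(** * Symbol orders of real functions *)

Section coordinates.
Context {R : realType} {n s : nat}.
Notation W := ('rV[R]_n * 'rV[R]_s)%type.
Notation I := ('I_n + 'I_s)%type.
Notation e := (@dirxt R n s).
Implicit Types (z : W).

Definition theta_coord (j : 'I_s) z : R := z.2 ord0 j.

Definition dtheta_coord (i : I) (j : 'I_s) : R := if i is inr k then (k == j)%:R else 0.

Lemma is_derive_theta_coord i j z : is_derive z (e i) (theta_coord j) (dtheta_coord i
    j).
Proof.
have := @is_derive_line R _ (theta_coord j) z (e i) 0 (dtheta_coord i j).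
rewrite scale0r addr0 => -[_]; apply.
have -> : (fun r : R => theta_coord j (z + r *: e i)) = (cst (theta_coord j z) +
    dtheta_coord i j *: (@id R)).
  apply/funext => r; rewrite /theta_coord/= !mxE; congr (_ + _).
  rewrite [RHS]mulrC; case: i => k /=; rewrite !mxE//.
  by rewrite eqxx eq_sym.
by apply: is_derive_eq; rewrite add0r [_ *: _]mulr1.
Qed.

Lemma continuous_theta_coord j : continuous (theta_coord j).
Proof.
move=> z; apply: (@continuous_comp _ _ _ snd (fun x : 'rV[R]_s => x ord0 j)).
  exact: cvg_snd.
exact: coord_continuous.
Qed.

Lemma Cn_theta_coord A k j : Cn e k A (theta_coord j).
Proof.
have c : forall x, A x -> {for x, continuous (theta_coord j)}.
  by move=> x _; exact: continuous_theta_coord.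
case: k => [|k]; split=> // i; split=> [x _|].
  by have [] := is_derive_theta_coord i j x.
rewrite (_ : (fun x => _) = (fun=> dtheta_coord i j)); first exact: Cn_cst.
by apply/funext => x; have [] := is_derive_theta_coord i j x.
Qed.

Lemma dbound_theta_coord N j z : dbound N (theta_coord j) z (bracket z).
Proof.
have h : `|theta_coord j z| <= bracket z.
  by apply: (le_trans (enorm_coord _ _)); rewrite lerDr.
case: N => [|N]; first exact: bd0.
apply: dbound_rec => // i.
rewrite (_ : (fun y => _) = (fun=> dtheta_coord i j)); last first.
  by apply/funext => x; have [] := is_derive_theta_coord i j x.
apply: (dbound_weak _ (@dbound_cst _ _ _ N (dtheta_coord i j) z)).
case: i => k /=; first by rewrite normr0 mulr_ge0 ?powR_ge0// ltW// bracket_gt0.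
rewrite -[X in X * _]powRr1 ?(ltW (bracket_gt0 z))// -bracketD subrr powRr0.
by rewrite normr_nat lern1 leq_b1.
Qed.

Definition theta_sq z : R := \sum_(j < s) theta_coord j z * theta_coord j z.

Lemma tsqE z : theta_sq z = enorm z.2 ^+ 2.
Proof. by rewrite sqr_sqrtr// sumr_ge0// => j _; exact: sqr_ge0. Qed.

Lemma theta_sq_ge0 z : 0 <= theta_sq z.
Proof. by rewrite tsqE exprn_ge0// enorm_ge0. Qed.

Lemma Cn_theta_sq A k : open A -> Cn e k A theta_sq.
Proof.
by move=> oA; apply: Cn_sum => // j; apply: Cn_mul => //; exact: Cn_theta_coord.
Qed.

Lemma dbound_theta_sq N z : dbound N theta_sq z (s%:R * 2 ^+ N * bracket z ^+ 2).
Proof.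
have := @dbound_sum _ _ _ setT openT N _ (index_enum 'I_s) (fun j z => theta_coord j
    z * theta_coord j z)
  z (fun=> 2 ^+ N * bracket z * bracket z) Logic.I.
rewrite sumr_const card_ord => H.
apply: (dbound_weak _ (H _ _)) => [|j|j].
- by rewrite -[X in X <= _]mulr_natl expr2 !mulrA lexx.
- by apply: Cn_mul; [exact: openT|exact: Cn_theta_coord|exact: Cn_theta_coord].
- by apply: (dbound_mul openT) => //; [exact: Cn_theta_coord|exact:
      Cn_theta_coord|exact: dbound_theta_coord|exact: dbound_theta_coord].
Qed.

(** A theta derivative lowers the order of the phase by one; the factor
|theta|^2 brings its square back to the order of the squared x derivatives. *)
Definition grad_weight (i : I) z : R := if i is inr _ then theta_sq z else 1.

Lemma grad_weight_ge0 i z : 0 <= grad_weight i z.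
Proof. by case: i => j //=; exact: theta_sq_ge0. Qed.

Lemma Cn_grad_weight A k i : open A -> Cn e k A (grad_weight i).
Proof. by case: i => j oA; [exact: Cn_cst|exact: Cn_theta_sq]. Qed.

End coordinates.

Section symbol_order.
Context {R : realType} {n s : nat}.
Notation W := ('rV[R]_n * 'rV[R]_s)%type.
Notation I := ('I_n + 'I_s)%type.
Notation e := (@dirxt R n s).
Variables (A : set W) (K : set 'rV[R]_n).
Hypotheses (oA : open A) (KA : forall z : W, K z.1 -> A z).
Implicit Types (f g : W -> R) (m : R).

Definition has_order N f m := exists2 C, 0 <= C & forall z : W, K z.1 ->
  dbound N f z (C * bracket z `^ m).

Lemma has_order_mono N f m m' : m <= m' -> has_order N f m -> has_order N f m'.
Proof.
move=> mm [C C0 h]; exists C => // z Kz; apply: (dbound_weak _ (h z Kz)).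
by rewrite ler_wpM2l// bracket_le.
Qed.

Lemma has_order_derive N f m i : has_order N.+1 f m ->
  has_order N (fun y => 'D_(e i) f y) (m - theta_exp i).
Proof.
move=> [C C0 h]; exists C => // z Kz; rewrite bracketD mulrA; exact:
    dbound_derive (h z Kz).
Qed.

Lemma has_order_cst N c : has_order N (fun=> c) 0.
Proof.
by exists `|c| => // z Kz; rewrite powRr0 mulr1; exact: dbound_cst.
Qed.

Lemma has_order_add N f g m : Cn e N A f -> Cn e N A g -> has_order N f m ->
    has_order N g m ->
  has_order N (fun y => f y + g y) m.
Proof.
move=> Nf Ng [C C0 hf] [D D0 hg]; exists (C + D); first exact: addr_ge0.
by move=> z Kz; rewrite mulrDl; apply: (dbound_add oA); [exact: KA|..|exact:
    hf|exact: hg].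
Qed.

Lemma has_order_sum N (T : Type) (r : seq T) (f : T -> W -> R) m :
  (forall j, Cn e N A (f j)) -> (forall j, has_order N (f j) m) ->
  has_order N (fun y => \sum_(j <- r) f j y) m.
Proof.
move=> Nf hf; elim: r => [|j r IH].
  exists 0 => // z Kz; rewrite mul0r (_ : (fun y => _) = fun=> 0).
    by have := @dbound_cst R n s N 0 z; rewrite normr0.
  by apply/funext => y; rewrite big_nil.
rewrite (_ : (fun y => _) = fun y => f j y + \sum_(j <- r) f j y).
  by apply: has_order_add => //; exact: Cn_sum.
by apply/funext => y; rewrite big_cons.
Qed.

Lemma has_order_mul N f g m m' : Cn e N A f -> Cn e N A g -> has_order N f m ->
    has_order N g m' ->
  has_order N (fun y => f y * g y) (m + m').
Proof.
move=> Nf Ng [C C0 hf] [D D0 hg]; exists (2 ^+ N * C * D).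
  by rewrite !mulr_ge0// exprn_ge0.
move=> z Kz; have := dbound_mul oA (KA Kz) Nf Ng (hf z Kz) (hg z Kz).
by apply: dbound_weak; rewrite bracketD le_eqVlt; apply/orP; left; apply/eqP; ring.
Qed.

Lemma has_order_grad_weight N i : has_order N (grad_weight i) (2 * theta_exp i).
Proof.
case: i => j.
  by rewrite /theta_exp/= mulr0; exact: has_order_cst.
exists (s%:R * 2 ^+ N); first by rewrite mulr_ge0// exprn_ge0.
by move=> z Kz; rewrite /theta_exp/= mulr1 powR_mulrn ?(ltW (bracket_gt0 z))//;
    exact: dbound_theta_sq.
Qed.

Lemma has_order_inv N f m : Cn e N A f -> (forall y, A y -> f y != 0) ->
    has_order N f m ->
  (exists2 C, 0 <= C & forall z, K z.1 -> `|(f z)^-1| <= C * bracket z `^ (- m)) ->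
  has_order N (fun y => (f y)^-1) (- m).
Proof.
move=> Nf f0 [C C0 hf] [D D0 hv].
exists (D * inv_const (C * D) N).
  by rewrite mulr_ge0// (le_trans _ (@inv_const_ge1 _ _ N _))// mulr_ge0.
move=> z Kz; have := dbound_inv oA (KA Kz) f0 Nf (hf z Kz) (hv z Kz).
apply: dbound_weak; rewrite mulrACA -bracketD subrr powRr0 mulr1.
by rewrite le_eqVlt; apply/orP; left; apply/eqP; ring.
Qed.

End symbol_order.

(** * The damping factor and the vector field of a phase *)

Section phase.
Context {R : realType} {n s : nat}.
Notation W := ('rV[R]_n * 'rV[R]_s)%type.
Notation I := ('I_n + 'I_s)%type.
Notation e := (@dirxt R n s).
Variables (Omega : set 'rV[R]_n) (mu : R) (phi : W -> R).
Notation O := (Omega `*` [set: 'rV[R]_s]).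

Definition phase_grad_sq z : R := \sum_(i : I) grad_weight i z * ('D_(e i) phi z *
    'D_(e i) phi z).
(** The value 1 in 1 + Q is what replaces a cutoff: the damped term has order
-2 mu, which is below the order -mu of the terms coming from the field. *)
Definition phase_damping z : R := (1 + phase_grad_sq z)^-1.
Definition phase_field (i : I) z : R := phase_damping z * grad_weight i z * 'D_(e i)
    phi z.

Lemma phase_grad_sqE z :
  phase_grad_sq z = gradx_sq phi z + enorm z.2 ^+ 2 * gradt_sq phi z.
Proof.
rewrite /phase_grad_sq big_sumType /=; congr (_ + _).
  by apply: eq_bigr => i _; rewrite mul1r.
by rewrite mulr_sumr; apply: eq_bigr => i _; rewrite -tsqE.
Qed.

Lemma phase_grad_sq_ge0 z : 0 <= phase_grad_sq z.
Proof. by apply: sumr_ge0 => i _; rewrite mulr_ge0 ?grad_weight_ge0// sqr_ge0. Qed.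

Lemma phase_damping_den_gt0 z : 0 < 1 + phase_grad_sq z.
Proof. by rewrite ltr_pwDl// phase_grad_sq_ge0. Qed.

Lemma damping_field_id z : phase_damping z + \sum_i phase_field i z * 'D_(e i) phi z
    = 1.
Proof.
have -> : \sum_i phase_field i z * 'D_(e i) phi z = phase_damping z * phase_grad_sq z.
  by rewrite mulr_sumr; apply: eq_bigr => i _; rewrite /phase_field -!mulrA.
by rewrite -[X in X + _]mulr1 -mulrDr mulVf// gt_eqF// phase_damping_den_gt0.
Qed.

Hypotheses (oO : open O) (mu0 : 0 < mu) (sphi : forall k, Cn e k O phi).

Lemma Cn_phase_grad_sq k : Cn e k O phase_grad_sq.
Proof.
apply: Cn_sum => // i; apply: Cn_mul => //; first exact: Cn_grad_weight.
by apply: Cn_mul => //; apply: Cn_derive.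
Qed.

Lemma Cn_phase_damping k : Cn e k O phase_damping.
Proof.
apply: Cn_inv => // [x _|]; first by rewrite gt_eqF// phase_damping_den_gt0.
by apply: Cn_add => //; [exact: Cn_cst|exact: Cn_phase_grad_sq].
Qed.

Lemma Cn_phase_field k i : Cn e k O (phase_field i).
Proof.
apply: Cn_mul => //; last exact: Cn_derive.
by apply: Cn_mul => //; [exact: Cn_phase_damping|exact: Cn_grad_weight].
Qed.

Variable K : set 'rV[R]_n.
Hypotheses (KO : K `<=` Omega) (bphi : forall N, has_order K N phi mu).
Hypothesis ellipticity : exists C D : R, [/\ 0 < C, 0 < D &
        forall x theta, K x -> D <= enorm theta ->
          C * enorm theta `^ (2 * mu) <=
          gradx_sq phi (x, theta) +
            enorm theta ^+ 2 * gradt_sq phi (x, theta)].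

Let KO' (z : W) : K z.1 -> O z. Proof. by move=> /KO. Qed.

Lemma has_order_phase_grad_sq N : has_order K N phase_grad_sq (2 * mu).
Proof.
have Nd i : Cn e N O (fun z => 'D_(e i) phi z) by apply: Cn_derive.
have Nk i : Cn e N O (grad_weight i) by exact: Cn_grad_weight.
apply: (has_order_sum oO KO') => i; first by do 2?apply: Cn_mul => //.
have -> : 2 * mu = 2 * theta_exp i + ((mu - theta_exp i) + (mu - theta_exp i)) by ring.
apply: (has_order_mul oO KO') => //; first by apply: Cn_mul.
  exact: has_order_grad_weight.
by apply: (has_order_mul oO KO') => //; apply: has_order_derive.
Qed.

(** Away from the ball |theta| < D the ellipticity of the phase gives the bound,
and inside it the summand 1 does. *)
Lemma ellipticity_bound : exists2 L, 0 <= L &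
  forall z, K z.1 -> bracket z `^ (2 * mu) <= L * (1 + phase_grad_sq z).
Proof.
have [C [D [C0 D0 h]]] := ellipticity.
have m0 : 0 <= 2 * mu by rewrite mulr_ge0// ltW.
set r := 2 * mu in m0 h *.
(* for |theta| >= D one has 1 + |theta| <= (1 + 1/D) |theta| *)
pose M := 1 + D^-1.
have M0 : 0 <= M by rewrite addr_ge0// invr_ge0 ltW.
exists (M `^ (r) / C + (1 + D) `^ (r)).
  by rewrite addr_ge0// ?divr_ge0 ?powR_ge0// ltW.
move=> [x th] /= Kx; have q0 := phase_grad_sq_ge0 (x, th).
set q := phase_grad_sq _ in q0 *.
have t0 := enorm_ge0 th.
rewrite mulrDl; have [Dt|tD] := leP D (enorm th).
  apply: (@le_trans _ _ (M `^ (r) / C * (1 + q))); last first.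
    by rewrite lerDl mulr_ge0 ?powR_ge0// addr_ge0.
  have := h x th Kx Dt; rewrite -/(phase_grad_sq _) => hq.
  have {}hq : C * enorm th `^ (r) <= q by rewrite /q phase_grad_sqE.
  apply: (@le_trans _ _ (M `^ (r) * enorm th `^ (r))).
    rewrite -powRM//; apply: ge0_ler_powR => //; rewrite ?nnegrE ?mulr_ge0 ?(ltW
        (bracket_gt0 _))//.
    rewrite /bracket/= /M mulrDl mul1r addrC lerD2l.
    by rewrite mulrC ler_pdivlMr// mul1r.
  rewrite -!mulrA ler_wpM2l ?powR_ge0// mulrC ler_pdivlMr// mulrC.
  by apply: (le_trans hq); rewrite lerDr.
apply: (@le_trans _ _ ((1 + D) `^ (r) * (1 + q))); last first.
  by rewrite lerDr mulr_ge0 ?divr_ge0 ?powR_ge0 ?(ltW C0)// addr_ge0.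
apply: (@le_trans _ _ ((1 + D) `^ (r))).
  apply: ge0_ler_powR; rewrite ?nnegrE ?(ltW (bracket_gt0 _))//.
    by rewrite addr_ge0// ltW.
  by rewrite lerD2l/= ltW.
by rewrite ler_peMr ?powR_ge0// lerDl.
Qed.

Lemma has_order_phase_damping N : has_order K N phase_damping (- (2 * mu)).
Proof.
have N1 : Cn e N O (fun z => 1 + phase_grad_sq z).
  by apply: Cn_add => //; [exact: Cn_cst|exact: Cn_phase_grad_sq].
apply: (has_order_inv oO KO') => //.
- by move=> y _; rewrite gt_eqF// phase_damping_den_gt0.
- apply: (has_order_add oO KO'); [exact: Cn_cst|exact: Cn_phase_grad_sq|..|exact:
      has_order_phase_grad_sq].
  by apply: (has_order_mono _ (has_order_cst K N 1)); rewrite mulr_ge0// ltW.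
have [L L0 hL] := ellipticity_bound; exists L => // z Kz.
rewrite ger0_norm ?invr_ge0 ?(ltW (phase_damping_den_gt0 z))//.
rewrite powRN ler_pdivlMr ?powR_gt0 ?bracket_gt0// ler_pdivrMl
    ?phase_damping_den_gt0// [leRHS]mulrC.
exact: hL.
Qed.

Lemma has_order_phase_field N i : has_order K N (phase_field i) (theta_exp i - mu).
Proof.
have -> : theta_exp i - mu = (- (2 * mu) + 2 * theta_exp i) + (mu - theta_exp i) by
    ring.
apply: (has_order_mul oO KO').
- by apply: Cn_mul => //; [exact: Cn_phase_damping|exact: Cn_grad_weight].
- exact: Cn_derive.
- apply: (has_order_mul oO KO'); [exact: Cn_phase_damping|exact:
      Cn_grad_weight|exact: has_order_phase_damping|exact: has_order_grad_weight].
- exact: has_order_derive.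
Qed.

End phase.

(** * Integration over R^n and R^s *)

Section measurability.
Context {R : realType} {n s : nat}.
Notation W := ('rV[R]_n * 'rV[R]_s)%type.
Context d (T : measurableType d) (g1 : T -> 'rV[R]_n) (g2 : T -> 'rV[R]_s).
Hypothesis mg1 : forall j, measurable_fun setT (fun t => g1 t ord0 j).
Hypothesis mg2 : forall j, measurable_fun setT (fun t => g2 t ord0 j).

Let measurable_ball_rV N (g : T -> 'rV[R]_N) (q : 'rV[R]_N) (r : R) : 0 < r ->
  (forall j, measurable_fun setT (fun t => g t ord0 j)) ->
  measurable [set t | ball q r (g t)].
Proof.
move=> r0 mg.
have -> : [set t | ball q r (g t)] =
    \bigcap_(j in [set: 'I_N]) ((fun t => g t ord0 j) @^-1` ball (q ord0 j) r).
  apply/seteqP; split => t /=; first by move=> [_ qt] j _; exact: (qt ord0 j).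
  by move=> qt; rewrite /ball/= /mx_ball; split=> // i j; rewrite (ord1 i); exact: qt.
apply: fin_bigcap_measurable; first exact: finite_finset.
move=> j _; rewrite -[X in measurable X]setTI; apply: mg => //.
exact: measurable_ball.
Qed.

Let rat_approx N (x : 'rV[R]_N) (r : R) : 0 < r ->
  exists q : 'rV[rat]_N, ball (map_mx (@ratr R) q) r x.
Proof.
move=> r0; have h j : exists q : rat, `|ratr q - x ord0 j| < r.
  have [|q] := @rat_in_itvoo R (x ord0 j - r) (x ord0 j + r).
    by rewrite ltrBlDr -addrA ltrDl addr_gt0.
  by rewrite in_itv/= => hq; exists q; rewrite ltr_distl.
exists (\row_j sval (cid (h j))); split=> // i j; rewrite (ord1 i) !mxE.
exact: (svalP (cid (h j))).
Qed.

(** Boxes with rational centres form a countable base, which is what turns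
coordinatewise measurability into measurability of preimages of open sets. *)
Let box (i : 'rV[rat]_n * 'rV[rat]_s * nat) : set W :=
  ball (map_mx (@ratr R) i.1.1, map_mx (@ratr R) i.1.2) (i.2.+1%:R^-1).

Lemma measurable_fun_continuous (F : W -> R) : continuous F ->
  measurable_fun setT (fun t => F (g1 t, g2 t)).
Proof.
move=> cF; apply: (measurability _ (RGenOpens.measurableE R)).
move=> _ [_ [a [b ->] <-]]; rewrite setTI.
have oU : open (F @^-1` `]a, b[) by apply: open_comp => // z _; exact: cF.
have -> : (fun t => F (g1 t, g2 t)) @^-1` `]a, b[ =
    \bigcup_(i in [set i | box i `<=` F @^-1` `]a, b[])
      ((fun t => (g1 t, g2 t)) @^-1` box i).
  apply/seteqP; split => t /=; last by move=> [i ib /ib].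
  move=> Ft; have /nbhs_ballP[r /= r0 hr] : nbhs (g1 t, g2 t) (F @^-1` `]a, b[).
    exact: open_nbhs_nbhs.
  have [k] := ltr_add_invr (divr_gt0 r0 (ltr0n _ 2)); rewrite add0r => hk.
  have k0 : 0 < (k.+1%:R^-1 : R) by rewrite invr_gt0.
  have [q1 hq1] := rat_approx (g1 t) k0; have [q2 hq2] := rat_approx (g2 t) k0.
  exists (q1, q2, k); last by split.
  move=> z bz; apply: hr; rewrite (splitr r).
  have le_k := @le_ball _ W _ _ _ (ltW hk).
  apply: (@ball_triangle _ _ (map_mx (@ratr R) q1, map_mx (@ratr R) q2)); apply:
      le_k => //.
  by apply: ball_sym; split.
rewrite bigcup_mkcond; apply: countable_bigcupT_measurable; first exact: countableP.
move=> [[q1 q2] k]; case: ifPn => // _.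
have k0 : 0 < (k.+1%:R^-1 : R) by rewrite invr_gt0.
rewrite (_ : _ @^-1` _ = [set t | ball (map_mx (@ratr R) q1) (k.+1%:R^-1) (g1 t)] `&`
   [set t | ball (map_mx (@ratr R) q2) (k.+1%:R^-1) (g2 t)])//.
by apply: measurableI; exact: measurable_ball_rV.
Qed.

End measurability.

Section improper.
Context {R : realType}.

Lemma powR_le_neg (x y a : R) : 0 < x -> x <= y -> a <= 0 -> y `^ a <= x `^ a.
Proof.
move=> x0 xy a0; rewrite -(opprK a) !(powRN _ (- a)).
have y0 := lt_le_trans x0 xy.
by rewrite lef_pV2 ?posrE ?powR_gt0// ge0_ler_powR ?oppr_ge0 ?nnegrE// ltW.
Qed.

Lemma powR_neg_small (a eps : R) : 0 < a -> 0 < eps ->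
  exists2 M, 0 < M & forall x, M <= x -> x `^ (- a) <= eps.
Proof.
move=> a0 eps0; exists (eps `^ (- a^-1)); first exact: powR_gt0.
move=> x Mx; apply: (@le_trans _ _ ((eps `^ (- a^-1)) `^ (- a))).
  by apply: powR_le_neg => //; rewrite ?powR_gt0// oppr_le0 ltW.
by rewrite -powRrM mulrNN mulVf ?gt_eqF// powRr1// ltW.
Qed.

(** One-dimensional integrable weights; their products over the coordinates
dominate negative powers of 1 + |x| and are integrable by Tonelli's theorem,
without polar coordinates. *)
Definition line_weight (r y : R) : R := (1 + `|y|) `^ (- r).

Lemma line_weight_base_gt0 (y : R) : 0 < 1 + `|y|. Proof. by rewrite ltr_pwDl. Qed.

Lemma line_weight_ge0 r y : 0 <= line_weight r y. Proof. exact: powR_ge0. Qed.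

Lemma continuous_line_weight r : continuous (line_weight r).
Proof.
move=> y; rewrite (_ : line_weight r = (fun x => x `^ (- r)) \o (fun y => 1 + `|y|))//.
apply: continuous_comp.
  by apply: continuousD; [exact: cst_continuous|exact: norm_continuous].
have [dp _] := is_derive1_powR (- r) (line_weight_base_gt0 y).
exact/differentiable_continuous/derivable1_diffP.
Qed.

Lemma measurable_line_weight r : measurable_fun setT (line_weight r).
Proof. by apply: continuous_measurable_fun; exact: continuous_line_weight. Qed.

Notation leb := (@lebesgue_measure R).

Lemma integral_line_weight_half (r : R) : 1 < r ->
  (\int[leb]_(y in `[0%R, +oo[) (line_weight r y)%:E = (r - 1)^-1%:E)%E.
Proof.
move=> r1.
have r1' : 1 - r != 0 by rewrite subr_eq0 lt_eqF.
pose F (y : R) := (1 - r)^-1 * (1 + y) `^ (1 - r).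
have dF (y : R) : 0 <= y -> is_derive y 1 F ((1 + y) `^ (- r)).
  move=> y0; have y1 : 0 < 1 + y by rewrite ltr_pwDl.
  have d1 : is_derive y 1 (fun y : R => 1 + y) 1.
    by have := is_deriveD (is_derive_cst (1 : R) y 1) (is_derive_id y (1 : R));
        rewrite add0r.
  have := is_derive1_comp (is_derive1_powR (1 - r) y1) d1.
  rewrite mulr1 => d2.
  have d3 := is_deriveZ (1 - r)^-1 d2.
  suff <- : (1 - r)^-1 *: ((1 - r) * (1 + y) `^ (1 - r - 1)) = (1 + y) `^ (- r) by [].
  by rewrite [LHS]mulrA mulVf// mul1r addrAC subrr add0r.
have [d0 _] := dF 0 (lexx 0).
have : {for 0, continuous F}.
  exact/differentiable_continuous/derivable1_diffP.
rewrite /prop_for /continuous_at {2}/F addr0 powR1 mulr1 => cF0.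
have := @ge0_continuous_FTC2y R (line_weight r) F 0 0.
rewrite -EFinB /F addr0 powR1 mulr1 sub0r -invrN opprB; apply.
- by move=> x _; exact: line_weight_ge0.
- exact/continuous_subspaceT/continuous_line_weight.
- rewrite -[X in _ --> X](mulr0 (1 - r)^-1); apply: cvgMr.
  apply/cvgrPdist_le => eps eps0.
  have r10 : 0 < r - 1 by rewrite subr_gt0.
  have [M M0 hM] := powR_neg_small r10 eps0.
  near=> y; rewrite sub0r normrN ger0_norm ?powR_ge0// -opprB; apply: hM.
  rewrite ler_wpDl//; near: y; exact: nbhs_pinfty_ge.
- by move=> x /ltW /dF[].
- exact: cvg_at_right_filter.
- move=> x; rewrite in_itv/= andbT => x0.
  by rewrite derive1E; have [_ ->] := dF x (ltW x0); rewrite /line_weight gtr0_norm.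
Unshelve. all: by end_near. Qed.

Lemma integral_line_weight_lty (r : R) : 1 < r -> (\int[leb]_y (line_weight r y)%:E <
    +oo)%E.
Proof.
move=> r1; rewrite ge0_symfun_integralT.
- rewrite -set_itvcy integral_line_weight_half// -EFinM; exact: ltry.
- exact: line_weight_ge0.
- exact: continuous_line_weight.
- by move=> y; rewrite /line_weight/= normrN.
Qed.

Lemma integrable_line_weight (r : R) : 1 < r -> leb.-integrable setT (EFin \o
    line_weight r).
Proof.
move=> r1; apply/integrableP; split.
  by apply/measurable_EFinP; exact: measurable_line_weight.
under eq_integral do rewrite /= ger0_norm ?line_weight_ge0//.
exact: integral_line_weight_lty.
Qed.

(** The fundamental theorem of calculus on [-N, N], passed to the limit by
dominated convergence. *)
Lemma integral_derivative_eq0 (k k' : R -> R) (r eps C1 C2 : R) : 1 < r -> 0 < eps ->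
  (forall y : R, is_derive y 1 k (k' y)) -> continuous k' ->
  (forall y, `|k' y| <= C1 * line_weight r y) ->
  (forall y, `|k y| <= C2 * line_weight eps y) ->
  (\int[leb]_y (k' y)%:E = 0)%E.
Proof.
move=> r1 eps0 dk ck' bk' bk.
have C20 : 0 <= C2.
  have := le_trans (normr_ge0 _) (bk 0).
  by rewrite /line_weight normr0 addr0 powR1 mulr1.
have ck : continuous k.
  by move=> y; have [d0 _] := dk y; exact/differentiable_continuous/derivable1_diffP.
have mk' : measurable_fun setT k' by exact: continuous_measurable_fun.
pose itv (N : nat) : set R := `[- N.+1%:R, N.+1%:R]%classic.
pose f_ (N : nat) : R -> \bar R := (EFin \o k') \_ (itv N).
have EN N : (\int[leb]_y f_ N y = (k N.+1%:R - k (- N.+1%:R))%:E)%E.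
  rewrite /f_ -integral_mkcond (@continuous_FTC2 R k' k)//.
  - by rewrite gtrN.
  - exact: continuous_subspaceT.
  - split.
    + by move=> x _; have [] := dk x.
    + by apply: cvg_at_right_filter; exact: ck.
    + by apply: cvg_at_left_filter; exact: ck.
  - by move=> x _; rewrite derive1E; have [] := dk x.
have mf_ N : measurable_fun setT (f_ N).
  apply/(measurable_restrictT _ _).1 => //.
    exact: measurable_itv.
  by apply: measurable_funTS; exact/measurable_EFinP.
have mfk' : measurable_fun setT (EFin \o k') by exact/measurable_EFinP.
have f_f : {ae leb, forall y, setT y -> f_ ^~ y @ \oo --> (EFin \o k') y}.
  apply/aeW => y _; apply: cvg_near_cst.
  near=> N; rewrite /f_ patchE ifT// /itv inE/= in_itv/= -ler_norml.
  apply: (@le_trans _ _ N%:R); last by rewrite ler_nat.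
  near: N; exact: nbhs_infty_ger.
have ig : leb.-integrable setT (fun y => (C1 * line_weight r y)%:E).
  have := @integrableZl _ _ _ leb setT measurableT C1 _ (integrable_line_weight r1).
  by apply: eq_integrable => // y _ /=; rewrite EFinM.
have f_g : {ae leb, forall y N, setT y -> (`|f_ N y| <= (C1 * line_weight r y)%:E)%E}.
  apply/aeW => y N _; rewrite /f_ patchE; case: ifPn => _ /=.
    by rewrite lee_fin.
  by rewrite normr0 lee_fin (le_trans _ (bk' y)).
have [_ _] := @dominated_convergence _ _ R leb setT measurableT f_ (EFin \o k')
  (fun y => (C1 * line_weight r y)%:E) mf_ mfk' f_f ig f_g.
rewrite /= => cvg1.
have cvg2 : (k N.+1%:R - k (- N.+1%:R))%:E @[N --> \oo] --> (0%:E : \bar R).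
  apply: cvg_EFin; first exact: nearW.
  apply/cvgrPdist_le => e e0.
  have [M M0 hM] := powR_neg_small eps0 (divr_gt0 e0 (ltr_pwDr ltr01 (mulr_ge0 (ler0n
      _ 2) C20))).
  near=> N; rewrite /= sub0r normrN.
  have hN : M <= N.+1%:R.
    apply: (@le_trans _ _ N%:R); last by rewrite ler_nat.
    by near: N; exact: nbhs_infty_ger.
  have hk (y : R) : `|y| = N.+1%:R -> `|k y| <= C2 * (e / (2 * C2 + 1)).
    move=> yN; apply: (le_trans (bk y)); rewrite ler_wpM2l// /line_weight; apply: hM.
    by rewrite yN ler_wpDl.
  apply: (le_trans (ler_normB _ _)).
  have := hk N.+1%:R; rewrite ger0_norm// => /(_ erefl) h1.
  have := hk (- N.+1%:R); rewrite normrN ger0_norm// => /(_ erefl) h2.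
  apply: (le_trans (lerD h1 h2)).
  have p0 : 0 < 2 * C2 + 1 by rewrite ltr_pwDr// mulr_ge0.
  have -> : C2 * (e / (2 * C2 + 1)) + C2 * (e / (2 * C2 + 1)) =
    (2 * C2) * e / (2 * C2 + 1) by ring.
  rewrite ler_pdivrMr// [leRHS]mulrDr mulr1 [leLHS]mulrC lerDl; exact: ltW.
have EN' : (fun N => (k N.+1%:R - k (- N.+1%:R))%:E) = (fun N => \int[leb]_y f_ N y)%E.
  by apply/funext => N; rewrite EN.
rewrite EN' in cvg2.
exact: (cvg_unique _ cvg1 cvg2).
Unshelve. all: by end_near. Qed.
End improper.

Section tuples.
Context {R : realType}.
Notation T := (measurableTypeR R).
Notation leb := (@lebesgue_measure R).

Lemma integral_tcons_ge0 N (f : N.+1.-tuple T -> \bar R) : measurable_fun setT f ->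
  (forall t, 0 <= f t)%E ->
  (\int[lebesgueN R N.+1]_t f t = \int[leb \x lebesgueN R N]_z f (tcons z))%E.
Proof.
move=> mf f0; have := @ge0_integral_pushforward _ _ _ _ R _ (@measurable_tcons R N)
  (leb \x lebesgueN R N)%E setT f measurableT mf (fun t _ => f0 t).
by rewrite preimage_setT.
Qed.

Lemma integrable_tcons N (f : N.+1.-tuple T -> \bar R) :
  (lebesgueN R N.+1).-integrable setT f ->
  (leb \x lebesgueN R N)%E.-integrable setT (f \o @tcons R N).
Proof.
move=> /integrableP[mf f_fin]; apply/integrableP; split.
  exact: measurableT_comp mf (@measurable_tcons R N).
move: f_fin; rewrite integral_tcons_ge0//.
exact: measurableT_comp.
Qed.

Lemma integral_tcons N (f : N.+1.-tuple T -> \bar R) :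
  (lebesgueN R N.+1).-integrable setT f ->
  (\int[lebesgueN R N.+1]_t f t = \int[leb \x lebesgueN R N]_z f (tcons z))%E.
Proof.
move=> intf; have := @integral_pushforward _ _ _ _ R _ (@measurable_tcons R N)
  (leb \x lebesgueN R N)%E setT f (measurable_int _ intf).
rewrite preimage_setT => /(_ (integrable_tcons intf) measurableT) H.
exact: H.
Qed.

Definition set_coord N (j : 'I_N) (t : N.-tuple T) (y : R) : N.-tuple T :=
  [tuple if k == j then y else tnth t k | k < N].

Lemma set_coord_ord0 N (t : N.-tuple T) x y :
  set_coord ord0 (tcons (x, t)) y = tcons (y, t).
Proof.
apply: eq_from_tnth => k; rewrite tnth_mktuple.
case: (unliftP ord0 k) => [k'|] ->.
  by rewrite eq_sym (negbTE (neq_lift _ _)) !tnthS.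
by rewrite eqxx tnth0.
Qed.

Lemma set_coord_lift N (t : N.-tuple T) j x y :
  set_coord (lift ord0 j) (tcons (x, t)) y = tcons (x, set_coord j t y).
Proof.
apply: eq_from_tnth => k; rewrite tnth_mktuple.
case: (unliftP ord0 k) => [k'|] ->.
  by rewrite (inj_eq lift_inj) !tnthS tnth_mktuple.
by rewrite (negbTE (neq_lift _ _)) !tnth0.
Qed.

(** Reduces integration by parts in R^N to one real variable: when all integrals
along lines parallel to an axis vanish, so does the total integral.  The
induction on N peels off one coordinate with Fubini's theorem, and for the axis
that is peeled off the order of integration is exchanged. *)
Lemma integral_lines N (f : N.-tuple T -> \bar R) (j : 'I_N) :
  (lebesgueN R N).-integrable setT f ->
  (forall t, \int[leb]_y f (set_coord j t y) = 0)%E ->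
  (\int[lebesgueN R N]_t f t = 0)%E.
Proof.
elim: N f j => [f []//|N IH] f j intf hf.
rewrite integral_tcons//; have intf' := integrable_tcons intf.
case: (unliftP ord0 j) => [j'|] jE; rewrite {}jE in hf.
  rewrite -[LHS](integral12_prod_meas1 intf') /fubini_F.
  have ae := ae_integrable1 intf'.
  transitivity (\int[leb]_x (cst (0 : \bar R) x))%E;
      last by rewrite integral_cst// mul0e.
  apply: ae_eq_integral => //.
    exact: (measurable_fubini_F intf').
  apply: filterS ae => x ix _ /=; apply: (IH _ j') => // t.
  by rewrite -[RHS](hf (tcons (x, t))); apply: eq_integral => y _ /=;
      rewrite set_coord_lift.
rewrite -[LHS](integral21_prod_meas1 intf') /fubini_G.
rewrite -[RHS](integral0 (lebesgueN R N) setT); apply: eq_integral => t _.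
rewrite -[RHS](hf (tcons (0, t))); apply: eq_integral => y _ /=.
by rewrite set_coord_ord0.
Qed.

Definition box_weight N (r : R) (x : 'rV[R]_N) : R := \prod_j line_weight r (x ord0 j).

Lemma box_weight_ge0 N r (x : 'rV[R]_N) : 0 <= box_weight r x.
Proof. by apply: prodr_ge0 => j _; exact: line_weight_ge0. Qed.

Lemma line_weight_le1 (r y : R) : 0 <= r -> line_weight r y <= 1.
Proof.
move=> r0; apply: (@le_trans _ _ (1 `^ (- r))); last by rewrite powR1.
apply: powR_le_neg => //.
  by rewrite lerDl.
by rewrite oppr_le0.
Qed.

Lemma box_weight_le N r (x : 'rV[R]_N) j : 0 <= r ->
    box_weight r x <= line_weight r (x ord0 j).
Proof.
move=> r0; rewrite /box_weight (bigD1 j)//= ler_piMr ?line_weight_ge0//.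
by apply: prodr_ile1 => k _; rewrite line_weight_ge0 line_weight_le1.
Qed.

Notation rv := (@rv_of_tuple R _).

Lemma measurable_box_weight N r : measurable_fun setT (fun t :
    N.-tuple T => box_weight r (rv t)).
Proof.
apply: measurable_prod => j _; under eq_fun do rewrite mxE.
by apply: measurableT_comp; [exact: measurable_line_weight|exact: measurable_tnth].
Qed.

Lemma box_weight_tcons N r (z : T * N.-tuple T) :
  box_weight r (rv (tcons z)) = line_weight r z.1 * box_weight r (rv z.2).
Proof.
rewrite /box_weight big_ord_recl mxE tnth0; congr (_ * _).
by apply: eq_bigr => j _; rewrite !mxE tnthS.
Qed.

Lemma integrable_box_weight N r : 1 < r ->
  (lebesgueN R N).-integrable setT (fun t => (box_weight r (rv t))%:E).
Proof.
move=> r1; apply/integrableP; split.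
  by apply/measurable_EFinP; exact: measurable_box_weight.
under eq_integral do rewrite /= ger0_norm ?box_weight_ge0//.
elim: N => [|N IH].
  rewrite /= integral_dirac//; last by apply/measurable_EFinP; exact:
      measurable_box_weight.
  by rewrite diracT mul1e ltry.
rewrite integral_tcons_ge0; last 2 first.
- by apply/measurable_EFinP; exact: measurable_box_weight.
- by move=> t; rewrite lee_fin box_weight_ge0.
under eq_integral do rewrite box_weight_tcons.
have mh : measurable_fun setT (fun z : T * N.-tuple T => line_weight r z.1 *
    box_weight r (rv z.2)).
  apply: measurable_funM.
    by apply: measurableT_comp; [exact: measurable_line_weight|exact: measurable_fst].
  by apply: (@measurableT_comp _ _ _ _ _ _ (fun t => box_weight r (rv t))); [exact:
      measurable_box_weight|exact: measurable_snd].
rewrite fubini_tonelli1//; last 2 first.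
- by apply/measurable_EFinP.
- by move=> z; rewrite lee_fin mulr_ge0 ?line_weight_ge0 ?box_weight_ge0.
rewrite /fubini_F/=.
under eq_integral => x _.
  under eq_integral do rewrite EFinM.
  rewrite ge0_integralZl//; last 3 first.
  - by apply/measurable_EFinP; exact: measurable_box_weight.
  - by move=> t _; rewrite lee_fin box_weight_ge0.
  - by rewrite lee_fin line_weight_ge0.
  over.
have hw0 : (0 <= \int[leb]_y (line_weight r y)%:E)%E.
  by apply: integral_ge0 => y _; rewrite lee_fin line_weight_ge0.
rewrite ge0_integralZr//.
- by apply: lte_mul_pinfty => //; rewrite ge0_fin_numE// integral_line_weight_lty.
- by apply/measurable_EFinP; exact: measurable_line_weight.
- by move=> y _; rewrite lee_fin line_weight_ge0.
- by apply: integral_ge0 => t _; rewrite lee_fin box_weight_ge0.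
Qed.

End tuples.

Section joint_integral.
Context {R : realType} {n s : nat}.
Notation T := (measurableTypeR R).
Notation leb := (@lebesgue_measure R).
Notation W := ('rV[R]_n * 'rV[R]_s)%type.
Notation I := ('I_n + 'I_s)%type.
Notation e := (@dirxt R n s).
Notation rv := (@rv_of_tuple R _).
Notation P := (lebesgueN R n \x lebesgueN R s)%E.

Definition joint_row (z : n.-tuple T * s.-tuple T) : W := (rv z.1, rv z.2).

Lemma measurable_joint_row (F : W -> R) : continuous F ->
  measurable_fun setT (fun z => F (joint_row z)).
Proof.
move=> cF; apply: (measurable_fun_continuous (g1 := fun z => rv z.1)
  (g2 := fun z => rv z.2)) => // j.
  under eq_fun do rewrite mxE.
  by apply: (@measurableT_comp _ _ _ _ _ _ (fun t => tnth t j));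
    [exact: measurable_tnth|exact: measurable_fst].
under eq_fun do rewrite mxE.
by apply: (@measurableT_comp _ _ _ _ _ _ (fun t => tnth t j));
  [exact: measurable_tnth|exact: measurable_snd].
Qed.

Lemma measurable_rv1 (F : W -> R) y : continuous F ->
  measurable_fun setT (fun t => F (rv t, y)).
Proof.
move=> cF; apply: (measurable_fun_continuous (g1 := fun z => rv z)
  (g2 := fun z => y)) => // j.
by under eq_fun do rewrite mxE; exact: measurable_tnth.
Qed.

Lemma measurable_rv2 (F : W -> R) x : continuous F ->
  measurable_fun setT (fun t => F (x, rv t)).
Proof.
move=> cF; apply: (measurable_fun_continuous (g1 := fun z => x)
  (g2 := fun z => rv z)) => // j.
by under eq_fun do rewrite mxE; exact: measurable_tnth.
Qed.

Definition joint_weight (r : R) (z : W) : R := box_weight 2 z.1 * box_weight r z.2.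

Lemma joint_weight_ge0 r z : 0 <= joint_weight r z.
Proof. by rewrite mulr_ge0 ?box_weight_ge0. Qed.

Lemma measurable_joint_weight r : measurable_fun setT (fun z => joint_weight r
    (joint_row z)).
Proof.
apply: measurable_funM.
  by apply: (@measurableT_comp _ _ _ _ _ _ (fun t => box_weight 2 (rv t)));
    [exact: measurable_box_weight|exact: measurable_fst].
by apply: (@measurableT_comp _ _ _ _ _ _ (fun t => box_weight r (rv t)));
  [exact: measurable_box_weight|exact: measurable_snd].
Qed.

Lemma integrable_joint_weight r : 1 < r -> P.-integrable setT (fun z => (joint_weight
    r (joint_row z))%:E).
Proof.
move=> r1; apply/integrable12ltyP.
  by apply/measurable_EFinP; exact: measurable_joint_weight.
have r2 : 1 < 2 :> R by rewrite ltr1n.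
have lt1 := integrable_lty measurableT (integrable_box_weight n r2).
have lt2 := integrable_lty measurableT (integrable_box_weight s r1).
have ge1 : (0 <= \int[lebesgueN R n]_t (box_weight 2 (rv t))%:E)%E.
  by apply: integral_ge0 => t _; rewrite lee_fin box_weight_ge0.
have ge2 : (0 <= \int[lebesgueN R s]_t (box_weight r (rv t))%:E)%E.
  by apply: integral_ge0 => t _; rewrite lee_fin box_weight_ge0.
under eq_integral => x _.
  under eq_integral do rewrite /= ger0_norm ?joint_weight_ge0// /joint_weight/= EFinM.
  rewrite ge0_integralZl//; last 3 first.
  - by apply/measurable_EFinP; exact: measurable_box_weight.
  - by move=> t _; rewrite lee_fin box_weight_ge0.
  - by rewrite lee_fin box_weight_ge0.
  over.
rewrite ge0_integralZr//.
- by apply: lte_mul_pinfty => //; rewrite ge0_fin_numE.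
- by apply/measurable_EFinP; exact: measurable_box_weight.
- by move=> y _; rewrite lee_fin box_weight_ge0.
Qed.

(** The weight in x is fixed: amplitudes are compactly supported in x, and any
integrable majorant of the indicator of a compact set will do. *)
Definition dominated r (F : W -> R) C := [/\ continuous F, 0 <= C &
  forall z, `|F z| <= C * joint_weight r z].

Lemma integrable_dominated r F C : 1 < r -> dominated r F C ->
  P.-integrable setT (fun z => (F (joint_row z))%:E).
Proof.
move=> r1 [cF C0 hF].
apply: (@le_integrable _ _ _ P setT measurableT _ (fun z => C%:E * (joint_weight r
    (joint_row z))%:E)%E).
- by apply/measurable_EFinP; exact: measurable_joint_row.
- move=> z _; rewrite -EFinM abse_EFin lee_fin.
  rewrite [leRHS]ger0_norm; [exact: hF|exact: mulr_ge0 C0 (joint_weight_ge0 _ _)].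
- by apply: integrableZl => //; exact: integrable_joint_weight.
Qed.

Lemma integrable_dominated1 r F C y : 1 < r -> dominated r F C ->
  (lebesgueN R n).-integrable setT (fun t => (F (rv t, y))%:E).
Proof.
move=> r1 [cF C0 hF].
have r2 : 1 < 2 :> R by rewrite ltr1n.
apply: (@le_integrable _ _ _ (lebesgueN R n) setT measurableT _
  (fun t => (C * box_weight r y)%:E * (box_weight 2 (rv t))%:E)%E).
- by apply/measurable_EFinP; exact: measurable_rv1.
- move=> z _; rewrite -EFinM abse_EFin lee_fin.
  rewrite [leRHS]ger0_norm ?mulr_ge0 ?box_weight_ge0//.
  by rewrite -mulrA (mulrC (box_weight r y)); exact: hF.
- by apply: integrableZl => //; exact: integrable_box_weight.
Qed.

Lemma integrable_dominated2 r F C x : 1 < r -> dominated r F C ->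
  (lebesgueN R s).-integrable setT (fun t => (F (x, rv t))%:E).
Proof.
move=> r1 [cF C0 hF].
apply: (@le_integrable _ _ _ (lebesgueN R s) setT measurableT _
  (fun t => (C * box_weight 2 x)%:E * (box_weight r (rv t))%:E)%E).
- by apply/measurable_EFinP; exact: measurable_rv2.
- move=> z _; rewrite -EFinM abse_EFin lee_fin.
  rewrite [leRHS]ger0_norm ?mulr_ge0 ?box_weight_ge0//.
  by rewrite -mulrA; exact: hF.
- by apply: integrableZl => //; exact: integrable_box_weight.
Qed.

Definition Jint (F : W -> R) : R := \int[P]_z F (joint_row z).

Lemma Jint_lin r c F G C D : 1 < r -> dominated r F C -> dominated r G D ->
  Jint (fun z => c * F z + G z) = c * Jint F + Jint G.
Proof.
move=> r1 dF dG; rewrite /Jint RintegralD//.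
- by rewrite RintegralZl//; exact: integrable_dominated dF.
- by have := integrableZl measurableT c (integrable_dominated r1 dF);
    apply: eq_integrable => // z _ /=; rewrite EFinM.
- exact: integrable_dominated dG.
Qed.

Lemma Jint_bound r F C : 1 < r -> dominated r F C ->
    `|Jint F| <= C * Jint (joint_weight r).
Proof.
move=> r1 dF; have [cF C0 hF] := dF.
rewrite /Jint -RintegralZl//; last exact: integrable_joint_weight.
apply: (le_trans (le_normr_Rintegral _ _)) => //; first exact: integrable_dominated dF.
apply: le_Rintegral => //.
- exact: (integrable_norm (integrable_dominated r1 dF)).
- by have := integrableZl measurableT C (integrable_joint_weight r1);
    apply: eq_integrable => // z _ /=; rewrite EFinM.
Qed.

Lemma dominated_add r F G C D : dominated r F C -> dominated r G D ->
  dominated r (fun z => F z + G z) (C + D).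
Proof.
move=> [cF C0 hF] [cG D0 hG]; split; last 2 first.
- exact: addr_ge0.
- by move=> z; rewrite mulrDl (le_trans (ler_normD _ _))// lerD.
by move=> z; apply: continuousD; [exact: cF|exact: cG].
Qed.

Lemma Jint_sum r (U : Type) (l : seq U) (F : U -> W -> R) : 1 < r ->
  (forall i, exists C, dominated r (F i) C) ->
  Jint (fun z => \sum_(i <- l) F i z) = \sum_(i <- l) Jint (F i).
Proof.
move=> r1 hF.
suff [_ ->] : (exists C, dominated r (fun z => \sum_(i <- l) F i z) C) /\
  Jint (fun z => \sum_(i <- l) F i z) = \sum_(i <- l) Jint (F i) by [].
elim: l => [|i l [[C IH1] IH2]].
  have -> : (fun z => \sum_(i <- [::]) F i z) = fun=> 0.
    by apply/funext => z; rewrite big_nil.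
  split; last by rewrite big_nil /Jint /Rintegral integral0.
  exists 0; split=> // [|z]; first exact: cst_continuous.
  by rewrite normr0 mul0r.
have -> : (fun z => \sum_(i <- i :: l) F i z) =
    fun z => F i z + \sum_(i <- l) F i z.
  by apply/funext => z; rewrite big_cons.
have [D hD] := hF i; split; first by exists (D + C); exact: dominated_add.
have := Jint_lin 1 r1 hD IH1; rewrite mul1r IH2 big_cons => <-.
by congr Jint; apply/funext => z; rewrite mul1r.
Qed.

Definition joint_coord (i : I) (z : W) : R :=
  match i with inl i => z.1 ord0 i | inr j => z.2 ord0 j end.

Lemma rv_set_coord N j (t : N.-tuple T) y :
  rv (set_coord j t y) = rv (set_coord j t 0) + y *: dirv R j.
Proof.
apply/rowP => k; rewrite !mxE !tnth_mktuple eqxx/=.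
by case: eqP => _; rewrite ?mulr1 ?mulr0 ?add0r ?addr0.
Qed.

Lemma continuous_line (F : W -> R) z i : continuous F ->
  continuous (fun y : R => F (z + y *: e i)).
Proof.
move=> cF y; apply: (@continuous_comp _ _ _ (fun y : R => z + y *: e i) F);
    last exact: cF.
apply: (@continuousD _ _ _ (fun=> z) (fun y : R => y *: e i)).
  exact: cst_continuous.
exact: scalel_continuous.
Qed.

Lemma integral_line_derive_eq0 r (G G' : W -> R) i C eps z : 1 < r -> 0 < eps ->
  continuous G' -> (forall z, is_derive z (e i) G (G' z)) ->
  (forall y : R, `|G' (z + y *: e i)| <= C * line_weight r (joint_coord i z + y)) ->
  (exists C2, forall y, `|G (z + y *: e i)| <= C2 * line_weight eps (joint_coord i z
      + y)) ->
  joint_coord i z = 0 ->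
  (\int[leb]_y (G' (z + y *: e i))%:E = 0)%E.
Proof.
move=> r1 eps0 cG' dG bG' [C2 bG] zi0.
apply: (@integral_derivative_eq0 R (fun y => G (z + y *: e i)) _ r eps C C2) => //.
- by move=> y; apply: (is_derive_line _ _ _ _ _).1.
- exact: continuous_line.
- by move=> y; have := bG' y; rewrite zi0 add0r.
- by move=> y; have := bG y; rewrite zi0 add0r.
Qed.

(** The decay of G along lines is required separately from the domination of its
derivative: for mu < 1 the primitive that occurs below has a larger order than
its derivative and is not integrable itself. *)
Lemma Jint_derive r (G G' : W -> R) i C eps : 1 < r -> 0 < eps ->
  dominated r G' C -> (forall z, is_derive z (e i) G (G' z)) ->
  (forall z, exists C2, forall y : R,
     `|G (z + y *: e i)| <= C2 * line_weight eps (joint_coord i z + y)) ->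
  Jint G' = 0.
Proof.
move=> r1 eps0 dG' dG bG; have [cG' C0 hG'] := dG'.
have r2 : 1 < 2 :> R by rewrite ltr1n.
suff E : (\int[P]_z (G' (joint_row z))%:E = 0)%E by rewrite /Jint /Rintegral E.
have intG' := integrable_dominated r1 dG'.
case: i dG bG => j dG bG.
  rewrite -[LHS](integral21_prod_meas1 intG') /fubini_G.
  rewrite -[RHS](integral0 (lebesgueN R s) setT); apply: eq_integral => t _.
  apply: (integral_lines (j := j)); first exact: (integrable_dominated1 (rv t) r1 dG').
  move=> x; pose z : W := (rv (set_coord j x 0), rv t).
  have zE y : (rv (set_coord j x y), rv t) = z + y *: e (inl j).
    by rewrite rv_set_coord; congr pair; rewrite /= scaler0 addr0.
  under eq_integral do rewrite /joint_row/= zE.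
  have zj : joint_coord (inl j) z = 0 by rewrite /= mxE tnth_mktuple eqxx.
  apply: (@integral_line_derive_eq0 2 G G' (inl j) (C * box_weight r (rv t)) eps z)
      => // y.
  rewrite zj add0r -zE; apply: (le_trans (hG' _)); rewrite -mulrA ler_wpM2l//.
  rewrite [leRHS]mulrC /joint_weight/= ler_wpM2r ?box_weight_ge0//.
  by apply: (le_trans (box_weight_le _ j _)) => //; rewrite mxE tnth_mktuple eqxx.
rewrite -[LHS](integral12_prod_meas1 intG') /fubini_F.
rewrite -[RHS](integral0 (lebesgueN R n) setT); apply: eq_integral => t _.
apply: (integral_lines (j := j)); first exact: (integrable_dominated2 (rv t) r1 dG').
move=> x; pose z : W := (rv t, rv (set_coord j x 0)).
have zE y : (rv t, rv (set_coord j x y)) = z + y *: e (inr j).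
  by rewrite rv_set_coord; congr pair; rewrite /= scaler0 addr0.
under eq_integral do rewrite /joint_row/= zE.
have zj : joint_coord (inr j) z = 0 by rewrite /= mxE tnth_mktuple eqxx.
apply: (@integral_line_derive_eq0 r G G' (inr j) (C * box_weight 2 (rv t)) eps z) =>
    // y.
rewrite zj add0r -zE; apply: (le_trans (hG' _)); rewrite -mulrA ler_wpM2l//.
rewrite /joint_weight/= ler_wpM2l ?box_weight_ge0//.
apply: (le_trans (box_weight_le _ j _)); first exact: ltW (lt_trans ltr01 r1).
by rewrite mxE tnth_mktuple eqxx.
Qed.

End joint_integral.

(** * Amplitudes and integration by parts *)

Section weights.
Context {R : realType} {n s : nat}.
Notation W := ('rV[R]_n * 'rV[R]_s)%type.

Lemma open_cylinder (U : set 'rV[R]_n) : open U -> open (U `*` [set: 'rV[R]_s]).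
Proof.
move=> oU; rewrite (_ : _ `*` _ = (fst : W -> _) @^-1` U).
  by apply: open_comp => // z _; exact: cvg_fst.
by apply/seteqP; split => z //= -[].
Qed.

(** Compares the indicator function of a compact set with the weight in x. *)
Lemma compact_box_weight (K : set 'rV[R]_n) : compact K ->
  exists2 CK, 0 <= CK & forall x, K x -> 1 <= CK * box_weight 2 x.
Proof.
move=> /compact_bounded[M0 [_ hM0]].
pose M := `|M0| + 1.
have hM x : K x -> `|x| <= M.
  by apply: hM0; rewrite (le_lt_trans (ler_norm M0))// ltrDl.
have M0' : 0 < 1 + M by rewrite ltr_pwDl// addr_ge0.
exists (\prod_(j < n) (1 + M) `^ 2).
  by apply: prodr_ge0 => j _; exact: powR_ge0.
move=> x Kx; rewrite /box_weight -big_split/=.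
apply: (@le_trans _ _ (\prod_(j < n) 1)); first by rewrite big1.
apply: ler_prod => j _; rewrite ler01/= /line_weight powRN.
rewrite ler_pdivlMr ?powR_gt0// ?ltr_pwDl// mul1r.
apply: ge0_ler_powR => //; rewrite ?nnegrE ?addr_ge0//.
rewrite lerD2l; apply: le_trans (hM x Kx).
by rewrite [leRHS]mx_normrE; exact: (le_bigmax _ (fun i => `|x i.1 i.2|) (ord0, j)).
Qed.

(** Since 1 + |theta| is at least 1 + |theta_j| for each j, its power m is at
most the product over j of the powers m / s of 1 + |theta_j|, and -m / s > 1. *)
Lemma bracket_le_box_weight (m : R) : m < - s%:R ->
  exists2 r, 1 < r & forall z : W, bracket z `^ m <= box_weight r z.2.
Proof.
move=> ms; have m0 : m <= 0 by rewrite ltW// (lt_le_trans ms)// oppr_le0.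
have [s0|s0] := posnP s.
  exists 2; first by rewrite ltr1n.
  move=> z; rewrite /box_weight big1; last by move=> j; exfalso; move: j;
      rewrite s0 => -[].
  apply: (@le_trans _ _ (1 `^ m)); last by rewrite powR1.
  exact: powR_le_neg (bracket_ge1 z) m0.
have s0' : 0 < s%:R :> R by rewrite ltr0n.
exists (- m / s%:R).
  by rewrite ltr_pdivlMr// mul1r ltrNr.
move=> z; rewrite /box_weight /line_weight mulNr opprK.
have -> : bracket z `^ m = \prod_(j < s) bracket z `^ (m / s%:R).
  by rewrite prodr_const card_ord -powR_mulrn ?powR_ge0// -powRrM divfK// gt_eqF.
apply: ler_prod => j _; rewrite powR_ge0/=; apply: powR_le_neg.
- exact: line_weight_base_gt0.
- by rewrite lerD2l enorm_coord.
- by rewrite mulr_le0_ge0// invr_ge0 ltW.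
Qed.

End weights.

Section amplitudes.
Context {R : realType} {n s : nat}.
Notation W := ('rV[R]_n * 'rV[R]_s)%type.
Notation I := ('I_n + 'I_s)%type.
Notation e := (@dirxt R n s).
Variables (Omega : set 'rV[R]_n).
Hypothesis oOmega : open Omega.
Notation O := (Omega `*` [set: 'rV[R]_s]).
Variable K : set 'rV[R]_n.
Hypotheses (cK : compact K) (KO : K `<=` Omega).

Let oO : open O. Proof. exact: open_cylinder. Qed.

Let KO' (z : W) : K z.1 -> O z. Proof. by move=> /KO. Qed.

Definition off_compact : set W := ~` K `*` [set: 'rV[R]_s].

Lemma open_off_compact : open off_compact.
Proof.
apply: open_cylinder.
by apply: closed_openC; apply: compact_closed => //; exact: norm_hausdorff.
Qed.

Definition zero_off (A : W -> R) := forall z, ~ K z.1 -> A z = 0.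

Lemma zero_off_is_derive A z v : zero_off A -> ~ K z.1 -> is_derive z v A 0.
Proof.
move=> hA Kz; have Oz : off_compact z by split.
have A0 y : off_compact y -> 0 = A y by move=> [/= Ky _]; rewrite hA.
have [E1 E2] := derive_ext_open v open_off_compact A0 Oz.
split; first by apply: E2; exact: derivable_cst.
by rewrite -E1; exact: derive_cst.
Qed.

Lemma zero_off_derive A i : zero_off A -> zero_off (fun z => 'D_(e i) A z).
Proof. by move=> hA z Kz; have [_ ->] := zero_off_is_derive (e i) hA Kz. Qed.

Lemma zero_off_continuous A : zero_off A -> (forall z, O z -> {for z, continuous A}) ->
  continuous A.
Proof.
move=> hA cA z; have [/KO' /cA//|Kz] := pselect (K z.1).
have Oz : off_compact z by split.
have A0 y : off_compact y -> 0 = A y by move=> [/= Ky _]; rewrite hA.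
exact: (continuous_ext_open open_off_compact A0 Oz (@cst_continuous _ _ 0 z)).
Qed.

(** The product of a symbol of order m and a test function of class C^p: only p
derivatives are available, and the support in x lies in K.  Nothing is asked of
A near the boundary of Omega, where it vanishes. *)
Definition amplitude (p : nat) (m : R) (A : W -> R) (C : R) :=
  [/\ Cn e p O A, zero_off A, 0 <= C & forall z, K z.1 ->
      dbound p A z (C * bracket z `^ m)].

Lemma amplitude_le p q m m' A C : (q <= p)%N -> m <= m' -> amplitude p m A C ->
    amplitude q m' A C.
Proof.
move=> qp mm [hA zA C0 bA]; split=> //; first exact: Cn_le hA.
by move=> z Kz; apply: (dbound_mono qp _ (bA z Kz)); rewrite ler_wpM2l// bracket_le.
Qed.

Lemma amplitude_mul p m m' (B : W -> R) : Cn e p O B -> has_order K p B m' ->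
  exists2 L, 0 <= L & forall A C, amplitude p m A C ->
    amplitude p (m + m') (fun z => A z * B z) (L * C).
Proof.
move=> hB [D D0 bB]; exists (2 ^+ p * D); first by rewrite mulr_ge0// exprn_ge0.
move=> A C [hA zA C0 bA]; split.
- exact: Cn_mul.
- by move=> z Kz; rewrite zA// mul0r.
- by rewrite !mulr_ge0// exprn_ge0.
- move=> z Kz; have := dbound_mul oO (KO' Kz) hA hB (bA z Kz) (bB z Kz).
  by apply: dbound_weak; rewrite bracketD le_eqVlt; apply/orP; left; apply/eqP; ring.
Qed.

Lemma amplitude_derive p m A C i : amplitude p.+1 m A C ->
  amplitude p (m - theta_exp i) (fun z => 'D_(e i) A z) C.
Proof.
move=> [hA zA C0 bA]; split=> //.
- exact: Cn_derive.
- exact: zero_off_derive.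
- by move=> z Kz; rewrite bracketD mulrA; exact: dbound_derive (bA z Kz).
Qed.

Lemma amplitude_lin p m c A B C D : amplitude p m A C -> amplitude p m B D ->
  amplitude p m (fun z => c * A z + B z) (`|c| * 2 ^+ p * C + D).
Proof.
move=> [hA zA C0 bA] [hB zB D0 bB]; have hc := Cn_cst e O p c.
split.
- by apply: Cn_add => //; exact: Cn_mul.
- by move=> z Kz; rewrite zA// zB// mulr0 addr0.
- by rewrite addr_ge0// !mulr_ge0// exprn_ge0.
- move=> z Kz; rewrite mulrDl.
  have := dbound_add oO (KO' Kz) (Cn_mul oO hc hA) hB
    (dbound_mul oO (KO' Kz) hc hA (@dbound_cst _ _ _ p c z) (bA z Kz)) (bB z Kz).
  by apply: dbound_weak; rewrite lerD2r le_eqVlt; apply/orP; left; apply/eqP; ring.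
Qed.

Lemma amplitude_sum (T : Type) (r : seq T) p m (A : T -> W -> R) (L : T -> R) C :
    0 <= C ->
  (forall i, amplitude p m (A i) (L i * C)) ->
  amplitude p m (fun z => \sum_(i <- r) A i z) ((\sum_(i <- r) L i) * C).
Proof.
move=> C0 hA; split.
- by apply: Cn_sum => // i; have [] := hA i.
- by move=> z Kz; rewrite big1// => i _; have [_ zA _ _] := hA i; exact: zA.
- by rewrite mulr_suml sumr_ge0// => i _; have [] := hA i.
- move=> z Kz; have := dbound_sum oO (N := p) r (f := A) (c := fun i => L i * C *
      bracket z `^ m) (KO' Kz).
  rewrite !mulr_suml; apply.
    by move=> i; have [] := hA i.
  by move=> i; have [_ _ _] := hA i; exact.
Qed.

Variables (mu : R) (phi : W -> R).
Hypotheses (mu0 : 0 < mu) (sphi : forall k, Cn e k O phi).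
Hypothesis bphi : forall N, has_order K N phi mu.
Hypothesis ellipticity : exists C D : R, [/\ 0 < C, 0 < D &
        forall x theta, K x -> D <= enorm theta ->
          C * enorm theta `^ (2 * mu) <=
          gradx_sq phi (x, theta) +
            enorm theta ^+ 2 * gradt_sq phi (x, theta)].

(** The formal divergence of A times the field: the terms that remain once the
derivative has been moved away from the oscillating factor. *)
Definition transport (A : W -> R) (z : W) : R :=
  \sum_i 'D_(e i) (fun y => A y * phase_field phi i y) z.

Definition damp (A : W -> R) (z : W) : R := A z * phase_damping phi z.

Lemma amplitude_damp p m : exists2 L, 0 <= L & forall A C, amplitude p m A C ->
  amplitude p (m - mu) (damp A) (L * C).
Proof.
have Nw : Cn e p O (phase_damping phi) by exact: Cn_phase_damping.
have ow : has_order K p (phase_damping phi) (- mu).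
  apply: (has_order_mono _ (has_order_phase_damping oO mu0 sphi KO bphi ellipticity
      p)); rewrite lerN2.
  by rewrite ler_peMl ?(ltW mu0)// ler1n.
exact: (amplitude_mul m Nw ow).
Qed.

Lemma amplitude_transport p m : exists2 L, 0 <= L & forall A C, amplitude p.+1 m A C ->
  amplitude p (m - mu) (transport A) (L * C).
Proof.
have h i : exists2 L, 0 <= L & forall A C, amplitude p.+1 m A C ->
    amplitude p.+1 (m + (theta_exp i - mu)) (fun z => A z * phase_field phi i z) (L *
        C).
  apply: amplitude_mul; first exact: Cn_phase_field.
  exact: (has_order_phase_field oO mu0 sphi KO bphi ellipticity p.+1 i).
pose L i := sval (cid2 (h i)).
exists (\sum_i L i); first by apply: sumr_ge0 => i _; rewrite /L; case: cid2.
move=> A C hA; have C0 : 0 <= C by have [] := hA.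
apply: amplitude_sum => // i; rewrite /L; case: cid2 => /= Li _ hL.
have := amplitude_derive i (hL _ _ hA).
by rewrite (_ : m + (theta_exp i - mu) - theta_exp i = m - mu)//; ring.
Qed.

Definition osc_integrand (tau : R) (A : W -> R) (z : W) : R := A z * cos (phi z + tau).

Lemma is_derive_cos_phi tau i z : O z ->
  is_derive z (e i) (fun y => cos (phi y + (tau - pi / 2)))
    (cos (phi z + tau) * 'D_(e i) phi z).
Proof.
move=> Oz; have d1 := derivableP (Cn_derivable (i := i) (sphi 1) Oz).
have d2 : is_derive (phi z) 1 (fun t : R => cos (t + (tau - pi / 2)))
    (cos (phi z + tau)).
  have d3 : is_derive (phi z) 1 (fun t : R => t + (tau - pi / 2)) 1.
    by have := is_deriveD (is_derive_id (phi z) (1 : R))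
      (is_derive_cst (tau - pi / 2) (phi z) (1 : R)); rewrite addr0.
  have := @is_derive_comp R _ (fun t : R => t + (tau - pi / 2)) cos _ _ _ _ d3
    (is_derive_cos (phi z + (tau - pi / 2))).
  by rewrite mulr1 addrA sinBpihalf opprK.
exact: (is_derive_comp d1 d2).
Qed.

Lemma continuous_osc_integrand tau A : (forall z, O z -> {for z, continuous A}) ->
    zero_off A ->
  continuous (osc_integrand tau A).
Proof.
move=> cA zA; apply: zero_off_continuous => [z Kz|z Oz].
  by rewrite /osc_integrand zA// mul0r.
apply: continuousM; first exact: cA.
apply: (@continuous_comp _ _ _ (fun y => phi y + tau) cos); last exact: continuous_cos.
by apply: continuousD; [exact: (Cn_continuous (sphi 0))|exact: cst_continuous].
Qed.

(** The exponent r and the constant depend on m and K alone, so that all the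
integrands of the integration by parts share one majorant. *)
Lemma dominated_osc m : m < - s%:R -> exists r L, [/\ 1 < r, 0 <= L &
  forall tau A C, amplitude 0 m A C -> dominated r (osc_integrand tau A) (L * C)].
Proof.
move=> /(@bracket_le_box_weight R n s)[r r1 hr]; have [CK CK0 hK] :=
    compact_box_weight cK.
exists r, CK; split=> // tau A C [hA zA C0 bA]; split.
- by apply: continuous_osc_integrand => //; exact: (Cn_continuous hA).
- exact: mulr_ge0.
- move=> z; rewrite /osc_integrand; have [Kz|Kz] := pselect (K z.1); last first.
    by rewrite zA// mul0r normr0 mulr_ge0 ?joint_weight_ge0 ?mulr_ge0.
  rewrite normrM; apply: (@le_trans _ _ (`|A z|)).
    by rewrite ler_piMr// cos_max.
  apply: (le_trans (dbound_val (bA z Kz))).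
  apply: (@le_trans _ _ (C * box_weight r z.2)); first by rewrite ler_wpM2l.
  rewrite /joint_weight -[leLHS]mul1r.
  have -> : CK * C * (box_weight 2 z.1 * box_weight r z.2) = CK * box_weight 2 z.1 *
      (C * box_weight r z.2) by ring.
  by rewrite ler_wpM2r ?mulr_ge0 ?box_weight_ge0// hK.
Qed.

(** The regularized integral of A cos (phi + tau), by p integrations by parts.
A phase shift instead of the pair cos, sin keeps the recursion real-valued and
in a single function. *)
Fixpoint real_osc (p : nat) (tau : R) (A : W -> R) : R :=
  if p is q.+1 then
    real_osc q tau (damp A) - real_osc q (tau - pi / 2) (transport A)
  else Jint (osc_integrand tau A).

Lemma real_osc_bound p m : m - p%:R * mu < - s%:R ->
  exists2 L, 0 <= L & forall tau A C, amplitude p m A C -> `|real_osc p tau A| <= L * C.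
Proof.
elim: p m => [|p IH] m.
  rewrite mul0r subr0 => ms; have [r [L [r1 L0 h]]] := dominated_osc ms.
  exists (L * @Jint R n s (joint_weight r)).
    rewrite mulr_ge0// /Jint; apply: Rintegral_ge0 => z _; exact: joint_weight_ge0.
  move=> tau A C /(h tau) /(Jint_bound r1) /le_trans; apply.
  by rewrite mulrAC.
move=> ms; have {}ms : m - mu - p%:R * mu < - s%:R.
  by move: ms; rewrite -natr1 mulrDl mul1r opprD addrA addrAC.
have [L L0 hL] := IH _ ms.
have [L1 L10 h1] := amplitude_damp p m; have [L2 L20 h2] := amplitude_transport p m.
exists (L * L1 + L * L2); first by rewrite addr_ge0// mulr_ge0.
move=> tau A C hA /=; rewrite [leRHS]mulrDl.
have hA' := amplitude_le (leqnSn p) (lexx m) hA.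
apply: (le_trans (ler_normB _ _)); apply: lerD.
  by rewrite -mulrA; apply: hL; exact: h1.
by rewrite -mulrA; apply: hL; exact: h2.
Qed.

Lemma transport_lin c A B z : Cn e 1 O A -> Cn e 1 O B -> zero_off A -> zero_off B ->
  transport (fun z => c * A z + B z) z = c * transport A z + transport B z.
Proof.
move=> hA hB zA zB; rewrite /transport mulr_sumr -big_split/=; apply: eq_bigr => i _.
have [Kz|Kz] := pselect (K z.1); last first.
  rewrite !(zero_off_derive i _ Kz) ?mulr0 ?addr0//.
  - by move=> y Ky; rewrite zB// mul0r.
  - by move=> y Ky; rewrite zA// mul0r.
  - by move=> y Ky; rewrite zA// zB// mulr0 addr0 mul0r.
have Oz := KO' Kz; have hv : Cn e 1 O (phase_field phi i) by exact: Cn_phase_field.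
have dA := Cn_derivable (i := i) (Cn_mul oO hA hv) Oz.
have dB := Cn_derivable (i := i) (Cn_mul oO hB hv) Oz.
have := is_deriveD (is_deriveZ c (derivableP dA)) (derivableP dB) => -[_ <-].
by congr ('D_(e i) _ z); apply/funext => y /=; rewrite mulrDl -mulrA.
Qed.

Lemma real_osc_lin p m tau c A B C D : m - p%:R * mu < - s%:R ->
  amplitude p m A C -> amplitude p m B D ->
  real_osc p tau (fun z => c * A z + B z) = c * real_osc p tau A + real_osc p tau B.
Proof.
elim: p m tau A B C D => [|p IH] m tau A B C D.
  rewrite mul0r subr0 => ms hA hB; have [r [L [r1 L0 h]]] := dominated_osc ms.
  rewrite /= -(Jint_lin c r1 (h tau _ _ hA) (h tau _ _ hB)); congr Jint.
  by apply/funext => z; rewrite /osc_integrand; ring.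
move=> ms hA hB; have {}ms : m - mu - p%:R * mu < - s%:R.
  by move: ms; rewrite -natr1 mulrDl mul1r opprD addrA addrAC.
have [L1 L10 h1] := amplitude_damp p m; have [L2 L20 h2] := amplitude_transport p m.
have hA' := amplitude_le (leqnSn p) (lexx m) hA.
have hB' := amplitude_le (leqnSn p) (lexx m) hB.
rewrite /=.
have -> : damp (fun z => c * A z + B z) = (fun z => c * damp A z + damp B z).
  by apply/funext => z; rewrite /damp; ring.
have -> : transport (fun z => c * A z + B z) =
    (fun z => c * transport A z + transport B z).
  case: hA hB => [hA zA _ _] [hB zB _ _].
  by apply/funext => z; apply: transport_lin => //; [exact: Cn_le hA|exact: Cn_le hB].
rewrite (IH _ _ _ _ _ _ ms (h1 _ _ hA') (h1 _ _ hB')).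
rewrite (IH _ _ _ _ _ _ ms (h2 _ _ hA) (h2 _ _ hB)); ring.
Qed.

(** By [damping_field_id], A cos (phi + tau) is the damped term plus
sum_i (A b_i) d_i phi cos (phi + tau), and each summand is
d_i (A b_i cos (phi + tau')) - d_i (A b_i) cos (phi + tau') with
tau' = tau - pi / 2; total derivatives integrate to 0. *)
Lemma integration_by_parts_osc m tau A C : m < - s%:R -> amplitude 1 m A C ->
  Jint (osc_integrand tau (damp A)) - Jint (osc_integrand (tau - pi / 2) (transport
      A)) = Jint (osc_integrand tau A).
Proof.
move=> ms hA; have [r [L [r1 L0 hdom]]] := dominated_osc ms.
have [CK CK0 hK] := compact_box_weight cK.
have [hA1 zA C0 bA] := hA.
set tau' := tau - pi / 2.
pose B i z := A z * phase_field phi i z.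
have hB i : exists D, amplitude 1 (m + (theta_exp i - mu)) (B i) D.
  have [D D0 h] := amplitude_mul m (Cn_phase_field oO sphi 1 i)
      (has_order_phase_field oO mu0 sphi KO bphi ellipticity 1 i).
  by exists (D * C); exact: h.
pose G i z := osc_integrand tau' (B i) z.
pose G1 i z := osc_integrand tau' (fun z => 'D_(e i) (B i) z) z.
pose G2 i z := osc_integrand tau (fun z => B i z * 'D_(e i) phi z) z.
have zB i : zero_off (B i) by move=> z Kz; rewrite /B zA// mul0r.
have dG i z : is_derive z (e i) (G i) (G1 i z + G2 i z).
  have [Kz|Kz] := pselect (K z.1); last first.
    have -> : G1 i z + G2 i z = 0.
      by rewrite /G1 /G2 /osc_integrand (zero_off_derive i (zB i) Kz) zB// !mul0r addr0.
    by apply: zero_off_is_derive => // y Ky; rewrite /G /osc_integrand zB// mul0r.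
  have Oz := KO' Kz; have [D [hD _ _ _]] := hB i.
  have d1 := derivableP (Cn_derivable (i := i) hD Oz).
  have d2 := is_derive_cos_phi tau i Oz.
  have := is_deriveM d1 d2; rewrite -/tau' => d3.
  suff <- : B i z *: (cos (phi z + tau) * 'D_(e i) phi z) +
    cos (phi z + tau') *: 'D_(e i) (B i) z = G1 i z + G2 i z by [].
  rewrite /G1 /G2 /osc_integrand /GRing.scale/=; ring.
have dom1 i : exists D, dominated r (G1 i) D.
  have [D hD] := hB i; exists (L * D); apply: hdom.
  apply: (amplitude_le (leqnn 0) _ (amplitude_derive i hD)).
  have -> : m + (theta_exp i - mu) - theta_exp i = m - mu by ring.
  by rewrite lerBlDr lerDl ltW.
have dom2 i : exists D, dominated r (G2 i) D.
  have [D hD] := hB i.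
  have [D' D'0 h] := @amplitude_mul 0 (m + (theta_exp i - mu)) (mu - theta_exp i)
    (fun z => 'D_(e i) phi z) (Cn_derive i (sphi 1)) (has_order_derive i (bphi 1)).
  exists (L * (D' * D)); apply: hdom.
  have := h _ _ (amplitude_le (leq0n 1) (lexx _) hD).
  by have -> : m + (theta_exp i - mu) + (mu - theta_exp i) = m by ring.
have dom12 i : exists D, dominated r (fun z => G1 i z + G2 i z) D.
  by have [D hD] := dom1 i; have [D' hD'] := dom2 i; exists (D + D'); exact:
      dominated_add.
have J0 i : Jint (fun z => G1 i z + G2 i z) = 0.
  have [D hD] := dom12 i; have [D' [hD' _ D'0 bB]] := hB i.
  have nG z : K z.1 -> `|G i z| <= D' * bracket z `^ (m + (theta_exp i - mu)).
    move=> Kz; rewrite /G /osc_integrand normrM; apply: le_trans (dbound_val (bB z Kz)).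
    by rewrite ler_piMr// cos_max.
  have nG0 z : ~ K z.1 -> G i z = 0 by move=> Kz; rewrite /G /osc_integrand zB// mul0r.
  case: i {dom1 dom2 dom12 hB} (dG i) hD hD' bB nG nG0 => j dGj hD hD' bB nG nG0.
    (* along an x line the amplitude is compactly supported, so any exponent does *)
    apply: (@Jint_derive R n s r (G (inl j)) _ (inl j) D 2 r1 _ hD dGj); first by [].
    move=> z; exists (D' * bracket z `^ (m + (theta_exp (inl j :
        'I_n + 'I_s) - mu)) * CK) => y.
    set z' := z + y *: e (inl j).
    have zj : joint_coord (inl j) z + y = z'.1 ord0 j by rewrite /= !mxE !eqxx mulr1.
    have z2 : z'.2 = z.2 by rewrite /z'/= scaler0 addr0.
    have jz : bracket z' = bracket z by rewrite /bracket z2.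
    have [Kz|Kz] := pselect (K z'.1); last first.
      by rewrite nG0// normr0 !mulr_ge0 ?powR_ge0.
    apply: (le_trans (nG _ Kz)); rewrite jz -[leRHS]mulrA ler_peMr//.
      by rewrite mulr_ge0 ?powR_ge0.
    apply: (le_trans (hK _ Kz)); rewrite ler_wpM2l// zj.
    exact: box_weight_le.
  (* there is a theta direction, so s >= 1 and m + 1 - mu < 1 - s - mu < 0 *)
  have eps0 : 0 < - (m + (theta_exp (inr j : 'I_n + 'I_s) - mu)).
    have s1 : 1 <= s%:R :> R.
      by rewrite ler1n; apply: leq_ltn_trans (ltn_ord j).
    rewrite /theta_exp/= oppr_gt0; move: ms mu0 s1; lra.
  apply: (@Jint_derive R n s r (G (inr j)) _ (inr j) D _ r1 eps0 hD dGj).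
  move=> z; exists D' => y; set z' := z + y *: e (inr j).
  have zj : joint_coord (inr j) z + y = z'.2 ord0 j by rewrite /= !mxE !eqxx mulr1.
  have [Kz|Kz] := pselect (K z'.1); last first.
    by rewrite nG0// normr0 !mulr_ge0 ?powR_ge0.
  apply: (le_trans (nG _ Kz)); rewrite ler_wpM2l// /line_weight opprK zj.
  apply: powR_le_neg; [exact: line_weight_base_gt0| |].
    by rewrite lerD2l enorm_coord.
  by rewrite -oppr_ge0 ltW.
have JS : Jint (fun z => \sum_i (G1 i z + G2 i z)) = 0.
  by rewrite (Jint_sum _ r1 dom12) big1.
have [L1 L10 h1] := amplitude_damp 0 m; have [L2 L20 h2] := amplitude_transport 0 m.
have mmu : m - mu <= m by rewrite lerBlDr lerDl ltW.
have hA0 := amplitude_le (leq0n 1) (lexx m) hA.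
have domA := hdom tau _ _ hA0.
have domD := hdom tau _ _ (amplitude_le (leqnn 0) mmu (h1 _ _ hA0)).
have domT := hdom tau' _ _ (amplitude_le (leqnn 0) mmu (h2 _ _ hA)).
have SE : (fun z => \sum_i (G1 i z + G2 i z)) =
    (fun z => (-1) * osc_integrand tau (damp A) z + (osc_integrand tau A z +
        osc_integrand tau' (transport A) z)).
  apply/funext => z; rewrite big_split/= /G1 /G2 /osc_integrand /transport -/B.
  rewrite -!mulr_suml [X in _ + X * _](_ : _ = A z - damp A z); first by ring.
  under eq_bigr do rewrite /B -mulrA.
  rewrite -mulr_sumr /damp -[X in X - _]mulr1 -mulrBr; congr (_ * _).
  by rewrite -(damping_field_id phi z) addrC addKr.
have := Jint_lin (-1) r1 domD (dominated_add domA domT); rewrite -SE JS.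
have := Jint_lin 1 r1 domA domT; rewrite mul1r.
have -> : (fun z => 1 * osc_integrand tau A z + osc_integrand tau' (transport A) z) =
  (fun z => osc_integrand tau A z + osc_integrand tau' (transport A) z).
  by apply/funext => z; rewrite mul1r.
move=> -> /eqP; rewrite eq_sym mulN1r addrC subr_eq0 => /eqP <-.
by rewrite addrK.
Qed.

(** Once the case p = 0 is known, both sides unfold to the same recursion on
amplitudes of order m - mu. *)
Lemma real_osc_step p m tau A C : m - p%:R * mu < - s%:R -> amplitude p.+1 m A C ->
  real_osc p.+1 tau A = real_osc p tau A.
Proof.
elim: p m tau A C => [|p IH] m tau A C.
  rewrite mul0r subr0 => ms hA; exact: integration_by_parts_osc ms hA.
move=> ms hA; have {}ms : m - mu - p%:R * mu < - s%:R.
  by move: ms; rewrite -natr1 mulrDl mul1r opprD addrA addrAC.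
have [L1 L10 h1] := amplitude_damp p.+1 m; have [L2 L20 h2] := amplitude_transport
    p.+1 m.
have hA' := amplitude_le (leqnSn _) (lexx m) hA.
have E1 := IH _ tau _ _ ms (h1 _ _ hA').
have E2 := IH _ (tau - pi / 2) _ _ ms (h2 _ _ hA).
by rewrite -[LHS]/(real_osc p.+1 tau (damp A) - real_osc p.+1 (tau - pi / 2)
    (transport A))
  E1 E2.
Qed.

End amplitudes.

(** * Topologies generated by seminorm balls *)

Section subbase.
Variables (X : topologicalType) (D : set (set X)).
Hypothesis openD :
  (open : set (set X)) = [set \bigcup_(i in D') id i | D' in subset^~ (finI_from D id)].

Lemma subbase_nbhs (x : X) B : D B -> B x -> nbhs x B.
Proof.
move=> DB Bx; apply: open_nbhs_nbhs; split=> //; rewrite openD.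
exists [set B]; last by rewrite bigcup_set1.
by move=> _ ->; exact: (@finI_from1 _ _ D id B DB).
Qed.

Lemma subbase_cvg (F : set_system X) (x : X) : Filter F ->
  (forall B, D B -> B x -> F B) -> F --> x.
Proof.
move=> FF FB A; rewrite nbhsE => -[B [oB Bx] sBA]; apply: filterS sBA _.
move: oB; rewrite openD => -[D' sD' BE]; move: Bx; rewrite -BE => -[C D'C Cx].
apply: (@filterS _ _ _ C); first by move=> y Cy; exists C.
have [D0 sD0 CE] := sD' _ D'C; rewrite -CE; apply: filter_bigI => E DE.
have /sD0 := DE; rewrite inE => ED; apply: FB => //.
by move: Cx; rewrite -CE => /(_ _ DE).
Qed.

End subbase.

Section instances.
Context {R : realType} {n s : nat} (Omega : set 'rV[R]_n).

Lemma open_symbolsE m : (open : set (set (symbols Omega s m))) =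
  [set \bigcup_(i in D') id i | D' in subset^~
     (finI_from (seminorm_balls (@symbol_fun R n Omega s m) (symbol_norms Omega m))
         id)].
Proof. by []. Qed.

Lemma open_testsE k : (open : set (set (tests Omega k))) =
  [set \bigcup_(i in D') id i | D' in subset^~
     (finI_from (seminorm_balls id (@test_norms R n Omega k)) id)].
Proof. by []. Qed.

Lemma open_distrE k : (open : set (set (distr Omega k))) =
  [set \bigcup_(i in D') id i | D' in subset^~
     (finI_from (seminorm_balls (@distr_fun R n Omega k) (@weak_star_norms R n Omega
         k)) id)].
Proof. by []. Qed.

End instances.

(** * Ordered partial derivatives as words of directions *)

Section words.

Fixpoint words (I : finType) (N : nat) : seq (seq I) :=
  if N is M.+1 then [::] :: [seq i :: w | i <- enum I, w <- words I M] else [:: [::]].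

Lemma mem_words (I : finType) N (ws : seq I) : (size ws <= N)%N -> ws \in words I N.
Proof.
elim: N ws => [|N IH] [|i ws]//= sw; rewrite inE/=.
by apply: allpairs_f; [rewrite mem_enum|exact: IH].
Qed.

Lemma size_words (I : finType) N (ws : seq I) : ws \in words I N -> (size ws <= N)%N.
Proof.
elim: N ws => [|N IH] ws; first by rewrite inE => /eqP ->.
by rewrite inE => /orP[/eqP ->//|/allpairsP[[i w] /= [_ /IH sw ->]]].
Qed.

Definition sorted_word N (alpha : 'I_N -> nat) : seq 'I_N :=
  flatten [seq nseq (alpha i) i | i <- enum 'I_N].

Lemma count_sorted_word N (alpha : 'I_N -> nat) x :
    count_mem x (sorted_word alpha) = alpha x.
Proof.
rewrite /sorted_word count_flatten sumnE !big_map -big_enum big_enum /=.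
rewrite (bigD1 x)//= big1 ?addn0; first by rewrite count_nseq/= eqxx mul1n.
by move=> i ix; rewrite count_nseq/= (negbTE ix) mul0n.
Qed.

Lemma size_sorted_word N (alpha : 'I_N -> nat) : size (sorted_word alpha) = mdegree
    alpha.
Proof.
rewrite /sorted_word size_flatten sumnE big_map big_map /mdegree -big_enum.
by apply: eq_bigr => i _; rewrite size_nseq.
Qed.

Definition mult N (ws : seq 'I_N) (i : 'I_N) : nat := count_mem i ws.

Lemma perm_sorted_word N (ws : seq 'I_N) : perm_eq ws (sorted_word (mult ws)).
Proof. by rewrite /perm_eq; apply/allP => x _ /=; rewrite count_sorted_word. Qed.

Variables (n s : nat).
Notation I := ('I_n + 'I_s)%type.

Definition multx (ws : seq I) (i : 'I_n) : nat := count_mem (inl i) ws.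
Definition multt (ws : seq I) (j : 'I_s) : nat := count_mem (inr j) ws.

Definition joint_word (alpha : 'I_n -> nat) (beta : 'I_s -> nat) : seq I :=
  map inl (sorted_word alpha) ++ map inr (sorted_word beta).

Lemma theta_degree_joint_word alpha beta : theta_degree (joint_word alpha beta) =
    mdegree beta.
Proof.
rewrite /theta_degree /joint_word count_cat !count_map.
rewrite (eq_count (a2 := pred0))// count_pred0 add0n.
by rewrite (eq_count (a2 := predT))// count_predT size_sorted_word.
Qed.

Lemma size_joint_word alpha beta : size (joint_word alpha beta) = (mdegree alpha +
    mdegree beta)%N.
Proof. by rewrite size_cat !size_map !size_sorted_word. Qed.

Lemma perm_joint_word (ws : seq I) : perm_eq ws (joint_word (multx ws) (multt ws)).
Proof.
rewrite /perm_eq; apply/allP => x _ /=; rewrite /joint_word count_cat !count_map.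
case: x => i /=.
  rewrite (eq_count (a2 := pred1 i))//; rewrite count_sorted_word.
  by rewrite (eq_count (a2 := @pred0 'I_s))// count_pred0 addn0.
rewrite (eq_count (a2 := @pred0 'I_n))// count_pred0 add0n.
by rewrite (eq_count (a2 := pred1 i))// count_sorted_word.
Qed.

End words.

Section partials.
Context {R : realType} {V : normedModType R}.
Local Notation re f := (fun x => complex.Re (f x)).
Local Notation im f := (fun x => complex.Im (f x)).

Lemma re_iter (I : eqType) (e : I -> V) k i (f : V -> R[i]) :
  re (iter k (cderive (e i)) f) = derive_word e (nseq k i) (re f).
Proof. by elim: k => //= k ->. Qed.

Lemma im_iter (I : eqType) (e : I -> V) k i (f : V -> R[i]) :
  im (iter k (cderive (e i)) f) = derive_word e (nseq k i) (im f).
Proof. by elim: k => //= k ->. Qed.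

Lemma re_partial N (e : 'I_N -> V) alpha (f : V -> R[i]) :
  re (partial e alpha f) = derive_word e (sorted_word alpha) (re f).
Proof.
rewrite /partial /sorted_word; elim: (enum 'I_N) => //= i l IH.
by rewrite derive_word_cat -IH re_iter.
Qed.

Lemma im_partial N (e : 'I_N -> V) alpha (f : V -> R[i]) :
  im (partial e alpha f) = derive_word e (sorted_word alpha) (im f).
Proof.
rewrite /partial /sorted_word; elim: (enum 'I_N) => //= i l IH.
by rewrite derive_word_cat -IH im_iter.
Qed.

End partials.

Section joint_partials.
Context {R : realType} {n s : nat}.
Notation W := ('rV[R]_n * 'rV[R]_s)%type.
Notation I := ('I_n + 'I_s)%type.
Notation e := (@dirxt R n s).
Local Notation re f := (fun x => complex.Re (f x)).
Local Notation im f := (fun x => complex.Im (f x)).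

Lemma derive_word_dirx ws (f : W -> R) : derive_word (@dirx R n s) ws f = derive_word
    e (map inl ws) f.
Proof. by elim: ws => //= i ws ->. Qed.

Lemma derive_word_dirt ws (f : W -> R) : derive_word (@dirt R n s) ws f = derive_word
    e (map inr ws) f.
Proof. by elim: ws => //= i ws ->. Qed.

Lemma re_jpartial alpha beta (f : W -> R[i]) :
  re (partial (@dirx R n s) alpha (partial (@dirt R n s) beta f)) =
  derive_word e (joint_word alpha beta) (re f).
Proof. by rewrite re_partial re_partial derive_word_dirx derive_word_dirt /joint_word
    derive_word_cat. Qed.

Lemma im_jpartial alpha beta (f : W -> R[i]) :
  im (partial (@dirx R n s) alpha (partial (@dirt R n s) beta f)) =
  derive_word e (joint_word alpha beta) (im f).
Proof. by rewrite im_partial im_partial derive_word_dirx derive_word_dirt /joint_word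
    derive_word_cat. Qed.

Lemma normr_re_le (z : R[i]) : `|complex.Re z| <= cabs z.
Proof.
case: z => a b /=; rewrite -sqrtr_sqr; apply: ler_wsqrtr.
by rewrite lerDl sqr_ge0.
Qed.

Lemma normr_im_le (z : R[i]) : `|complex.Im z| <= cabs z.
Proof.
case: z => a b /=; rewrite -sqrtr_sqr; apply: ler_wsqrtr.
by rewrite lerDr sqr_ge0.
Qed.

Lemma cabs_le (z : R[i]) : cabs z <= `|complex.Re z| + `|complex.Im z|.
Proof.
case: z => a b /=.
rewrite -[leRHS]ger0_norm ?addr_ge0// -sqrtr_sqr; apply: ler_wsqrtr.
by rewrite sqrrD !real_normK ?num_real// lerD2r lerDl mulrn_wge0// mulr_ge0.
Qed.

Lemma cabs_ge0 (z : R[i]) : 0 <= cabs z.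
Proof. by case: z => a b; exact: sqrtr_ge0. Qed.

Variables (Omega K : set 'rV[R]_n).
Hypotheses (oOmega : open Omega) (KO : K `<=` Omega).
Notation O := (Omega `*` [set: 'rV[R]_s]).

Definition csmooth (a : W -> R[i]) :=
  forall k, Cn e k O (re a) /\ Cn e k O (im a).

Definition cdbound N m (a : W -> R[i]) C := forall z, K z.1 ->
  dbound N (re a) z (C * bracket z `^ m) /\ dbound N (im a) z (C * bracket z `^ m).

(** From the seminorms, which see only ordered derivatives, to all words: a word
is a permutation of the ordered word with the same multiplicities. *)
Lemma symbol_norm_cdbound N m a C : csmooth a ->
  (forall ws, (size ws <= N)%N ->
    (symbol_norm m (multx ws) (multt ws) K a <= C%:E)%E) ->
  cdbound N m a C.
Proof.
move=> sa ha z Kz; have Oz : O z by split=> //; exact: KO.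
have oO : open O by exact: open_cylinder.
have key ws : (size ws <= N)%N ->
    cabs (partial (@dirx R n s) (multx ws) (partial (@dirt R n s) (multt ws) a) z) <=
    C * bracket z `^ m * bracket z `^ (- (theta_degree ws)%:R).
  move=> sw; have {}ha := ha ws sw.
  set p := partial _ _ _.
  have : ((cabs (p z) * bracket z `^ ((mdegree (multt ws))%:R - m))%:E <= C%:E)%E.
    by apply: le_trans ha; apply: ereal_sup_ubound; exists z.
  rewrite lee_fin -ler_pdivlMr ?powR_gt0 ?bracket_gt0// -powRN opprB -mulrA -bracketD.
  by rewrite (permP (perm_joint_word ws) is_theta :
      theta_degree _ = theta_degree _) theta_degree_joint_word.
split=> ws sw.
  apply: le_trans (key ws sw); apply: le_trans (normr_re_le _).
  have [sr _] := sa (size ws).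
  by rewrite (derive_word_perm oO (perm_joint_word ws) sr Oz) -re_jpartial.
apply: le_trans (key ws sw); apply: le_trans (normr_im_le _).
have [_ si] := sa (size ws).
by rewrite (derive_word_perm oO (perm_joint_word ws) si Oz) -im_jpartial.
Qed.

Lemma cdbound_symbol_norm m a alpha beta C : 
  cdbound (mdegree alpha + mdegree beta) m a C ->
  (symbol_norm m alpha beta K a <= (C + C)%:E)%E.
Proof.
move=> ha; apply: ge_ereal_sup => _ [z Kz <-]; rewrite lee_fin.
have [hr hi] := ha z Kz.
rewrite -[_ `^ _]/(bracket z `^ _) -ler_pdivlMr ?powR_gt0 ?bracket_gt0// -powRN opprB.
apply: (le_trans (cabs_le _)); rewrite mulrDl.
have := hr (joint_word alpha beta); have := hi (joint_word alpha beta).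
rewrite size_joint_word leqnn theta_degree_joint_word -re_jpartial -im_jpartial
    -mulrA -bracketD => h1 h2.
exact: lerD (h2 isT) (h1 isT).
Qed.

Lemma symbol_csmooth m a : is_symbol Omega m a -> csmooth a.
Proof. by move=> [ca _] k; exact: ca. Qed.

Lemma lty_bound (x : \bar R) : (x < +oo)%E -> exists2 C : R, 0 <= C & (x <= C%:E)%E.
Proof.
case: x => [r _|//|_]; last by exists 0 => //; exact: leNye.
by exists `|r| => //; rewrite lee_fin ler_norm.
Qed.

Lemma symbol_cdbound m a N : compact K -> is_symbol Omega m a ->
  exists2 C, 0 <= C & cdbound N m a C.
Proof.
move=> cK sa; have [_ /(_ K cK KO) ha] := sa.
have h ws := lty_bound (ha (multx ws) (multt ws)).
pose C ws := sval (cid2 (h ws)).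
have C0 ws : 0 <= C ws by rewrite /C; case: cid2.
exists (\sum_(ws <- words I N) C ws); first by rewrite sumr_ge0.
apply: symbol_norm_cdbound; first exact: symbol_csmooth sa.
move=> ws /mem_words wsN; apply: (@le_trans _ _ (C ws)%:E).
  by rewrite /C; case: cid2.
rewrite lee_fin (big_rem ws wsN)/= lerDl sumr_ge0//.
Qed.

End joint_partials.

(** * Test functions *)

Section complex_parts.
Context {R : realType}.
Implicit Types z w : R[i].

Lemma cReD z w : complex.Re (z + w) = complex.Re z + complex.Re w.
Proof. by case: z w => [a b] [c d]. Qed.
Lemma cImD z w : complex.Im (z + w) = complex.Im z + complex.Im w.
Proof. by case: z w => [a b] [c d]. Qed.
Lemma cReM z w :
  complex.Re (z * w) = complex.Re z * complex.Re w - complex.Im z * complex.Im w.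
Proof. by case: z w => [a b] [c d]. Qed.
Lemma cImM z w :
  complex.Im (z * w) = complex.Re z * complex.Im w + complex.Im z * complex.Re w.
Proof. by case: z w => [a b] [c d]. Qed.
Lemma complex_ext z w : complex.Re z = complex.Re w ->
  complex.Im z = complex.Im w -> z = w.
Proof. by case: z w => [a b] [c d] /= -> ->. Qed.
Lemma cabsM z w : cabs (z * w) = cabs z * cabs w.
Proof. exact: Normc.normcM. Qed.
Lemma cabsD z w : cabs (z + w) <= cabs z + cabs w.
Proof.
exact: complex.le_normcD.
Qed.
End complex_parts.

Section lifting.
Context {R : realType} {n s : nat}.
Notation W := ('rV[R]_n * 'rV[R]_s)%type.
Notation I := ('I_n + 'I_s)%type.
Notation e := (@dirxt R n s).
Notation d := (@dirv R n).

(** The derivatives of (x, theta) |-> g x, again as functions of x. *)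
Definition dlift (i : I) (g : 'rV[R]_n -> R) (x : 'rV[R]_n) : R :=
  if i is inl j then 'D_(d j) g x else 0.

Lemma is_derive_lift g i (z : W) : (forall j, derivable g z.1 (d j)) ->
  is_derive z (e i) (fun z : W => g z.1) (dlift i g z.1).
Proof.
case: i => j dg /=; first by have [] := derivableP (dg j).
have [_ H] := @is_derive_line R _ (fun z : W => g z.1) z (e (inr j)) 0 0.
rewrite scale0r addr0 in H; apply: H.
have -> : (fun r : R => g (z + r *: e (inr j)).1) = cst (g z.1).
  by apply/funext => r /=; rewrite scaler0 addr0.
exact: is_derive_cst.
Qed.

Lemma Cn_lift k g (A : set W) : Cn d k setT g -> Cn e k A (fun z => g z.1).
Proof.
elim: k g => [|k IH] g hg.
  split=> // z _; apply: (@continuous_comp _ _ _ fst g); first exact: cvg_fst.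
  exact: (Cn_continuous hg).
have dl i (z : W) := @is_derive_lift g i z (fun j => Cn_derivable hg Logic.I).
split=> [z _|i].
  apply: (@continuous_comp _ _ _ fst g); first exact: cvg_fst.
  exact: (Cn_continuous hg).
split=> [z _|]; first by have [] := dl i z.
rewrite (_ : (fun z => _) = (fun z : W => dlift i g z.1)).
  case: i => j /=; first exact: (IH _ (Cn_derive j hg)).
  exact: Cn_cst.
by apply/funext => z; have [_ ->] := dl i z.
Qed.

Lemma dbound_lift N g (z : W) U : Cn d N setT g ->
  (forall ws, (size ws <= N)%N -> `|derive_word d ws g z.1| <= U) ->
  dbound N (fun z => g z.1) z U.
Proof.
elim: N g U => [|N IH] g U hg hU; first by apply: bd0; exact: (hU [::]).
have dl i (z : W) := @is_derive_lift g i z (fun j => Cn_derivable hg Logic.I).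
apply: dbound_rec => [|i]; first exact: (hU [::]).
rewrite (_ : (fun z => _) = (fun z : W => dlift i g z.1)); last first.
  by apply/funext => y; have [_ ->] := dl i y.
have U0 : 0 <= U := le_trans (normr_ge0 _) (hU [::] isT).
case: i => j.
  rewrite /theta_exp/= oppr0 powRr0 mulr1; apply: (IH (fun x => 'D_(d j) g x)).
    exact: Cn_derive.
  by move=> ws sw; rewrite -derive_word_rcons; apply: hU; rewrite size_rcons.
have := @dbound_cst R n s N 0 z; rewrite normr0; apply: dbound_weak.
by rewrite mulr_ge0// powR_ge0.
Qed.

End lifting.

Section tests_bounds.
Context {R : realType} {n : nat}.
Notation d := (@dirv R n).
Local Notation re f := (fun x => complex.Re (f x)).
Local Notation im f := (fun x => complex.Im (f x)).

(** The bounds are required on K only: an amplitude vanishes elsewhere. *)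
Definition test_bound (p : nat) (K : set 'rV[R]_n) (u : 'rV[R]_n -> R[i]) (U : R) :=
  [/\ Cn d p setT (re u) /\ Cn d p setT (im u), (forall x, ~ K x -> u x = 0),
     0 <= U & forall ws x, (size ws <= p)%N -> K x ->
      `|derive_word d ws (re u) x| <= U /\ `|derive_word d ws (im u) x| <= U].

Lemma compact_derive_word_bound p K g : compact K -> Cn d p setT g ->
  exists2 U, 0 <= U & forall ws x, (size ws <= p)%N -> K x ->
      `|derive_word d ws g x| <= U.
Proof.
move=> cK hg.
have h ws : exists2 U, 0 <= U & ((size ws <= p)%N -> forall x, K x ->
    `|derive_word d ws g x| <= U).
  case: (leqP (size ws) p) => [sw|_]; last by exists 0.
  have cD : continuous (derive_word d ws g).
    move=> x; have := Cn_derive_word (A := setT) (k := 0) (f := g) (ws := ws).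
    rewrite addn0 => /(_ d (Cn_le sw hg)) H.
    exact: (Cn_continuous H).
  have /compact_bounded[M [_ hM]] : compact (derive_word d ws g @` K).
    by apply: continuous_compact => //; exact: continuous_subspaceT.
  exists (`|M| + 1); first by rewrite addr_ge0.
  move=> _ x Kx; apply: hM; last by exists x.
  by rewrite (le_lt_trans (ler_norm M))// ltrDl.
pose U ws := sval (cid2 (h ws)).
have U0 ws : 0 <= U ws by rewrite /U; case: cid2.
exists (\sum_(ws <- words 'I_n p) U ws); first by rewrite sumr_ge0.
move=> ws x sw Kx; apply: (@le_trans _ _ (U ws)).
  by rewrite /U; case: cid2 => /= ? _; apply.
by rewrite (big_rem ws (mem_words sw))/= lerDl sumr_ge0.
Qed.

Lemma supp_off (u : 'rV[R]_n -> R[i]) (K : set 'rV[R]_n) : supp u `<=` K ->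
  forall x, ~ K x -> u x = 0.
Proof.
move=> uK x Kx; apply/eqP; apply: contra_notT Kx => ux; apply: uK.
exact: subset_closure.
Qed.

Lemma is_test_bounded (Omega : set 'rV[R]_n) k p u K : (forall j, (j <= p)%N ->
    le_order j k) ->
  compact K -> is_test Omega k u -> supp u `<=` K -> exists U, test_bound p K u U.
Proof.
move=> pk cK [cu _ _] uK; have [hr hi] := cu p (pk p (leqnn p)).
have [U1 U10 h1] := compact_derive_word_bound cK hr.
have [U2 U20 h2] := compact_derive_word_bound cK hi.
exists (U1 + U2); split=> //; [exact: supp_off|exact: addr_ge0|].
move=> ws x sw Kx; split.
  by apply: (le_trans (h1 ws x sw Kx)); rewrite lerDl.
by apply: (le_trans (h2 ws x sw Kx)); rewrite lerDr.
Qed.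

Lemma sup_norm_ge0 alpha (u : 'rV[R]_n -> R[i]) : (0 <= sup_norm alpha u)%E.
Proof.
apply: (@le_trans _ _ (cabs (partial d alpha u 0))%:E);
    first by rewrite lee_fin cabs_ge0.
by apply: ereal_sup_ubound; exists 0.
Qed.

(** Only derivatives of order at most p occur, which is what makes the
distribution act on test functions of class C^p. *)
Lemma sup_norm_test_bound (Omega : set 'rV[R]_n) k p u K U :
  (forall j, (j <= p)%N -> le_order j k) -> 0 <= U ->
  is_test Omega k u -> supp u `<=` K ->
  (forall ws, (size ws <= p)%N -> (sup_norm (mult ws) u <= U%:E)%E) ->
      test_bound p K u U.
Proof.
move=> pk U0 [cu _ _] uK hU; have [hr hi] := cu p (pk p (leqnn p)).
split=> //; first exact: supp_off.
move=> ws x sw _.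
have {}hU : cabs (partial d (mult ws) u x) <= U.
  rewrite -lee_fin; apply: le_trans (hU ws sw).
  by apply: ereal_sup_ubound; exists x.
split; apply: le_trans hU.
  apply: le_trans (normr_re_le _).
  have E := re_partial d (mult ws) u.
  rewrite (derive_word_perm openT (perm_sorted_word ws) (Cn_le sw hr) (x := x))//.
  by rewrite -E.
apply: le_trans (normr_im_le _).
have E := im_partial d (mult ws) u.
rewrite (derive_word_perm openT (perm_sorted_word ws) (Cn_le sw hi) (x := x))//.
by rewrite -E.
Qed.

End tests_bounds.

(** * The oscillatory form of a symbol and a test function *)

Section oscillatory.
Context {R : realType} {n s : nat}.
Notation W := ('rV[R]_n * 'rV[R]_s)%type.
Notation I := ('I_n + 'I_s)%type.
Notation e := (@dirxt R n s).
Local Notation re f := (fun x => complex.Re (f x)).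
Local Notation im f := (fun x => complex.Im (f x)).
Variables (Omega : set 'rV[R]_n) (mu : R) (phi : W -> R).
Hypotheses (oOmega : open Omega) (hphi : is_phase Omega mu phi).
Notation O := (Omega `*` [set: 'rV[R]_s]).

Let oO : open O. Proof. exact: open_cylinder. Qed.

Let mu0 : 0 < mu. Proof. by case: hphi. Qed.

Let sphi k : Cn e k O phi.
Proof. by case: hphi => _ /symbol_csmooth/(_ k)[]. Qed.

Let bphi K (cK : compact K) (KO : K `<=` Omega) N : has_order K N phi mu.
Proof.
case: hphi => _ sp _; have [C C0 hC] := symbol_cdbound oOmega KO N cK sp.
by exists C => // z /hC[].
Qed.

Let ellipticity K (cK : compact K) (KO : K `<=` Omega) : exists C D : R, [/\ 0 < C,
    0 < D &
        forall x theta, K x -> D <= enorm theta ->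
          C * enorm theta `^ (2 * mu) <=
          gradx_sq phi (x, theta) +
            enorm theta ^+ 2 * gradt_sq phi (x, theta)].
Proof. by case: hphi => _ _; apply. Qed.

(** The integral of A exp (i phi), using sin phi = cos (phi - pi / 2). *)
Definition complex_osc (p : nat) (A : W -> R[i]) : R[i] :=
  ((real_osc phi p 0 (re A) - real_osc phi p (- (pi / 2)) (im A)) +i*
   (real_osc phi p 0 (im A) + real_osc phi p (- (pi / 2)) (re A)))%C.

Definition camplitude K p m (A : W -> R[i]) C :=
  amplitude Omega K p m (re A) C /\ amplitude Omega K p m (im A) C.

Section fixed_compact.
Variable K : set 'rV[R]_n.
Hypotheses (cK : compact K) (KO : K `<=` Omega).

Let E_bound p m := @real_osc_bound R n s Omega oOmega K cK KO mu phi mu0 sphi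
  (bphi cK KO) (ellipticity cK KO) p m.

Lemma complex_osc_bound p m : m - p%:R * mu < - s%:R ->
  exists2 L, 0 <= L & forall A C, camplitude K p m A C ->
      cabs (complex_osc p A) <= L * C.
Proof.
move=> /E_bound[L L0 hL]; exists (L + L + (L + L)); first by rewrite !addr_ge0.
move=> A C [h1 h2]; apply: (le_trans (cabs_le _)) => /=.
rewrite [leRHS]mulrDl [X in _ <= X + X]mulrDl; apply: lerD.
  by apply: (le_trans (ler_normB _ _)); apply: lerD; exact: hL.
by apply: (le_trans (ler_normD _ _)); apply: lerD; exact: hL.
Qed.

Lemma complex_osc_step p m A C : m - p%:R * mu < - s%:R -> camplitude K p.+1 m A C ->
  complex_osc p.+1 A = complex_osc p A.
Proof.
move=> ms [h1 h2]; rewrite /complex_osc.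
have step tau B := @real_osc_step R n s Omega oOmega K cK KO mu phi mu0 sphi
  (bphi cK KO) (ellipticity cK KO) p m tau B C ms.
by rewrite !(step _ _ h1) !(step _ _ h2).
Qed.

(** Complex linearity splits into real combinations of the real and imaginary
parts, two at a time. *)
Lemma complex_osc_lin p m c A B C D : m - p%:R * mu < - s%:R ->
  camplitude K p m A C -> camplitude K p m B D ->
  complex_osc p (fun z => c * A z + B z) = c * complex_osc p A + complex_osc p B.
Proof.
move=> ms [hA1 hA2] [hB1 hB2].
have lin tau r F G C1 C2 := @real_osc_lin R n s Omega oOmega K cK KO mu phi mu0 sphi
  (bphi cK KO) (ellipticity cK KO) p m tau r F G C1 C2 ms.
case: c => a b.
have E1 : re (fun z => (a +i* b)%C * A z + B z) =
    fun z => a * complex.Re (A z) + ((- b) * complex.Im (A z) + complex.Re (B z)).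
  by apply/funext => z; rewrite cReD cReM/=; ring.
have E2 : im (fun z => (a +i* b)%C * A z + B z) =
    fun z => a * complex.Im (A z) + (b * complex.Re (A z) + complex.Im (B z)).
  by apply/funext => z; rewrite cImD cImM/=; ring.
have h1 := amplitude_lin oOmega KO (- b) hA2 hB1.
have h2 := amplitude_lin oOmega KO b hA1 hB2.
have L1 tau := lin tau a _ _ _ _ hA1 h1.
have L2 tau := lin tau a _ _ _ _ hA2 h2.
have L3 tau := lin tau (- b) _ _ _ _ hA2 hB1.
have L4 tau := lin tau b _ _ _ _ hA1 hB2.
by rewrite /complex_osc; apply: complex_ext; rewrite ?cReD ?cImD ?cReM ?cImM/= E1 E2
    !L1 !L2 !L3 !L4; ring.
Qed.

Lemma amplitude_prod p m f g C U : Cn e p O f -> Cn e p O g -> zero_off K g ->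
    0 <= C -> 0 <= U ->
  (forall z, K z.1 -> dbound p f z (C * bracket z `^ m)) ->
  (forall z, K z.1 -> dbound p g z U) ->
  amplitude Omega K p m (fun z => f z * g z) (2 ^+ p * C * U).
Proof.
move=> hf hg zg C0 U0 bf bg; split.
- exact: Cn_mul.
- by move=> z Kz; rewrite zg// mulr0.
- by rewrite !mulr_ge0// exprn_ge0.
- move=> z Kz.
  have Oz : O z by split=> //; exact: KO.
  have := dbound_mul oO Oz hf hg (bf z Kz) (bg z Kz).
  by apply: dbound_weak; rewrite le_eqVlt; apply/orP; left; apply/eqP; ring.
Qed.

Lemma camplitude_prod p m a u C U : csmooth Omega a -> 0 <= C -> cdbound K p m a C ->
  test_bound p K u U ->
  camplitude K p m (fun z => a z * u z.1) ((2 ^+ p + 1) * 2 ^+ p * C * U).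
Proof.
move=> sa C0 ba [[hr hi] zu U0 bu]; have [sr si] := sa p.
have zr : zero_off K (fun z : W => complex.Re (u z.1)) by move=> z /zu ->.
have zi : zero_off K (fun z : W => complex.Im (u z.1)) by move=> z /zu ->.
have br (z : W) : K z.1 -> dbound p (fun z : W => complex.Re (u z.1)) z U.
  by move=> Kz; apply: (@dbound_lift R n s p (re u)) => // ws sw;
      have [] := bu ws _ sw Kz.
have bi (z : W) : K z.1 -> dbound p (fun z : W => complex.Im (u z.1)) z U.
  by move=> Kz; apply: (@dbound_lift R n s p (im u)) => // ws sw;
      have [] := bu ws _ sw Kz.
have lr := @Cn_lift R n s p (re u) O hr.
have li := @Cn_lift R n s p (im u) O hi.
have b1 z (Kz : K z.1) := (ba z Kz).1.
have b2 z (Kz : K z.1) := (ba z Kz).2.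
have rr := amplitude_prod sr lr zr C0 U0 b1 br.
have ri := amplitude_prod sr li zi C0 U0 b1 bi.
have ir := amplitude_prod si lr zr C0 U0 b2 br.
have ii := amplitude_prod si li zi C0 U0 b2 bi.
have cE : (2 ^+ p + 1) * 2 ^+ p * C * U = 1 * 2 ^+ p * (2 ^+ p * C * U) + 2 ^+ p * C
    * U.
  by ring.
split.
  have := amplitude_lin oOmega KO (-1) ii rr; rewrite normrN1 -cE.
  by congr (amplitude _ _ _ _ _ _); apply/funext => z; rewrite cReM; ring.
have := amplitude_lin oOmega KO 1 ri ir; rewrite normr1 -cE.
by congr (amplitude _ _ _ _ _ _); apply/funext => z; rewrite cImM; ring.
Qed.

End fixed_compact.

Definition osc_form p (a : W -> R[i]) (u : 'rV[R]_n -> R[i]) : R[i] :=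
  complex_osc p (fun z => a z * u z.1).

(** The estimate behind all continuity statements: linear both in the symbol
bounds of a on K and in the bounds of the derivatives of u. *)
Lemma osc_form_bound p m K : compact K -> K `<=` Omega -> m - p%:R * mu < - s%:R ->
  exists2 L, 0 <= L & forall a u C U, csmooth Omega a -> 0 <= C -> cdbound K p m a C ->
    test_bound p K u U -> cabs (osc_form p a u) <= L * C * U.
Proof.
move=> cK KO ms; have [L L0 hL] := complex_osc_bound cK KO ms.
exists (L * ((2 ^+ p + 1) * 2 ^+ p)).
  by rewrite !mulr_ge0 ?addr_ge0 ?exprn_ge0.
move=> a u C U sa C0 ba hu; apply: (le_trans (hL _ _ (camplitude_prod KO sa C0 ba hu))).
by rewrite !mulrA.
Qed.

End oscillatory.

(** * Distributions defined by symbols *)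

Lemma norm_lt_cabs (R : realType) (z e : R[i]) : 0 < e -> cabs z < complex.Re e ->
  `|z| < e.
Proof.
rewrite ltcE /= => /andP[/eqP ie re0] ze; rewrite normc_def ltcE/= ie eqxx/=.
by case: z ze.
Qed.

Section distributions.
Context {R : realType} {n s : nat}.
Notation W := ('rV[R]_n * 'rV[R]_s)%type.
Notation I := ('I_n + 'I_s)%type.
Notation e := (@dirxt R n s).
Local Notation re f := (fun x => complex.Re (f x)).
Local Notation im f := (fun x => complex.Im (f x)).
Variables (Omega : set 'rV[R]_n) (mu : R) (phi : W -> R).
Hypotheses (oOmega : open Omega) (hphi : is_phase Omega mu phi).
Notation O := (Omega `*` [set: 'rV[R]_s]).

Implicit Types (a b : W -> R[i]) (u v : 'rV[R]_n -> R[i]).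

Let mu0 : 0 < mu. Proof. by case: hphi. Qed.

Section fixed_compact.
Variable K : set 'rV[R]_n.
Hypotheses (cK : compact K) (KO : K `<=` Omega).

Lemma symbol_camplitude p m a u U : is_symbol Omega m a -> test_bound p K u U ->
  exists C, camplitude Omega K p m (fun z => a z * u z.1) C.
Proof.
move=> sa hu; have [C C0 ba] := symbol_cdbound oOmega KO p cK sa.
by exists ((2 ^+ p + 1) * 2 ^+ p * C * U);
  exact: (camplitude_prod oOmega KO (symbol_csmooth sa) C0 ba hu).
Qed.

Lemma osc_form_lin_test p m a u v U V c : m - p%:R * mu < - s%:R ->
  is_symbol Omega m a -> test_bound p K u U -> test_bound p K v V ->
  osc_form phi p a (fun x => c * u x + v x) = c * osc_form phi p a u + osc_form phi p
      a v.
Proof.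
move=> ms sa hu hv; have [C hC] := symbol_camplitude sa hu;
    have [D hD] := symbol_camplitude sa hv.
rewrite /osc_form -(complex_osc_lin oOmega hphi cK KO c ms hC hD); congr complex_osc.
by apply/funext => z; ring.
Qed.

Lemma osc_form_lin_symbol p m a b u U c : m - p%:R * mu < - s%:R ->
  is_symbol Omega m a -> is_symbol Omega m b -> test_bound p K u U ->
  osc_form phi p (fun z => c * a z + b z) u = c * osc_form phi p a u + osc_form phi p
      b u.
Proof.
move=> ms sa sb hu; have [C hC] := symbol_camplitude sa hu;
    have [D hD] := symbol_camplitude sb hu.
rewrite /osc_form -(complex_osc_lin oOmega hphi cK KO c ms hC hD); congr complex_osc.
by apply/funext => z; ring.
Qed.

Lemma osc_form_step p m a u U : m - p%:R * mu < - s%:R ->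
  is_symbol Omega m a -> test_bound p.+1 K u U -> osc_form phi p.+1 a u = osc_form
      phi p a u.
Proof.
move=> ms sa hu; have [C hC] := symbol_camplitude sa hu.
exact: (complex_osc_step oOmega hphi cK KO ms hC).
Qed.

End fixed_compact.

Lemma order_succ p m k : m - p%:R * mu < - s%:R -> m - (p + k)%:R * mu < - s%:R.
Proof.
apply: le_lt_trans; rewrite lerD2l lerN2 ler_wpM2r ?(ltW mu0)// ler_nat leq_addr//.
Qed.

Lemma osc_form_add p k m a (u : tests Omega None) : m - p%:R * mu < - s%:R ->
  is_symbol Omega m a -> osc_form phi (p + k) a u = osc_form phi p a u.
Proof.
move=> ms sa; have /asboolP[cu ku su] := test_funP u.
elim: k => [|k IH]; first by rewrite addn0.
have [U hU] := is_test_bounded (p := (p + k).+1) (k := None) (fun _ _ => Logic.I) ku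
  (And3 cu ku su) (@subset_refl _ (supp u)).
rewrite addnS -IH; apply: (osc_form_step ku su _ sa hU).
exact: order_succ.
Qed.

(** Both sides equal the value obtained with p + p' integrations by parts. *)
Lemma osc_form_indep p m p' m' a (u : tests Omega None) :
  m - p%:R * mu < - s%:R -> m' - p'%:R * mu < - s%:R ->
  is_symbol Omega m a -> is_symbol Omega m' a -> osc_form phi p a u = osc_form phi p'
      a u.
Proof.
move=> ms ms' sa sa'.
by rewrite -(osc_form_add p' u ms sa) addnC (osc_form_add p u ms' sa').
Qed.

Section distr_of_symbol.
Variables (k : option nat) (p : nat) (m : R).
Hypotheses (pk : forall j, (j <= p)%N -> le_order j k) (ms : m - p%:R * mu < - s%:R).

Lemma tests_linP c (u v : tests Omega k) :
  (c *: u + v : tests Omega k) = (fun x => c * u x + v x) :> ('rV[R]_n -> R[i]).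
Proof. by []. Qed.

Lemma tests_test_bound (u : tests Omega k) K : compact K -> supp u `<=` K ->
  exists U, test_bound p K u U.
Proof.
by move=> cK uK; have /asboolP hu := test_funP u; exact: is_test_bounded hu uK.
Qed.

Lemma osc_form_scalar a : is_symbol Omega m a ->
  scalar (fun u : tests Omega k => osc_form phi p a u).
Proof.
move=> sa c u v; have /asboolP[cu ku su] := test_funP u.
have /asboolP[cv kv sv] := test_funP v.
have kK := compactU ku kv.
have KO : supp u `|` supp v `<=` Omega by rewrite subUset.
have [U hU] := tests_test_bound kK (@subsetUl _ (supp u) (supp v)).
have [V hV] := tests_test_bound kK (@subsetUr _ (supp u) (supp v)).
by rewrite tests_linP (osc_form_lin_test kK KO c ms sa hU hV).
Qed.

Lemma sup_norm_sum_bound (u : 'rV[R]_n -> R[i]) (A : seq ('I_n -> nat)) alpha :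
  alpha \in A -> (sup_norm alpha u <= \sum_(al <- A) sup_norm al u)%E.
Proof.
move=> alA; rewrite (big_rem alpha alA)/= leeDl// sume_ge0// => al _.
exact: sup_norm_ge0.
Qed.

(** The topology of test functions is generated by all seminorms that are
continuous on each C_K^k; the modulus of the form is one of them. *)
Lemma osc_form_test_norm a : is_symbol Omega m a ->
  @test_norms R n Omega k (fun u : tests Omega k => (cabs (osc_form phi p a u))%:E).
Proof.
move=> sa; have sc := osc_form_scalar sa.
exists (fun u : tests Omega k => cabs (osc_form phi p a u)); split=> //.
  split=> [u v|c u].
    have := sc 1 u v; rewrite scale1r => ->; rewrite mul1r; exact: cabsD.
  have T0 : osc_form phi p a (0 : tests Omega k) = 0.
    have := sc (-1) 0 0; rewrite scaler0 addr0 => E.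
    have : osc_form phi p a (0 : tests Omega k) + 0 =
      osc_form phi p a (0 : tests Omega k) + osc_form phi p a (0 : tests Omega k) * -1.
      by rewrite [LHS]addr0 {1}E addrC [X in _ = _ + X]mulrC.
    by rewrite addr0 mulrN1 subrr.
  by have := sc c u 0; rewrite addr0 T0 addr0 => ->; rewrite cabsM.
move=> K cK KO.
have [L L0 hL] := osc_form_bound oOmega hphi cK KO ms.
have [C C0 ba] := symbol_cdbound oOmega KO p cK sa.
exists [seq mult ws | ws <- words 'I_n p], (L * C + 1); split.
- by rewrite addr_ge0// mulr_ge0.
- move=> alpha /mapP[ws /size_words sw ->]; apply: pk.
  by rewrite -size_sorted_word -(perm_size (perm_sorted_word ws)).
move=> u uK; set S := (\sum_(_ <- _) _)%E.
have S0 : (0 <= S)%E by apply: sume_ge0 => al _; exact: sup_norm_ge0.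
have LC : 0 < L * C + 1 by rewrite ltr_pwDr// mulr_ge0.
have hS ws : (size ws <= p)%N -> (sup_norm (mult ws) u <= S)%E.
  by move=> sw; apply: sup_norm_sum_bound; apply: map_f; exact: mem_words.
move: S0 hS; case: S => [S|_ _|//]; last by rewrite gt0_muley ?leey// lte_fin.
(* the sum of the seminorms of u is now a real number S, a common bound *)
rewrite lee_fin => S0 hS; rewrite -EFinM lee_fin.
have /asboolP hu := test_funP u.
have ht := sup_norm_test_bound pk S0 hu uK hS.
apply: (le_trans (hL a u C S (symbol_csmooth sa) C0 ba ht)).
by rewrite ler_wpM2r// lerDl.
Qed.

Lemma osc_form_distr a : is_symbol Omega m a ->
  (fun u : tests Omega k => osc_form phi p a u) \in @distr_pred R n Omega k.
Proof.
move=> sa; apply/asboolP; split; first exact: osc_form_scalar.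
move=> u0 A /nbhs_ballP[eps /= eps0 hA].
have re0 : 0 < complex.Re eps by move: eps0; rewrite ltcE /= => /andP[].
pose B := [set v : tests Omega k | ((cabs (osc_form phi p a (v - u0)))%:E <
    (complex.Re eps)%:E)%E].
have DB : seminorm_balls id (@test_norms R n Omega k) B.
  exists (fun u : tests Omega k => (cabs (osc_form phi p a u))%:E), u0,
      (complex.Re eps); split=> //.
  exact: osc_form_test_norm.
have sc := osc_form_scalar sa.
have subE (v : tests Omega k) : osc_form phi p a (v - u0) = osc_form phi p a v -
    osc_form phi p a u0.
  have := sc (-1) u0 v.
  have -> : -1 *: u0 + v = v - u0 :> tests Omega k by rewrite scaleN1r addrC.
  by move=> ->; rewrite addrC mulN1r.
have BE (v : tests Omega k) : B v = (cabs (osc_form phi p a v - osc_form phi p a u0)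
    < complex.Re eps) :> Prop.
  by rewrite -subE -lte_fin.
have Bu0 : B u0 by rewrite BE subrr Normc.normc0.
have nB := subbase_nbhs (@open_testsE R n Omega k) DB Bu0.
apply: filterS nB => v; rewrite BE => hv.
apply: hA; rewrite -ball_normE/= distrC; exact: norm_lt_cabs.
Qed.

Definition osc_distr a (sa : is_symbol Omega m a) :
    distr Omega k := Distr (osc_form_distr sa).

End distr_of_symbol.
End distributions.

(** * Continuity in the symbol *)

Lemma filter_all_seq (X : Type) (T : eqType) (F : set_system X) (l : seq T)
  (P : T -> set X) : Filter F -> (forall t, t \in l -> F (P t)) ->
  F [set x | forall t, t \in l -> P t x].
Proof.
move=> FF; elim: l => [|t l IH] hl.
  by apply: filterS filterT => x _ t; rewrite in_nil.
have H1 : F (P t) by apply: hl; rewrite mem_head.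
have H2 : F [set x | forall t, t \in l -> P t x].
  by apply: IH => t' tl; apply: hl; rewrite inE tl orbT.
apply: filterS2 H1 H2 => x Ptx Plx t'.
by rewrite inE => /orP[/eqP ->//|]; exact: Plx.
Qed.

Section symbol_space.
Context {R : realType} {n s : nat}.
Notation W := ('rV[R]_n * 'rV[R]_s)%type.
Notation I := ('I_n + 'I_s)%type.
Notation e := (@dirxt R n s).
Local Notation re f := (fun x => complex.Re (f x)).
Local Notation im f := (fun x => complex.Im (f x)).
Variables (Omega : set 'rV[R]_n).
Hypotheses (oOmega : open Omega).
Notation O := (Omega `*` [set: 'rV[R]_s]).
Implicit Types (a b : W -> R[i]).

Let oO : open O. Proof. exact: open_cylinder. Qed.

Lemma csmooth_add a b : csmooth Omega a -> csmooth Omega b ->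
  csmooth Omega (fun z => a z + b z).
Proof.
move=> sa sb k; have [ar ai] := sa k; have [br bi] := sb k; split.
  by apply: (Cn_ext oO _ (Cn_add oO ar br)) => z _; rewrite cReD.
by apply: (Cn_ext oO _ (Cn_add oO ai bi)) => z _; rewrite cImD.
Qed.

Lemma csmooth_opp a : csmooth Omega a -> csmooth Omega (fun z => - a z).
Proof.
move=> sa k; have [ar ai] := sa k; split.
  by apply: (Cn_ext oO _ (Cn_opp oO ar)) => z _; case: (a z).
by apply: (Cn_ext oO _ (Cn_opp oO ai)) => z _; case: (a z).
Qed.

Lemma csmooth_sub a b : csmooth Omega a -> csmooth Omega b ->
  csmooth Omega (fun z => a z - b z).
Proof. by move=> sa sb; apply: csmooth_add => //; exact: csmooth_opp. Qed.

Lemma cdbound_is_symbol m a : csmooth Omega a ->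
  (forall K N, compact K -> K `<=` Omega -> exists C, cdbound K N m a C) ->
  is_symbol Omega m a.
Proof.
move=> sa ha; split; first by move=> k _; exact: sa.
move=> K cK KO alpha beta.
have [C hC] := ha K (mdegree alpha + mdegree beta)%N cK KO.
by apply: le_lt_trans (cdbound_symbol_norm hC) _; exact: ltry.
Qed.

Lemma cdbound_mono K N m m' a C : 0 <= C -> m <= m' -> cdbound K N m a C ->
    cdbound K N m' a C.
Proof.
move=> C0 mm ha z Kz; have [h1 h2] := ha z Kz.
by split; [apply: dbound_weak h1|apply: dbound_weak h2]; rewrite ler_wpM2l// bracket_le.
Qed.

Lemma is_symbol_mono m m' a : m <= m' -> is_symbol Omega m a -> is_symbol Omega m' a.
Proof.
move=> mm sa; apply: cdbound_is_symbol; first exact: symbol_csmooth sa.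
move=> K N cK KO; have [C C0 hC] := symbol_cdbound oOmega KO N cK sa.
by exists C; exact: cdbound_mono hC.
Qed.

Lemma csmooth_mulr a (f : W -> R) : csmooth Omega a -> (forall k, Cn e k O f) ->
  csmooth Omega (fun z => a z * (f z)%:C%C).
Proof.
move=> sa sf k; have [ar ai] := sa k; split.
  apply: (Cn_ext oO _ (Cn_mul oO ar (sf k))) => z _.
  by rewrite cReM/= mulr0 subr0.
apply: (Cn_ext oO _ (Cn_mul oO ai (sf k))) => z _.
by rewrite cImM/= mulr0 add0r.
Qed.

Lemma cdbound_mulr K N m m' a (f : W -> R) C D : K `<=` Omega ->
  csmooth Omega a -> Cn e N O f -> cdbound K N m a C ->
  (forall z, K z.1 -> dbound N f z (D * bracket z `^ m')) ->
  cdbound K N (m + m') (fun z => a z * (f z)%:C%C) (2 ^+ N * C * D).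
Proof.
move=> KO sa sf ha hf z Kz; have [h1 h2] := ha z Kz; have [sr si] := sa N.
have Oz : O z by split=> //; exact: KO.
have cE : 2 ^+ N * (C * bracket z `^ m) * (D * bracket z `^ m') =
   2 ^+ N * C * D * bracket z `^ (m + m').
  by rewrite bracketD; ring.
split.
  rewrite -cE; apply: (dbound_ext oO _ Oz (dbound_mul oO Oz sr sf h1 (hf z Kz))) => y _.
  by rewrite cReM/= mulr0 subr0.
rewrite -cE; apply: (dbound_ext oO _ Oz (dbound_mul oO Oz si sf h2 (hf z Kz))) => y _.
by rewrite cImM/= mulr0 add0r.
Qed.

(** Additivity of the partial derivatives holds on the open set only, where the
symbols are differentiable. *)
Lemma cabs_partial_add a b alpha beta (z : W) : O z ->
  csmooth Omega a -> csmooth Omega b ->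
  cabs (partial (@dirx R n s) alpha (partial (@dirt R n s) beta (fun z => a z + b z)) z)
  <= cabs (partial (@dirx R n s) alpha (partial (@dirt R n s) beta a) z) +
     cabs (partial (@dirx R n s) alpha (partial (@dirt R n s) beta b) z).
Proof.
move=> Oz sa sb; apply: (le_trans _ (cabsD _ _)).
rewrite (_ : partial _ _ _ z = partial (@dirx R n s) alpha (partial (@dirt R n s)
    beta a) z +
   partial (@dirx R n s) alpha (partial (@dirt R n s) beta b) z)//.
have [ar ai] := sa (size (joint_word alpha beta));
    have [br bi] := sb (size (joint_word alpha beta)).
have rE f := congr1 (fun g : W -> R => g z) (re_jpartial alpha beta f).
have iE f := congr1 (fun g : W -> R => g z) (im_jpartial alpha beta f).
rewrite /= in rE iE.
apply: complex_ext.
  rewrite cReD !rE -(derive_word_add oO ar br Oz).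
  by apply: (derive_word_ext _ _ oO _ Oz) => y _; rewrite cReD.
rewrite cImD !iE -(derive_word_add oO ai bi Oz).
by apply: (derive_word_ext _ _ oO _ Oz) => y _; rewrite cImD.
Qed.

Lemma symbol_norm_add m alpha beta K a b : K `<=` Omega ->
  csmooth Omega a -> csmooth Omega b ->
  (symbol_norm m alpha beta K (fun z => (a z + b z)%R) <=
   symbol_norm m alpha beta K a + symbol_norm m alpha beta K b)%E.
Proof.
move=> KO sa sb; apply: ge_ereal_sup => _ [z Kz <-].
have Oz : O z by split=> //; exact: KO.
apply: (@le_trans _ _ ((cabs (partial (@dirx R n s) alpha (partial (@dirt R n s) beta
    a) z) *
  (1 + enorm z.2) `^ ((mdegree beta)%:R - m))%:E +
  (cabs (partial (@dirx R n s) alpha (partial (@dirt R n s) beta b) z) *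
  (1 + enorm z.2) `^ ((mdegree beta)%:R - m))%:E)%E).
  by rewrite -EFinD lee_fin -mulrDl ler_wpM2r ?powR_ge0//; exact: cabs_partial_add.
by apply: leeD; apply: ereal_sup_ubound; exists z.
Qed.

Lemma symbol_norm_subrr m alpha beta K a :
  (symbol_norm m alpha beta K (fun z => (a z - a z)%R) <= 0)%E.
Proof.
have -> : (fun z => a z - a z) = (fun=> 0) by apply/funext => z; rewrite subrr.
have h : cdbound K (mdegree alpha + mdegree beta) m ((fun=> 0) : W -> R[i]) 0.
  move=> z _; rewrite mul0r.
  by split; have := @dbound_cst R n s (mdegree alpha + mdegree beta) 0 z;
      rewrite normr0.
by have := cdbound_symbol_norm h; rewrite addr0.
Qed.

Variable m : R.
Notation S := (symbols Omega s m).

Lemma symbolsP (a : S) : is_symbol Omega m a.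
Proof. by have /asboolP[] := symbol_funP a. Qed.

Lemma symbols_nbhs (a0 : S) K N (delta : R) : compact K -> K `<=` Omega -> 0 < delta ->
  nbhs a0 [set b : S | forall ws, ws \in words I N ->
    (symbol_norm m (multx ws) (multt ws) K (fun z => (b z - a0 z)%R) < delta%:E)%E].
Proof.
move=> cK KO d0; apply: filter_all_seq => ws _.
apply: (subbase_nbhs (@open_symbolsE R n s Omega m)).
  exists (symbol_norm m (multx ws) (multt ws) K), a0, delta; split=> //.
  by exists (multx ws), (multt ws), K.
by apply: (le_lt_trans (symbol_norm_subrr _ _ _ _ _)); rewrite lte_fin.
Qed.

Variables (mu : R) (phi : W -> R).
Hypothesis hphi : is_phase Omega mu phi.

(** The estimate [osc_form_bound] applied to the difference of two symbols, whose
finitely many relevant seminorms are small in a neighbourhood. *)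
Lemma continuous_osc_form k p (f : S -> distr Omega k) :
  (forall j, (j <= p)%N -> le_order j k) -> m - p%:R * mu < - s%:R ->
  (forall (a : S) u, f a u = osc_form phi p a u) -> continuous f.
Proof.
move=> pk ms hf a0.
have FF : Filter (f @ nbhs a0) by apply: fmap_filter; exact: nbhs_filter.
apply: (subbase_cvg (@open_distrE R n Omega k) FF).
move=> _ [_ [c [eps [[u ->] eps0 ->]]]] /=; rewrite lte_fin => ha0.
have /asboolP[cu ku su] := test_funP u.
have [U hU] := tests_test_bound (p := p) pk ku (@subset_refl _ (supp u)).
have U0 : 0 <= U by have [] := hU.
have [L L0 hL] := osc_form_bound oOmega hphi ku su ms.
set d := cabs _ in ha0.
(* chosen so that L * delta * U < eps - d *)
pose delta := (eps - d) / (L * U + 1).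
have LU : 0 < L * U + 1 by rewrite ltr_pwDr// mulr_ge0.
have d0 : 0 < delta by rewrite divr_gt0// subr_gt0.
have := symbols_nbhs a0 p ku su d0; apply: filterS => b hb /=; rewrite lte_fin.
have sa := symbolsP a0; have sb := symbolsP b.
have hba : cabs (f b u - f a0 u) < eps - d.
  have -> : f b u - f a0 u = osc_form phi p (fun z => b z - a0 z) u.
    have := osc_form_lin_symbol oOmega hphi ku su (-1) ms sa sb hU.
    rewrite !hf mulN1r addrC => <-; congr (osc_form phi p _ u).
    by apply/funext => z; rewrite mulN1r addrC.
  have sba := csmooth_sub (symbol_csmooth sb) (symbol_csmooth sa).
  have bba : cdbound (supp u) p m (fun z => b z - a0 z) delta.
    by apply: (symbol_norm_cdbound oOmega su sba) => ws /mem_words/hb/ltW.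
  apply: (le_lt_trans (hL _ u _ U sba (ltW d0) bba hU)).
  rewrite /delta mulrAC mulrA ltr_pdivrMr// mulrC.
  by rewrite ltr_pM2l ?subr_gt0// ltrDl.
apply: (@le_lt_trans _ _ (cabs (f b u - f a0 u) + d)); last by rewrite -ltrBrDr.
apply: le_trans (cabsD _ _).
by rewrite [X in cabs X <= _](_ : _ = f b u - f a0 u + (f a0 u - c u))// addrA subrK.
Qed.

End symbol_space.

(** * Agreement with the convergent integral *)

Section coincidence.
Context {R : realType} {n s : nat}.
Notation W := ('rV[R]_n * 'rV[R]_s)%type.
Notation I := ('I_n + 'I_s)%type.
Notation e := (@dirxt R n s).
Notation rv := (@rv_of_tuple R _).
Local Notation re f := (fun x => complex.Re (f x)).
Local Notation im f := (fun x => complex.Im (f x)).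

Lemma dominated_lin r c (F G : W -> R) C D : dominated r F C -> dominated r G D ->
  dominated r (fun z => c * F z + G z) (`|c| * C + D).
Proof.
move=> [cF C0 hF] dG; apply: dominated_add dG; split.
- by move=> z; apply: continuousM; [exact: cst_continuous|exact: cF].
- by rewrite mulr_ge0.
- by move=> z; rewrite normrM -mulrA ler_wpM2l.
Qed.

Lemma Jint_fubini r (F : W -> R) C : 1 < r -> dominated r F C ->
  Jint F = \int[lebesgueN R n]_t (\int[lebesgueN R s]_q F (rv t, rv q)).
Proof.
move=> r1 dF; have intF := integrable_dominated r1 dF.
rewrite /Jint /Rintegral -(integral12_prod_meas1 intF) /fubini_F; congr fine.
apply: eq_integral => t _; rewrite fineK//.
exact: (integrable_fin_num measurableT (integrable_dominated2 (rv t) r1 dF)).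
Qed.

Lemma cintegralZr N (f : 'rV[R]_N -> R[i]) c :
  (lebesgueN R N).-integrable setT (fun t => (complex.Re (f (rv t)))%:E) ->
  (lebesgueN R N).-integrable setT (fun t => (complex.Im (f (rv t)))%:E) ->
  cintegral setT (fun x => f x * c) = cintegral setT f * c.
Proof.
move=> ir ii; rewrite /cintegral preimage_setT; case: c => p q.
have iZ (g : N.-tuple (measurableTypeR R) -> R) (w : R) :
    (lebesgueN R N).-integrable setT (fun t => (g t)%:E) ->
    (lebesgueN R N).-integrable setT (fun t => (g t * w)%:E).
  move=> ig; have := integrableZr measurableT w ig.
  by apply: eq_integrable => // t _ /=; rewrite EFinM.
apply: complex_ext; rewrite ?cReM ?cImM/=.
  under eq_Rintegral do rewrite cReM/=.
  rewrite RintegralB//; [|exact: iZ|exact: iZ].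
  by rewrite !RintegralZr.
under eq_Rintegral do rewrite cImM/=.
rewrite RintegralD//; [|exact: iZ|exact: iZ].
by rewrite !RintegralZr.
Qed.

Variables (Omega : set 'rV[R]_n) (mu : R) (phi : W -> R).
Hypotheses (oOmega : open Omega) (hphi : is_phase Omega mu phi).

(** The symbol alone is not known to be integrable in theta for x outside Omega;
where u x is not 0 integrability follows by dividing the integrand by u x, and
elsewhere both sides vanish. *)
Lemma osc_fun_mul (a : W -> R[i]) (u : 'rV[R]_n -> R[i]) r C x : 1 < r ->
  dominated r (fun z => complex.Re (a z * u z.1 * cexpi (phi z))) C ->
  dominated r (fun z => complex.Im (a z * u z.1 * cexpi (phi z))) C ->
  osc_fun phi a x * u x =
  cintegral setT (fun th => a (x, th) * u x * cexpi (phi (x, th))).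
Proof.
move=> r1 d1 d2; have [u0|u0] := eqVneq (u x) 0.
  rewrite u0 mulr0 /cintegral; apply/esym; apply: complex_ext => /=.
    rewrite /Rintegral integral0_eq// => t _.
    by rewrite mulr0 mul0r.
  rewrite /Rintegral integral0_eq// => t _.
  by rewrite mulr0 mul0r.
rewrite /osc_fun.
have -> : (fun th => a (x, th) * cexpi (phi (x, th))) =
    (fun th => a (x, th) * u x * cexpi (phi (x, th)) * (u x)^-1).
  by apply/funext => th; rewrite mulrAC mulfK// mulrAC.
rewrite cintegralZr ?mulfVK//.
- exact: (integrable_dominated2 x r1 d1).
- exact: (integrable_dominated2 x r1 d2).
Qed.

(** For m < -s no integration by parts is needed, and Fubini's theorem turns the
joint integral into the iterated one. *)
Lemma osc_form_coincides m (a : W -> R[i]) k (u : tests Omega k) : m < - s%:R ->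
  is_symbol Omega m a -> (forall j, (j <= 0)%N -> le_order j k) ->
  osc_form phi 0 a u = cintegral Omega (fun x => osc_fun phi a x * u x).
Proof.
move=> ms sa pk; have /asboolP[cu ku su] := test_funP u.
have [U hU] := tests_test_bound (p := 0) pk ku (@subset_refl _ (supp u)).
have [C [c1 c2]] := symbol_camplitude oOmega ku su sa hU.
have sphi k' : Cn e k' (Omega `*` [set: 'rV[R]_s]) phi.
  by case: hphi => _ /symbol_csmooth/(_ k')[].
have [r [L [r1 L0 hd]]] := dominated_osc ku su sphi ms.
pose G z := a z * u z.1 * cexpi (phi z).
have GR : (fun z => complex.Re (G z)) = (fun z =>
    -1 * osc_integrand phi (- (pi / 2)) (fun z => complex.Im (a z * u z.1)) z +
    osc_integrand phi 0 (fun z => complex.Re (a z * u z.1)) z).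
  by apply/funext => z; rewrite /G cReM /osc_integrand addr0 cosBpihalf/=; ring.
have GI : (fun z => complex.Im (G z)) = (fun z =>
    1 * osc_integrand phi (- (pi / 2)) (fun z => complex.Re (a z * u z.1)) z +
    osc_integrand phi 0 (fun z => complex.Im (a z * u z.1)) z).
  by apply/funext => z; rewrite /G cImM /osc_integrand addr0 cosBpihalf/=; ring.
have d1 := hd 0 _ _ c1; have d2 := hd 0 _ _ c2.
have d3 := hd (- (pi / 2)) _ _ c1; have d4 := hd (- (pi / 2)) _ _ c2.
have dR := dominated_lin (-1) d4 d1; rewrite -GR normrN1 mul1r in dR.
have dI := dominated_lin 1 d3 d2; rewrite -GI normr1 mul1r in dI.
have TE : osc_form phi 0 a u = (Jint (fun z => complex.Re (G z)) +i* Jint (fun z =>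
    complex.Im (G z)))%C.
  rewrite GR GI (Jint_lin _ r1 d4 d1) (Jint_lin _ r1 d3 d2) /osc_form /complex_osc /=.
  by apply: complex_ext => /=; ring.
have Off x : ~ Omega x -> u x = 0.
  by move=> Ox; apply: (supp_off su).
have patchE (f : 'rV[R]_n -> R) : (forall x, ~ Omega x -> f x = 0) ->
    \int[lebesgueN R n]_(t in @rv_of_tuple R n @^-1` Omega) f (rv t) =
    \int[lebesgueN R n]_t f (rv t).
  move=> f0; rewrite Rintegral_mkcond; apply: eq_Rintegral => t _.
  rewrite patchE; case: ifPn => // /negP Ot; rewrite f0// => Ot'.
  by apply: Ot; rewrite inE.
rewrite TE /cintegral.
rewrite (patchE (fun x => complex.Re (osc_fun phi a x * u x))); last first.
  by move=> x /Off ->; rewrite mulr0.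
rewrite (patchE (fun x => complex.Im (osc_fun phi a x * u x))); last first.
  by move=> x /Off ->; rewrite mulr0.
rewrite (Jint_fubini r1 dR) (Jint_fubini r1 dI).
by apply: complex_ext => /=; apply: eq_Rintegral => t _;
  rewrite (osc_fun_mul (rv t) r1 dR dI) /cintegral preimage_setT.
Qed.

End coincidence.

(** * Uniqueness by regularization *)

Section regularization.
Context {R : realType} {n s : nat}.
Notation W := ('rV[R]_n * 'rV[R]_s)%type.
Notation I := ('I_n + 'I_s)%type.
Notation e := (@dirxt R n s).

(** A rational regularizer: it lowers the order by 2 for each eps > 0, and its
derivatives are controlled by [dbound_inv] with a constant free of eps. *)
Definition cutoff (eps : R) (z : W) : R := (1 + eps * theta_sq z)^-1.

Variable eps : R.
Hypotheses (eps0 : 0 < eps) (eps1 : eps <= 1).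

Lemma cutoff_den_gt0 (z : W) : 0 < 1 + eps * theta_sq z.
Proof. by rewrite ltr_pwDl// mulr_ge0 ?theta_sq_ge0// ltW. Qed.

Lemma Cn_cutoff_den k (A : set W) : open A -> Cn e k A (fun z => 1 + eps * theta_sq z).
Proof.
move=> oA; apply: Cn_add => //; first exact: Cn_cst.
by apply: Cn_mul => //; [exact: Cn_cst|exact: Cn_theta_sq].
Qed.

Lemma Cn_cutoff k (A : set W) : open A -> Cn e k A (cutoff eps).
Proof.
move=> oA; apply: Cn_inv => //; last exact: Cn_cutoff_den.
by move=> z _; rewrite gt_eqF// cutoff_den_gt0.
Qed.

Definition den_const (N : nat) : R := 1 + 2 ^+ N * (s%:R * 2 ^+ N) * 2.

Lemma den_const_ge0 N : 0 <= den_const N.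
Proof. by rewrite addr_ge0// !mulr_ge0// ?exprn_ge0. Qed.

Lemma bracket_sq_le (z : W) : bracket z ^+ 2 <= 2 * (1 + theta_sq z).
Proof.
rewrite tsqE /bracket; set t := enorm _.
by have := sqr_ge0 (1 - t); rewrite !expr2; lra.
Qed.

Lemma dbound_eps_theta_sq N (z : W) :
  dbound N (fun z => eps * theta_sq z) z (eps * (2 ^+ N * (s%:R * 2 ^+ N)) * bracket
      z ^+ 2).
Proof.
have := dbound_mul openT (z := z) Logic.I (Cn_cst e setT N eps) (Cn_theta_sq N openT)
  (@dbound_cst _ _ _ N eps z) (@dbound_theta_sq R n s N z).
apply: dbound_weak; rewrite ger0_norm ?(ltW eps0)//.
by rewrite le_eqVlt; apply/orP; left; apply/eqP; ring.
Qed.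

(** The weight is 1 + eps |theta|^2 itself, which absorbs eps (1 + |theta|)^2 up to
a factor 2 because eps <= 1; this is why the constant does not involve eps. *)
Lemma dbound_cutoff_den N (z : W) :
  dbound N (fun z => 1 + eps * theta_sq z) z (den_const N * (1 + eps * theta_sq z)).
Proof.
have := dbound_add openT (z := z) Logic.I (Cn_cst e setT N 1)
  (Cn_mul openT (Cn_cst e setT N eps) (Cn_theta_sq N openT))
  (@dbound_cst _ _ _ N 1 z) (@dbound_eps_theta_sq N z).
apply: dbound_weak; rewrite normr1 /den_const [leRHS]mulrDl mul1r; apply: lerD.
  by rewrite lerDl mulr_ge0 ?theta_sq_ge0// ltW.
set c := 2 ^+ N * _.
have c0 : 0 <= c by rewrite !mulr_ge0// exprn_ge0.
have -> : eps * c * bracket z ^+ 2 = c * (eps * bracket z ^+ 2) by ring.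
rewrite -mulrA ler_wpM2l//.
apply: (@le_trans _ _ (eps * (2 * (1 + theta_sq z)))).
  by rewrite ler_wpM2l ?(ltW eps0)// bracket_sq_le.
have -> : eps * (2 * (1 + theta_sq z)) = 2 * eps + 2 * (eps * theta_sq z) by ring.
move: eps1; lra.
Qed.

Definition cutoff_const N : R := inv_const (den_const N) N.

Lemma cutoff_const_ge0 N : 0 <= cutoff_const N.
Proof. by apply: (le_trans ler01); apply: inv_const_ge1; exact: den_const_ge0. Qed.

Lemma dbound_cutoff N (z : W) : dbound N (cutoff eps) z (cutoff_const N * (1 + eps *
    theta_sq z)^-1).
Proof.
have d0 := cutoff_den_gt0 z.
have hv : `|(1 + eps * theta_sq z)^-1| <= (1 + eps * theta_sq z)^-1.
  by rewrite ger0_norm// invr_ge0 ltW.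
have := dbound_inv openT (z := z) Logic.I (fun y _ => lt0r_neq0 (cutoff_den_gt0 y))
  (Cn_cutoff_den N openT) (@dbound_cutoff_den N z) hv.
by apply: dbound_weak; rewrite mulfK ?gt_eqF// mulrC.
Qed.

Lemma dbound_cutoff_decay N (z : W) :
  dbound N (cutoff eps) z (cutoff_const N * (2 / eps) * bracket z `^ (- 2)).
Proof.
apply: dbound_weak (@dbound_cutoff N z); rewrite -mulrA ler_wpM2l ?cutoff_const_ge0//.
rewrite powRN powR_mulrn ?(ltW (bracket_gt0 z))//.
rewrite ler_pdivlMr ?exprn_gt0 ?bracket_gt0// ler_pdivrMl ?cutoff_den_gt0//.
apply: (le_trans (bracket_sq_le z)).
rewrite mulrA ler_pdivlMr// [leRHS]mulrC -mulrA ler_wpM2l//.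
by rewrite mulrDl mul1r mulrC; move: eps1; lra.
Qed.

(** cutoff - 1 = - eps |theta|^2 cutoff: small in eps at the cost of two orders. *)
Lemma dbound_cutoff_sub1 N (z : W) : dbound N (fun z => cutoff eps z - 1) z
  (eps * (2 ^+ N * (2 ^+ N * (s%:R * 2 ^+ N)) * cutoff_const N * 2 ^+ N) * bracket z
      `^ 2).
Proof.
have b1 := dbound_mul openT (z := z) Logic.I
  (Cn_mul openT (Cn_cst e setT N eps) (Cn_theta_sq N openT)) (Cn_cutoff N openT)
  (@dbound_eps_theta_sq N z) (@dbound_cutoff N z).
have := dbound_mul openT (z := z) Logic.I (Cn_cst e setT N (-1))
  (Cn_mul openT (Cn_mul openT (Cn_cst e setT N eps) (Cn_theta_sq N openT)) (Cn_cutoff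
      N openT))
  (@dbound_cst _ _ _ N (-1) z) b1.
rewrite normrN1 => b2.
apply: (dbound_ext openT _ (z := z) Logic.I (dbound_weak _ b2)) => [y _|].
  rewrite /cutoff; have := cutoff_den_gt0 y; set t := eps * theta_sq y => t0.
  by field; rewrite gt_eqF.
rewrite powR_mulrn ?(ltW (bracket_gt0 z))//.
have v1 : (1 + eps * theta_sq z)^-1 <= 1.
  by rewrite invf_le1 ?cutoff_den_gt0// lerDl mulr_ge0 ?theta_sq_ge0// ltW.
set v := (1 + _)^-1 in v1 *; set c := s%:R * 2 ^+ N.
have -> : 2 ^+ N * 1 * (2 ^+ N * (eps * (2 ^+ N * c) * bracket z ^+ 2) *
    (cutoff_const N * v)) =
  (eps * (2 ^+ N * (2 ^+ N * c) * cutoff_const N * 2 ^+ N) * bracket z ^+ 2) * v by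
      ring.
rewrite ler_piMr// !mulr_ge0 ?exprn_ge0 ?cutoff_const_ge0 ?(ltW eps0) ?(ltW
    (bracket_gt0 z))//.
Qed.

Variables (Omega : set 'rV[R]_n) (m : R) (a : W -> R[i]).
Hypotheses (oOmega : open Omega) (sa : is_symbol Omega m a).

Let oO : open (Omega `*` [set: 'rV[R]_s]). Proof. exact: open_cylinder. Qed.

Definition regularize (z : W) : R[i] := a z * (cutoff eps z)%:C%C.

Lemma regularize_csmooth : csmooth Omega regularize.
Proof.
by apply: csmooth_mulr => //; [exact: symbol_csmooth sa|move=> k; exact: Cn_cutoff].
Qed.

Lemma regularize_symbol : is_symbol Omega (m - 2) regularize.
Proof.
apply: cdbound_is_symbol regularize_csmooth _ => // K N cK KO.
have [C C0 hC] := symbol_cdbound oOmega KO N cK sa.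
exists (2 ^+ N * C * (cutoff_const N * (2 / eps))).
apply: (cdbound_mulr oOmega KO (symbol_csmooth sa) _ hC); first exact: Cn_cutoff.
by move=> z _; exact: dbound_cutoff_decay.
Qed.

Lemma regularize_sub K N C : K `<=` Omega -> cdbound K N m a C ->
  cdbound K N (m + 2) (fun z => regularize z - a z)
   (eps * (2 ^+ N * C * (2 ^+ N * (2 ^+ N * (s%:R * 2 ^+ N)) * cutoff_const N * 2 ^+
       N))).
Proof.
move=> KO hC.
have -> : (fun z => regularize z - a z) = (fun z => a z * (cutoff eps z - 1)%:C%C).
  apply/funext => z; rewrite /regularize; case: (a z) => p q.
  by apply: complex_ext => /=; ring.
rewrite mulrCA.
apply: (cdbound_mulr oOmega KO (symbol_csmooth sa) _ hC); last first.
  by move=> z _; exact: dbound_cutoff_sub1.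
by apply: Cn_add => //; [exact: Cn_cutoff|exact: Cn_cst].
Qed.

End regularization.

Lemma cabsN (R : realType) (z : R[i]) : cabs (- z) = cabs z.
Proof. by case: z => a b /=; rewrite !sqrrN. Qed.

Section uniqueness.
Context {R : realType} {n s : nat}.
Notation W := ('rV[R]_n * 'rV[R]_s)%type.
Variables (Omega : set 'rV[R]_n) (phi : W -> R).
Hypotheses (oOmega : open Omega).
Notation Sy m := (symbols Omega s m).

(** The generating balls may be centred anywhere, hence the triangle inequality
for the seminorms. *)
Lemma symbols_cvg m (aj : nat -> Sy m) (a : Sy m) :
  (forall K alpha beta, compact K -> K `<=` Omega -> exists M, forall j,
    (symbol_norm m alpha beta K (fun z => (aj j z - a z)%R) <= (j.+1%:R^-1 *
        M)%:E)%E) ->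
  aj @ \oo --> a.
Proof.
move=> h.
have FF : Filter (aj @ \oo) by apply: fmap_filter; exact: eventually_filter.
apply: (subbase_cvg (@open_symbolsE R n s Omega m) FF).
move=> _ [_ [c [eps [[alpha [beta [K [cK KO ->]]]] eps0 ->]]]] /= hac.
have [M hM] := h K alpha beta cK KO.
have sub j : (symbol_norm m alpha beta K (fun z => (aj j z - c z)%R) <=
    symbol_norm m alpha beta K (fun z => (aj j z - a z)%R) +
    symbol_norm m alpha beta K (fun z => (a z - c z)%R))%E.
  have s1 := csmooth_sub oOmega (symbol_csmooth (symbolsP (aj j)))
    (symbol_csmooth (symbolsP a)).
  have s2 := csmooth_sub oOmega (symbol_csmooth (symbolsP a))
    (symbol_csmooth (symbolsP c)).
  have := symbol_norm_add oOmega m alpha beta KO s1 s2; congr (_ <= _)%E.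
  by congr symbol_norm; apply/funext => z; rewrite addrA subrK.
have {}hac : (symbol_norm m alpha beta K (fun z => (a z - c z)%R) < eps%:E)%E by [].
case E : (symbol_norm m alpha beta K (fun z => (a z - c z)%R)) hac sub => [r| |]//.
  rewrite lte_fin => re sub.
  have d0 : 0 < (eps - r) / (`|M| + 1) by rewrite divr_gt0 ?subr_gt0// ltr_pwDr.
  have := near_infty_natSinv_lt (PosNum d0); apply: filterS => j /= hj.
  apply: (le_lt_trans (sub j)); apply: (@le_lt_trans _ _ ((j.+1%:R^-1 * M)%:E +
      r%:E)%E).
    by rewrite leeD2r.
  rewrite -EFinD lte_fin -ltrBrDr.
  apply: (@le_lt_trans _ _ (j.+1%:R^-1 * (`|M| + 1))).
    by rewrite ler_wpM2l ?invr_ge0// (le_trans (ler_norm M))// lerDl.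
  by rewrite -ltr_pdivlMr// ltr_pwDr.
(* K is empty here, and the seminorm is -oo *)
move=> _ sub; exists 0%N => // j _ /=; apply: (le_lt_trans (sub j)).
by rewrite addeNy ltNyr.
Qed.

Lemma distr_nbhs k (T0 : distr Omega k) u (delta : R) : 0 < delta ->
  nbhs T0 [set T : distr Omega k | cabs (T u - T0 u) < delta].
Proof.
move=> d0; have := @subbase_nbhs _ _ (@open_distrE R n Omega k) T0
  [set T : distr Omega k | ((cabs (T u - T0 u))%:E < delta%:E)%E].
have -> : [set T : distr Omega k | ((cabs (T u - T0 u))%:E < delta%:E)%E] =
  [set T : distr Omega k | cabs (T u - T0 u) < delta].
  by apply/funext => T /=; rewrite lte_fin.
apply.
  exists (fun T => (cabs (T u))%:E), T0, delta; split; [by exists u|exact: d0|].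
  by apply/seteqP; split=> T /=; rewrite lte_fin.
by rewrite /= subrr Normc.normc0.
Qed.

(** Induction on k in steps of two orders, by density of order m - 2 in order m for
the topology of order m + 2. *)
Lemma Dphi_agree (D1 D2 : symbols_oo Omega s -> distr Omega None) k m (a : Sy m) u :
  is_Dphi phi D1 -> is_Dphi phi D2 -> m < - s%:R + 2 * k%:R ->
  D1 (symbol_incl a) u = D2 (symbol_incl a) u.
Proof.
move=> [H1 C1] [H2 C2]; elim: k m a => [|k IH] m a.
  by rewrite mulr0 addr0 => ms; rewrite H1// H2.
rewrite -[k.+1%:R]natr1 mulrDr mulr1 addrA -ltrBlDr => ms.
have sa := symbolsP a.
have za : zero_outside Omega a by have /asboolP[] := symbol_funP a.
have m2 : m - 2 <= m + 2 by rewrite lerBlDr -addrA lerDl addr_ge0.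
have mm2 : m <= m + 2 by rewrite lerDl.
pose eps (j : nat) : R := j.+1%:R^-1.
have eps0 j : 0 < eps j by rewrite invr_gt0.
have eps1 j : eps j <= 1 by rewrite invf_le1// ler1n.
have zr j : zero_outside Omega (regularize (eps j) a).
  by move=> z Oz; rewrite /regularize za// mul0r.
have lowP j : regularize (eps j) a \in symbol_pred Omega (m - 2).
  by apply/asboolP; split=> //; exact: regularize_symbol.
have highP j : regularize (eps j) a \in symbol_pred Omega (m + 2).
  by apply/asboolP; split=> //; apply: (is_symbol_mono oOmega m2); exact:
      regularize_symbol.
have aP : symbol_fun a \in symbol_pred Omega (m + 2).
  by apply/asboolP; split=> //; exact: is_symbol_mono sa.
pose low j := Symbol (lowP j); pose high j := Symbol (highP j); pose a' := Symbol aP.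
have lowhigh j : symbol_incl (high j) = symbol_incl (low j) by apply: val_inj.
have aa' : symbol_incl a' = symbol_incl a by apply: val_inj.
have cvg_high : high @ \oo --> a'.
  apply: symbols_cvg => K alpha beta cK KO.
  have [C C0 hC] := symbol_cdbound oOmega KO (mdegree alpha + mdegree beta) cK sa.
  eexists => j.
  have := cdbound_symbol_norm (regularize_sub (eps0 j) (eps1 j) oOmega sa KO hC).
  by rewrite -mulrDr; exact.
have conv (D : symbols_oo Omega s -> distr Omega None) (delta : R) :
    (forall m, continuous (fun b : Sy m => D (symbol_incl b))) -> 0 < delta ->
    \forall j \near \oo, cabs (D (symbol_incl (low j)) u - D (symbol_incl a) u) < delta.
  move=> CD d0.
  have h : \forall j \near \oo,
      cabs (D (symbol_incl (high j)) u - D (symbol_incl a') u) < delta.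
    exact: (cvg_high _ (CD (m + 2) a' _ (distr_nbhs (D (symbol_incl a')) u d0))).
  by apply: filterS h => j; rewrite lowhigh aa'.
apply/eqP; rewrite -subr_eq0; apply/eqP/Normc.eq0_normc/eqP.
rewrite eq_le cabs_ge0 andbT; apply/ler_addgt0Pr => delta d0; rewrite add0r.
have d2 : 0 < delta / 2 by rewrite divr_gt0.
have : \forall j \near \oo, cabs (D1 (symbol_incl a) u - D2 (symbol_incl a) u) <= delta.
  have h1 := conv D1 _ C1 d2; have h2 := conv D2 _ C2 d2.
  apply: filterS2 h1 h2 => j h1 h2.
  have E := IH _ (low j) ms.
  have -> : D1 (symbol_incl a) u - D2 (symbol_incl a) u =
    (D2 (symbol_incl (low j)) u - D2 (symbol_incl a) u) +
    - (D1 (symbol_incl (low j)) u - D1 (symbol_incl a) u) by rewrite E; ring.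
  apply: (le_trans (cabsD _ _)); rewrite cabsN.
  by rewrite ltW// (splitr delta) ltrD.
by move=> /filter_ex[].
Qed.

Lemma Dphi_unique (D1 D2 : symbols_oo Omega s -> distr Omega None) :
  is_Dphi phi D1 -> is_Dphi phi D2 -> D1 = D2.
Proof.
move=> H1 H2; apply/funext => a; apply: val_inj; apply/funext => u /=.
have /asboolP[[m sa] za] := symbol_oo_funP a.
have aP : symbol_oo_fun a \in symbol_pred Omega m by apply/asboolP; split.
have -> : a = symbol_incl (Symbol aP) by apply: val_inj.
apply: (@Dphi_agree D1 D2 (Num.bound `|m + s%:R|) m) => //.
have := archi_boundP (normr_ge0 (m + s%:R)).
have := ler_norm (m + s%:R); have := ler0n R (Num.bound `|m + s%:R|); lra.
Qed.

End uniqueness.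

(** * Existence *)

Section existence.
Context {R : realType} {n s : nat}.
Notation W := ('rV[R]_n * 'rV[R]_s)%type.
Variables (Omega : set 'rV[R]_n) (mu : R) (phi : W -> R).
Hypotheses (oOmega : open Omega) (hphi : is_phase Omega mu phi).

(** How many integrations by parts are enough: p > (m + s) / mu. *)
Lemma parts_number (m : R) : exists p : nat, m - p%:R * mu < - s%:R.
Proof.
have mu0 : 0 < mu by case: hphi.
exists (Num.bound `|(m + s%:R) / mu|).
have h := archi_boundP (normr_ge0 ((m + s%:R) / mu)).
have := le_lt_trans (ler_norm _) h; rewrite ltr_pdivrMr//; lra.
Qed.

Lemma symbol_oo_order (a : symbols_oo Omega s) :
  exists mp : R * nat, is_symbol Omega mp.1 a /\ mp.1 - mp.2%:R * mu < - s%:R.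
Proof.
have /asboolP[[m sa] _] := symbol_oo_funP a; have [p hp] := parts_number m.
by exists (m, p).
Qed.

Definition osc_distribution (a : symbols_oo Omega s) : distr Omega None :=
  let mp := cid (symbol_oo_order a) in
  osc_distr oOmega hphi (k := None) (fun _ _ => Logic.I) (svalP mp).2 (svalP mp).1.

Lemma osc_distributionE m p (a : symbols_oo Omega s) u : m - p%:R * mu < - s%:R ->
  is_symbol Omega m a -> osc_distribution a u = osc_form phi p a u.
Proof.
move=> ms sa; rewrite /osc_distribution; case: cid => -[m' p'] [/= sa' ms'].
exact: (osc_form_indep oOmega hphi u ms' ms sa' sa).
Qed.

Lemma osc_distribution_is_Dphi : is_Dphi phi osc_distribution.
Proof.
split=> [m a ms u|m].
  have sa := symbolsP a.
  rewrite (@osc_distributionE m 0)//; last by rewrite mul0r subr0.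
  exact: (osc_form_coincides oOmega hphi u ms sa (fun _ _ => Logic.I)).
have [p ms] := parts_number m.
apply: (continuous_osc_form oOmega hphi (k := None) (fun _ _ => Logic.I) ms) => a u.
by apply: (@osc_distributionE m p) => //; exact: symbolsP.
Qed.

End existence.

Theorem theorem2p9 (R : realType) (n s : nat) (Omega : set 'rV[R]_n)
    (mu : R) (phi : 'rV[R]_n * 'rV[R]_s -> R) :
  open Omega -> is_phase Omega mu phi ->
  exists D : symbols_oo Omega s -> distr Omega None,
    [/\ is_Dphi phi D,
        (forall D', is_Dphi phi D' -> D' = D) &
        forall (p : nat) (m : R), m - p%:R * mu < - s%:R ->
          exists Dp : symbols Omega s m -> distr Omega (Some p),
            continuous Dp /\
            forall a u, Dp a (test_incl p u) = D (symbol_incl a) u].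
Proof.
move=> oOmega hphi; exists (osc_distribution oOmega hphi); split.
- exact: osc_distribution_is_Dphi.
- by move=> D' hD'; exact: (Dphi_unique oOmega hD' (osc_distribution_is_Dphi oOmega
      hphi)).
move=> p m ms.
pose Dp (a : symbols Omega s m) : distr Omega (Some p) :=
  osc_distr oOmega hphi (k := Some p) (fun j jp => jp) ms (symbolsP a).
exists Dp; split; first exact: (continuous_osc_form oOmega hphi (k := Some p) _ ms).
by move=> a u; rewrite (@osc_distributionE _ _ _ _ _ _ oOmega hphi m p (symbol_incl
    a) u ms (symbolsP a)).
Qed.
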